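(* Let $k\ge1$, $x\ge1$ and $3\le y_1\le\cdots\le y_k$ with $2^ky_1\cdots y_k\le x/y_k$. Then, with $y_0=3$, $$\frac{H^{(k+1)}(x,\mathbf{y},2\mathbf{y})}{x}\asymp_k\prod_{i=1}^k\left(\frac{\log y_i}{\log y_{i-1}}\right)^{-(k-i+2)}\sum_{\mathbf{a}\in\mathscr{P}_*^k(\mathbf{y})}\frac{L^{(k+1)}(\mathbf{a})}{a_1\cdots a_k}.$$
   Context: $H^{(k+1)}(x,\mathbf{y},\mathbf{z})$ is the number of positive integers $n\le x$ for which there exist positive integers $d_1,\dots,d_k$ with $d_1\cdots d_k\mid n$ and $y_i<d_i\le z_i$ ($1\le i\le k$); $2\mathbf{y}=(2y_1,\dots,2y_k)$. For $\mathbf{a}=(a_1,\dots,a_k)\in\mathbb{N}^k$, $L^{(k+1)}(\mathbf{a})$ is the $k$-dimensional Lebesgue measure of the set $\bigcup [\log(d_1/2),\log d_1)\times\cdots\times[\log(d_k/2),\log d_k)$, the union over all $(d_1,\dots,d_k)\in\mathbb{N}^k$ with $d_1\cdots d_i\mid a_1\cdots a_i$ for all $1\le i\le k$. For $1\le y<z$, $\mathscr{P}_*(y,z)$ is the set of squarefree positive integers all of whose prime factors $p$ satisfy $y<p\le z$ (including $1$). For $1\le t_1\le\cdots\le t_k$ and $t_0=1$, $\mathscr{P}_*^k(\mathbf{t})=\{\mathbf{a}\in\mathbb{N}^k: a_i\in\mathscr{P}_*(t_{i-1},t_i),\ 1\le i\le k\}$. *)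

(* Defs.v *)
From HB Require Import structures.
From mathcomp Require Import all_boot all_order all_algebra.
From mathcomp Require Import all_classical all_reals all_analysis.

Set Implicit Arguments.
Unset Strict Implicit.
Unset Printing Implicit Defensive.

Import Order.TTheory GRing.Theory Num.Theory.
Import numFieldNormedType.Exports.

Local Open Scope classical_set_scope.
Local Open Scope ring_scope.

(* Convention: all k-dimensional objects (y, z, d, a, t) are functions on nat
   and only their coordinates 1..k are meaningful (1-indexed, as in the paper). *)

Section Defs.
Variable R : realType.

Definition Hcount (k : nat) (x : R) (y z : nat -> R) : nat :=
  \sum_(n < (Num.truncn x).+1 |
        (0 < n)%N && (n%:R <= x) &&
        `[< exists d : nat -> nat,
              (forall i, (1 <= i <= k)%N -> (0 < d i)%N) /\
              ((\prod_(1 <= i < k.+1) d i) %| n)%N /\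
              (forall i, (1 <= i <= k)%N -> y i < (d i)%:R <= z i) >]) 1%N.

(* k-dimensional Lebesgue measure of a set S of points t = (t_1,...,t_k)
   (coordinates 1..k of t : nat -> R), defined as the iterated integral of
   its indicator against the one-dimensional Lebesgue measure
   (Tonelli; coordinates are integrated in the order t_k (outermost), ..., t_1). *)
Fixpoint iter_leb_int (n : nat) (f : (nat -> R) -> \bar R) : \bar R :=
  match n with
  | 0%N => f (fun _ => 0)
  | m.+1 => (\int[@lebesgue_measure R]_(s in setT)
              iter_leb_int m (fun g => f (fun i => if i == m.+1 then s else g i)))%E
  end.

Definition lebesgue_k (k : nat) (S : set (nat -> R)) : \bar R :=
  iter_leb_int k (fun t => (\1_S t)%:E).

Definition Lset (k : nat) (a : nat -> nat) : set (nat -> R) :=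
  [set t | exists d : nat -> nat,
      (forall i, (1 <= i <= k)%N -> (0 < d i)%N) /\
      (forall i, (1 <= i <= k)%N ->
         ((\prod_(1 <= j < i.+1) d j) %| (\prod_(1 <= j < i.+1) a j))%N) /\
      (forall i, (1 <= i <= k)%N ->
         ln ((d i)%:R / 2) <= t i < ln ((d i)%:R))].

Definition Lk (k : nat) (a : nat -> nat) : \bar R := lebesgue_k k (Lset k a).

Definition Pstar (y z : R) (a : nat) : Prop :=
  (0 < a)%N /\
  (forall p, prime p -> (p %| a)%N -> ~~ (p ^ 2 %| a)%N /\ y < p%:R <= z).

(* P_*^k(t) with t_0 = 1; an element a in N^k is represented by a function
   nat -> nat whose coordinates outside 1..k are normalised to 1. *)
Definition Pstar_k (k : nat) (t : nat -> R) : set (nat -> nat) :=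
  [set a | (forall i, (1 <= i <= k)%N ->
              Pstar (if i == 1%N then 1 else t i.-1) (t i) (a i)) /\
           (forall i, ~~ (1 <= i <= k)%N -> a i = 1%N)].

Definition Lsum (k : nat) (y : nat -> R) : \bar R :=
  (\esum_(a in Pstar_k k y)
     Lk k a * ((\prod_(1 <= i < k.+1) (a i)%:R)^-1)%:E)%E.

Definition logprod (k : nat) (y : nat -> R) : R :=
  \prod_(1 <= i < k.+1)
     (ln (y i) / ln (if i == 1%N then 3 else y i.-1)) ^- (k - i + 2).

End Defs.

(* Main.v *)
Require Import Defs.
From HB Require Import structures.
From mathcomp Require Import all_boot all_order all_algebra.
From mathcomp Require Import all_classical all_reals all_analysis.
From mathcomp Require Import fingroup perm measurable_realfun.
From mathcomp Require Import zify ring lra.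
Set Implicit Arguments.
Unset Strict Implicit.
Unset Printing Implicit Defensive.
Import Order.TTheory GRing.Theory Num.Theory.
Import numFieldNormedType.Exports.
Local Open Scope ring_scope.

(** Put [Y_i] for the integer part of [y_i] and let [Nt Y A] count the dyadic
    cells met by the vectors [d] with [d_1...d_k | A] and [d_i] free of primes
    above [Y_i].  For [A = a_1...a_k] the volume [L(a)] is comparable to
    [Nt Y A], so the sum over [a] is comparable to
    [S = sum_A Nt Y A / A] over squarefree [Y_k]-smooth [A].  As
    [logprod = (log 3)^(k+1) / (log y_1 ... log y_k * log y_k)], one has to
    compare [H] with [x S / (log y_1 ... log y_k * log y_k)].

    Lower bound: consider [n = A p_1...p_k b] with [A] squarefree, having small
    [Y_i]-smooth parts and no prime in the windows where the [p_i] live, such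
    that some [d] in a cell of [A] has [Y_i < d_i p_i <= 2 Y_i], and [b] without
    small primes.  Each cell admits about [1 / log Y_i] primes [p_i] (weighted
    by [1 / p]), the sieve supplies [b], and [n] has boundedly many such
    representations.

    Upper bound: write [n = d_1...d_{k+1}] with [d_{k+1}] the cofactor, in a
    dyadic range, remove the largest prime factor of every [d_j], and order
    these primes.  All but the largest are [p_1 <= ... <= p_k], [A] is the
    [p_k]-smooth part of the rest, and [b] is what remains.  If all [log p_i]
    have the expected size the count is as above.  If some [p_i] is smaller
    than expected by a factor [2^r] in the exponent, then [A] has an abnormally
    large smooth part, which by Rankin's trick costs a factor
    [exp (- 2^r / 8)]; this beats the loss of a power of [2^r].

    The function [Nt Y] is only submultiplicative in the weak sense
    [Nt (A q^v) <= (2 (v + 1))^k Nt A]; all Euler product arguments are carried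
    out by induction on the primes for functions with that property. *)

(** * Chebyshev bounds and Bertrand's postulate *)

Section Chebyshev.
Local Open Scope nat_scope.

(** The arithmetic input is of Chebyshev type throughout: primes in [(u, 2u]] come from the central
    binomial coefficient, and integers without primes below [z] are counted by weighting each with
    its logarithm and expanding that over prime powers. Uniqueness shapes the lower bound: [A] must
    be recoverable from [n], so no prime of [A] may lie where a [p_i] or a prime cofactor can. The
    bound [d_i^2 <= Y_i] keeps [p_i] above a fixed root [v_i] of [Y_i], so the windows to be cleared
    reach only from [v_i] to [2 Y_i]; the sum of [1/p] over such a window is bounded, and clearing
    it costs a constant. The factor [y_k] in the hypothesis on [x] is used twice. Below, it leaves
    the cofactor [b] a range of length at least about [sqrt Y_k]; above, it makes the logarithm of
    [d_{k+1}] a fixed proportion of [log Y_k], apart from the few [n] up to about [x / sqrt Y_k].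
    From [NtReal] on the dimension is written [k.+1], so that the last index [ord_max] exists. *)

Lemma prod_primes_dvd (a b N : nat) (P : pred nat) :
  (forall p, a <= p < b -> P p -> prime p /\ p %| N) ->
  \prod_(a <= p < b | P p) p %| N.
Proof.
move=> H; have [ab|ba] := leqP a b; last by rewrite big_geq ?dvd1n // ltnW.
have -> : b = a + (b - a) by lia.
have : a + (b - a) <= b by lia.
elim: (b - a) => [|m IH] hb; first by rewrite addn0 big_geq ?dvd1n.
rewrite addnS big_mkcond big_nat_recr /= ?leq_addr // -big_mkcond /=.
have IH' := IH ltac:(lia).
case: ifP => [Pp|_]; last by rewrite muln1.
have [pr dv] := H (a + m) ltac:(lia) Pp.
rewrite Gauss_dvd ?IH' //; rewrite coprime_sym prime_coprime //.
rewrite big_seq_cond; apply/negP.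
elim/big_ind: _ => [|x y hx hy|i /andP[]]; rewrite ?dvdn1 ?Euclid_dvdM //.
- by apply/negP; rewrite neq_ltn prime_gt1 // orbT.
- by move=> /orP[].
rewrite mem_index_iota => hi Pi; have [pri _] := H i ltac:(lia) Pi.
by rewrite dvdn_prime2 //; lia.
Qed.

Definition primorial n := \prod_(0 <= p < n.+1 | prime p) p.

Lemma primorialS n :
  primorial n.+1 = primorial n * (if prime n.+1 then n.+1 else 1).
Proof. by rewrite /primorial big_mkcond big_nat_recr //= -big_mkcond. Qed.

(** [p] occurs in [n!] but in neither [m!] nor [(n-m)!]. *)
Lemma prime_dvd_binomial n m p : prime p -> m < p -> n - m < p -> p <= n -> m <= n ->
  p %| 'C(n, m).
Proof.
move=> pr mp nmp pn mn.
have /eqP := bin_fact mn.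
have : p %| n`! by rewrite dvdn_fact // prime_gt0.
move=> + /eqP h; rewrite -h !Euclid_dvdM //.
have nf k : k < p -> ~~ (p %| k`!).
  elim: k => [|k IH] hk; first by rewrite fact0 dvdn1 neq_ltn prime_gt1 ?orbT.
  rewrite factS Euclid_dvdM // negb_or IH ?andbT; last lia.
  by rewrite gtnNdvd.
by rewrite (negbTE (nf _ mp)) (negbTE (nf _ nmp)) !orbF.
Qed.

(** The two middle coefficients coincide, and together they are at most the full sum [2^(2m+1)]. *)
Lemma bin_odd_mid_le m : 'C(m.*2.+1, m) <= 4 ^ m.
Proof.
have h : 'C(m.*2.+1, m) + 'C(m.*2.+1, m.+1) <= 2 ^ (m.*2.+1).
  have := expnDn 1 1 m.*2.+1; rewrite addn1 => ->.
  have hm : m < m.*2.+2 by lia.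
  have hm1 : m.+1 < m.*2.+2 by lia.
  rewrite (bigD1 (Ordinal hm)) //= (bigD1 (Ordinal hm1)) /=; last first.
    by rewrite -val_eqE /=; lia.
  by rewrite !exp1n !muln1 addnA leq_addr.
have e : 'C(m.*2.+1, m.+1) = 'C(m.*2.+1, m).
  have -> : m.+1 = m.*2.+1 - m by lia.
  by rewrite bin_sub //; lia.
have e2 : 2 ^ (m.*2.+1) = 2 * 4 ^ m by rewrite expnS -mul2n expnM.
by move: h; rewrite e e2; lia.
Qed.

(** Erdos's argument. An even number above 2 adds no prime; for [2m+1], the primes in [[m+2, 2m+1]]
    divide the middle coefficient, at most [4^m], and induction covers those up to [m+1]. *)
Lemma primorial_le n : primorial n <= 4 ^ n.
Proof.
elim/ltn_ind: n => n IH.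
case: n IH => [|n] IH; first by rewrite /primorial unlock.
have [/eqP ->|n0] := boolP (n == 0); first by rewrite /primorial unlock.
have [oddn|evn] := boolP (odd n).
  have [/eqP ->|n1] := boolP (n == 1); first by rewrite /primorial unlock.
  rewrite primorialS ifF ?muln1; last first.
    apply/negP => pr; have := even_prime pr; rewrite /= oddn; case => //; lia.
  by apply: leq_trans (IH n _) _; rewrite ?leq_exp2l.
pose m := n./2; have nE : n = m.*2 by rewrite /m; lia.
rewrite nE in IH n0 *.
rewrite /primorial (@big_cat_nat _ _ _ m.+2) //=; last by lia.
rewrite -addnn -addnS expnD mulnC leq_mul ?IH //; last lia.
  apply: leq_trans (bin_odd_mid_le m).
  apply: dvdn_leq; first by rewrite bin_gt0; lia.
  rewrite -addnn in nE *.
  apply: prod_primes_dvd => p hp pr; split => //.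
  apply: prime_dvd_binomial => //; lia.
Qed.

Definition central n := 'C(n.*2, n).

Lemma central_lower n : 0 < n -> 4 ^ n <= n.*2 * central n.
Proof.
elim: n => // n IH _; have [/eqP->|n0] := boolP (n == 0); first by [].
have h1 : n.+1 * central n.+1 = (n.*2.+1).*2 * central n.
  rewrite /central doubleS.
  have e1 := mul_bin_diag n.*2.+2 n; rewrite /= in e1.
  have e2 := mul_bin_down n.*2.+1 n; rewrite /= in e2.
  have -> : n.+1 * 'C(n.*2.+2, n.+1) = n.*2.+2 * 'C(n.*2.+1, n) by rewrite e1.
  have e3 : n.*2.+1 - n = n.+1 by lia.
  rewrite e3 in e2.
  have -> : n.*2.+2 = n.+1 * 2 by lia.
  by rewrite -mulnA mulnCA -e2; lia.
have := IH ltac:(lia); rewrite expnS => {}IH.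
have -> : n.+1.*2 * central n.+1 = 2 * ((n.*2.+1).*2 * central n).
  by rewrite -h1; lia.
nia.
Qed.

Lemma central_gt0 n : 0 < central n.
Proof. by rewrite bin_gt0; lia. Qed.

(** Legendre's formula for [(2n)! = c(n) n!^2]. The truncated subtraction is exact, and each summand
    is 0 or 1. *)
Lemma logn_centralE p n : prime p ->
  logn p (central n) = \sum_(1 <= k < n.*2.+1) (n.*2 %/ p ^ k - (n %/ p ^ k).*2).
Proof.
move=> pr; have nn : n <= n.*2 by lia.
have h := bin_fact nn.
have := congr1 (logn p) h.
have n2 : n.*2 - n = n by lia.
rewrite n2 !lognM ?muln_gt0 ?fact_gt0 ?bin_gt0 // -/(central n) !logn_fact //.
have sumle : \sum_(1 <= k < n.*2.+1) n %/ p ^ k = \sum_(1 <= k < n.+1) n %/ p ^ k.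
  rewrite (@big_cat_nat _ _ _ n.+1) //=; try lia.
  rewrite [X in _ + X]big_nat_cond [X in _ + X]big1 ?addn0 // => k hk.
  rewrite divn_small //; apply: (@leq_ltn_trans k); first by case/andP: hk => /andP[/ltnW].
  by apply: ltn_expl; rewrite prime_gt1.
rewrite -sumle => e.
suff -> : \sum_(1 <= k < n.*2.+1) (n.*2 %/ p ^ k - (n %/ p ^ k).*2) =
   \sum_(1 <= k < n.*2.+1) (n.*2 %/ p ^ k) - \sum_(1 <= k < n.*2.+1) (n %/ p ^ k).*2.
  have -> : \sum_(1 <= k < n.*2.+1) (n %/ p ^ k).*2 =
     (\sum_(1 <= k < n.*2.+1) (n %/ p ^ k)).*2.
    by rewrite -[RHS]muln2 big_distrl; apply: eq_bigr => k _; exact: esym (muln2 _).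
  move: e; lia.
rewrite sumnB // => k _.
rewrite leq_divRL ?expn_gt0 ?prime_gt0 //.
by have := leq_trunc_div n (p ^ k); lia.
Qed.

Lemma double_divn_sub_le1 p k n : 0 < p ^ k -> n.*2 %/ p ^ k - (n %/ p ^ k).*2 <= 1.
Proof.
move=> pk0; set q := p ^ k in pk0 *.
have e := divn_eq n q; have l := ltn_pmod n pk0.
have : n.*2 %/ q < (n %/ q).*2 + 2 by rewrite ltn_divLR //; lia.
lia.
Qed.

Lemma pfactor_central_le p n : prime p -> 0 < n -> p ^ logn p (central n) <= n.*2.
Proof.
move=> pr n0; have p1 := prime_gt1 pr.
apply: leq_trans (trunc_logP p1 _); last by lia.
rewrite leq_exp2l // logn_centralE //.
set T := trunc_log p n.*2.
have TL : T <= n.*2.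
  rewrite -(leq_exp2l _ _ p1); apply: leq_trans (trunc_logP p1 _) _; first lia.
  exact/ltnW/ltn_expl.
rewrite (@big_cat_nat _ _ _ T.+1) //=.
rewrite [X in _ + X]big_nat_cond [X in _ + X]big1 ?addn0; last first.
  move=> k hk; rewrite divn_small ?sub0n //.
  apply: leq_trans (trunc_log_ltn _ p1) _; rewrite leq_exp2l //; lia.
apply: (@leq_trans (\sum_(1 <= k < T.+1) 1)).
  by apply: leq_sum => k _; apply: double_divn_sub_le1; rewrite expn_gt0 prime_gt0.
by rewrite sum_nat_const_nat; lia.
Qed.

Lemma logn_central_le1 p n : prime p -> 0 < n -> n.*2 < p ^ 2 -> logn p (central n) <= 1.
Proof.
move=> pr n0 h; rewrite leqNgt; apply/negP => h2; have := pfactor_central_le pr n0.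
rewrite leqNgt => /negP; apply; apply: leq_trans h _.
by rewrite (leq_exp2l _ _ (prime_gt1 pr)).
Qed.

(** For [2n/3 < p <= n] the multiples [p] and [2p] in [(2n)!] cancel the two copies of [p] in
    [n!^2]; powers from [p^2] on exceed [2n] because [p > 2]. *)
Lemma logn_central0 p n : prime p -> 2 < p -> n.*2 < 3 * p -> p <= n ->
  logn p (central n) = 0.
Proof.
move=> pr p2 h pn; rewrite logn_centralE //.
rewrite big_nat_cond big1 // => k /andP[hk _].
have [->|k1] := eqVneq k 1.
  have p0 := prime_gt0 pr.
  have h1 : 0 < n %/ p by rewrite divn_gt0.
  have h2 : n.*2 %/ p < 3 by rewrite ltn_divLR.
  by rewrite expn1; lia.
rewrite divn_small ?sub0n //.
have : p ^ 2 <= p ^ k by rewrite (leq_exp2l _ _ (prime_gt1 pr)) //; lia.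
by apply: leq_trans; rewrite expnS expn1; nia.
Qed.

Definition primes_in a b := \sum_(a.+1 <= p < b.+1 | prime p) 1.

(** Primes up to [s] contribute at most [2n] each, those in [(s, 2n/3]] at most once and so are
    bounded by [primorial], those in [(2n/3, n]] drop out. Each prime in [(n, 2n]] is charged a full
    [2n], so that the exponent records how many there are. *)
Lemma central_upper n s : 2 < n -> n.*2 < s.+1 ^ 2 ->
  central n <= n.*2 ^ (s + primes_in n n.*2) * 4 ^ (n.*2 %/ 3).
Proof.
move=> n2 hs; have n0 : 0 < n by lia.
have big k : 0 < n.*2 ^ k by rewrite expn_gt0; lia.
have [sn|ns] := leqP n.*2 s.
  have : central n <= 4 ^ n.
    have := bin_odd_mid_le n; apply: leq_trans.
    by rewrite /central leq_bin2l; lia.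
  move=> h; apply: leq_trans h _; apply: leq_trans (leq_pmulr _ _); last by rewrite expn_gt0.
  apply: leq_trans (leq_pexp2l _ (_ : n <= _)); try lia.
  by apply: leq_trans (_ : (n.*2) ^ n <= _); rewrite ?leq_exp2r //; lia.
pose f p := p ^ logn p (central n).
have cE : central n = \prod_(0 <= p < n.*2.+1) f p.
  rewrite -[LHS]partnT ?central_gt0 //.
  rewrite (@widen_partn (central n + n.*2)) ?leq_addr //=.
  rewrite (@big_cat_nat _ _ _ n.*2.+1) //=; try lia.
  rewrite [X in _ * X]big_nat_cond [X in _ * X]big1 ?muln1 // => p /andP[hp _].
  have [pr|npr] := boolP (prime p); last by rewrite lognE (negbTE npr).
  rewrite logn_centralE // big_nat_cond big1 ?expn0 // => j /andP[hj _].
  rewrite divn_small ?sub0n // (@leq_trans p) //; first by lia.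
  by rewrite -{1}[p]expn1 (leq_exp2l _ _ (prime_gt1 pr)) //; lia.
have f_gt0 p : 0 < f p.
  rewrite /f; case: p => [|p]; first by rewrite lognE.
  by rewrite expn_gt0.
have fnp p : ~~ prime p -> f p = 1 by move=> h; rewrite /f lognE (negbTE h).
have part1 : \prod_(0 <= p < s.+1) f p <= n.*2 ^ s.
  rewrite big_nat_recl // /f [X in X * _](_ : _ = 1); last by rewrite lognE.
  rewrite mul1n; apply: (@leq_trans (\prod_(0 <= p < s) n.*2)).
    apply: leq_prod => p _; have [pr|npr] := boolP (prime p.+1); first exact: pfactor_central_le.
    by have := fnp _ npr; rewrite /f => ->; lia.
  by rewrite prod_nat_const_nat subn0.
have f_le1 p : s < p -> prime p -> f p <= p.
  move=> hp pr; rewrite -{2}[p]expn1 (leq_exp2l _ _ (prime_gt1 pr)) //.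
  by apply: logn_central_le1 => //; apply: leq_trans hs _; rewrite leq_exp2r.
have part3 : \prod_(n.+1 <= p < n.*2.+1) f p <= n.*2 ^ primes_in n n.*2.
  rewrite /primes_in (big_morph _ (expnD n.*2) (expn0 _)) [leqRHS]big_mkcond /=.
  rewrite big_nat_cond [leqRHS]big_nat_cond; apply: leq_prod => p /andP[hp _].
  case: ifP => pr; last by rewrite fnp ?pr.
  rewrite ?expn1; exact: pfactor_central_le.
have part2 : \prod_(s.+1 <= p < n.+1) f p <= 4 ^ (n.*2 %/ 3).
  apply: leq_trans (primorial_le _).
  have [ns'|sn'] := leqP n s.
    by rewrite big_geq //; apply: prodn_cond_gt0 => p /prime_gt0.
  apply: (@leq_trans (\prod_(0 <= p < n.+1) (if (p <= n.*2 %/ 3) && prime p then p else 1))).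
    rewrite [leqRHS](@big_cat_nat _ _ _ s.+1) //=; try lia.
    rewrite -[leqLHS]mul1n leq_mul //.
      by apply: prodn_gt0 => p; case: ifP => // /andP[_ /prime_gt0].
    rewrite big_nat_cond [leqRHS]big_nat_cond; apply: leq_prod => p /andP[hp _].
    have [pr|npr] := boolP (prime p); last by rewrite fnp // andbF.
    rewrite andbT; case: ifP => hp3; first by apply: f_le1 => //; lia.
    rewrite /f logn_central0 //; lia.
  rewrite (@big_cat_nat _ _ _ (n.*2 %/ 3).+1) //=; try lia.
  rewrite [X in _ * X]big_nat_cond [X in _ * X]big1 ?muln1; last first.
    by move=> p /andP[hp _]; rewrite ifF //; lia.
  rewrite /primorial [leqRHS]big_mkcond big_nat_cond [leqRHS]big_nat_cond.
  by apply: leq_prod => p /andP[hp _]; case: (prime p); rewrite ?andbF // andbT; case: ifP => //; lia.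
have [ns'|sn'] := leqP n s.
  rewrite cE (@big_cat_nat _ _ _ s.+1) //=; try lia.
  rewrite -[leqLHS]muln1; apply: leq_mul; last by rewrite expn_gt0.
  rewrite expnD; apply: leq_mul => //.
  apply: leq_trans part3.
  rewrite [leqRHS](@big_cat_nat _ _ _ s.+1) //=; try lia.
  by apply: leq_pmull; apply: prodn_gt0.
rewrite cE (@big_cat_nat _ _ _ s.+1) //=; try lia.
rewrite (@big_cat_nat _ _ _ n.+1 s.+1) //=; try lia.
by rewrite expnD mulnAC -mulnA; apply: leq_mul => //; apply: leq_mul.
Qed.

Lemma primes_in_gt0 a b p : prime p -> a < p <= b -> 0 < primes_in a b.
Proof.
move=> pr /andP[ap pb]; rewrite /primes_in big_mkcond (@big_cat_nat _ _ _ p) //=; try lia.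
rewrite [X in _ + X]big_ltn ?ltnS // pr; lia.
Qed.

(** A chain of primes up to 4099, each at most twice its predecessor, meets every interval [(n, 2n]]
    in this range. *)
Lemma bertrand_small n : 0 < n -> n < 2 ^ 12 -> 0 < primes_in n n.*2.
Proof.
move=> n0; rewrite (_ : 2 ^ 12 = 4096) // => hn.
have step p q : prime p -> q < p <= q.*2 ->
  (n < q -> 0 < primes_in n n.*2) -> n < p -> 0 < primes_in n n.*2.
  move=> pr hpq IH np; have [|qn] := ltnP n q; first exact: IH.
  by apply: (@primes_in_gt0 _ _ p) => //; lia.
have : n < 4099 by lia.
do ![apply: (step 4099 2053)|apply: (step 2053 1031)|apply: (step 1031 521)
  |apply: (step 521 263)|apply: (step 263 137)|apply: (step 137 71)
  |apply: (step 71 37)|apply: (step 37 19)|apply: (step 19 11)|apply: (step 11 7)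
  |apply: (step 7 5)|apply: (step 5 3)|apply: (step 3 2)|apply: (step 2 1)|by vm_compute].
by lia.
Qed.

(** Comparing exponents of 2 in the two bounds for [central n] gives [2n <= (e+1)(s+c+1) + 2(2n/3)].
    As [(e+1)(s+1) <= 2^(e-2) <= n/2], there remains [n/6 <= (e+1)c], whence the constant 6. *)
Lemma bertrand_large n : 2 ^ 12 <= n ->
  n <= 6 * primes_in n n.*2 * (trunc_log 2 n.*2).+1.
Proof.
move=> hn; set c := primes_in _ _; set e := trunc_log 2 n.*2.
have n0 : 0 < n by apply: leq_trans hn; rewrite expn_gt0.
have he : 2 ^ e <= n.*2 by apply: trunc_logP; lia.
have he1 : n.*2 < 2 ^ e.+1 by apply: trunc_log_ltn.
have e13 : 13 <= e by apply: trunc_log_max => //; rewrite expnS; lia.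
pose f := e./2; pose s := 2 ^ f.+1.
have hs : n.*2 < s.+1 ^ 2.
  apply: leq_trans he1 _; apply: (@leq_trans (s ^ 2)); last by rewrite leq_exp2r.
  by rewrite /s -expnM leq_exp2l // /f; lia.
have n2 : 2 < n by apply: leq_trans hn.
have := central_upper n2 hs; rewrite -/c => hC.
have := central_lower n0 => hL.
have {}hL : 4 ^ n <= n.*2 ^ (s + c).+1 * 4 ^ (n.*2 %/ 3).
  apply: leq_trans hL _; rewrite expnS -mulnA leq_mul2l; apply/orP; right; exact: hC.
have {hC}hE : n.*2 <= e.+1 * (s + c).+1 + 2 * (n.*2 %/ 3).
  rewrite -(@leq_exp2l 2) //.
  have -> : 2 ^ n.*2 = 4 ^ n by rewrite -mul2n expnM.
  have -> : 2 ^ (e.+1 * (s + c).+1 + 2 * (n.*2 %/ 3)) =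
    (2 ^ e.+1) ^ (s + c).+1 * 4 ^ (n.*2 %/ 3) by rewrite expnD !expnM.
  apply: leq_trans hL _; rewrite leq_mul2r; apply/orP; right.
  by rewrite leq_exp2r // ltnW.
(* False at [e = 12] and true from [e = 13] on, which fixes the threshold [2^12]. The parities of
   [e] are separate inductions because [s] doubles only when [e] grows by 2. *)
have small : e.+1 * s.+1 <= 2 ^ (e - 2).
  have [f7 | f6] : (e = f.*2 /\ 7 <= f) \/ (e = f.*2.+1 /\ 6 <= f) by rewrite /f; lia.
    case: f7 => -> f7; rewrite /s; clear -f7; elim: f f7 => // f IH hf.
    have [h|h] := ltnP f 7; first by have -> : f = 6 by lia.
    have := IH h; have -> : f.+1.*2 - 2 = (f.*2 - 2).+2 by lia.
    rewrite ![2 ^ _.+1]expnS; set A := 2 ^ f; set B := 2 ^ (f.*2 - 2).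
    have : 1 <= A by rewrite expn_gt0.
    nia.
  case: f6 => -> f6; rewrite /s; clear -f6; elim: f f6 => // f IH hf.
  have [h|h] := ltnP f 6; first by have -> : f = 5 by lia.
  have := IH h; have -> : f.+1.*2.+1 - 2 = (f.*2.+1 - 2).+2 by lia.
  rewrite ![2 ^ _.+1]expnS; set A := 2 ^ f; set B := 2 ^ (f.*2.+1 - 2).
  have : 1 <= A by rewrite expn_gt0.
  nia.
have e2 : 2 ^ e = 4 * 2 ^ (e - 2) by rewrite -(expnD 2 2); congr (2 ^ _); lia.
nia.
Qed.

Lemma primes_in_lower n : 0 < n ->
  n <= 2 ^ 12 * primes_in n n.*2 * (trunc_log 2 n.*2).+1.
Proof.
move=> n0; have [h|h] := ltnP n (2 ^ 12).
  apply: leq_trans (ltnW h) _; rewrite -mulnA leq_pmulr // muln_gt0 bertrand_small //.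
apply: leq_trans (bertrand_large h) _.
by apply: leq_mul => //; apply: leq_mul.
Qed.

End Chebyshev.

(** * Logarithms of primes: [theta] and an upper bound of Mertens type *)

Section RealPrimes.
Variable R : realType.
Local Notation lnn n := (ln (n%:R : R)).

Lemma ln_ge_half : 1 / 2 <= ln (2 : R).
Proof.
have := @le_ln1Dx R (- (1 / 2)) ltac:(lra).
have -> : 1 - 1 / 2 = (2 : R)^-1 by field.
by rewrite lnV ?posrE //; lra.
Qed.

Lemma ln2_le1 : ln (2 : R) <= 1.
Proof. by have := @le_ln1Dx R 1 ltac:(lra); rewrite (_ : 1 + 1 = 2). Qed.

Lemma lnn_le m n : (0 < m)%N -> (m <= n)%N -> lnn m <= lnn n.
Proof.
by move=> m0 mn; rewrite ler_ln ?posrE ?ltr0n ?ler_nat //; apply: leq_trans mn.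
Qed.

Lemma lnn_ge0 n : 0 <= lnn n.
Proof.
case: n => [|n]; first by rewrite ln0.
by apply: ln_ge0; rewrite ler1n.
Qed.

Lemma lnn_gt0 n : (1 < n)%N -> 0 < lnn n.
Proof. by move=> n1; apply: ln_gt0; rewrite ltr1n. Qed.

Lemma lnn_ge_half n : (1 < n)%N -> 1 / 2 <= lnn n.
Proof. by move=> n1; apply: le_trans ln_ge_half _; apply: lnn_le. Qed.

Lemma lnnM m n : (0 < m)%N -> (0 < n)%N -> lnn (m * n)%N = lnn m + lnn n.
Proof. by move=> m0 n0; rewrite natrM lnM ?posrE ?ltr0n. Qed.

Lemma lnnX m n : (0 < m)%N -> lnn (m ^ n)%N = n%:R * lnn m.
Proof. by move=> m0; rewrite natrX lnXn ?ltr0n // mulr_natl. Qed.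

Definition theta n : R := \sum_(0 <= p < n.+1 | prime p) lnn p.

Lemma thetaS n : theta n.+1 = theta n + (if prime n.+1 then lnn n.+1 else 0).
Proof. by rewrite /theta big_mkcond big_nat_recr //= -big_mkcond. Qed.

Lemma thetaE n : theta n = lnn (primorial n).
Proof.
elim: n => [|n IH]; first by rewrite /theta /primorial unlock /= ln1.
rewrite thetaS primorialS IH; case: ifP => pr; last by rewrite muln1 addr0.
by rewrite lnnM //; apply: prodn_cond_gt0 => p /prime_gt0.
Qed.

Lemma theta_le n : theta n <= 2 * n%:R.
Proof.
rewrite thetaE; apply: le_trans (lnn_le _ (primorial_le n)) _.
  by apply: prodn_cond_gt0 => p /prime_gt0.
have -> : (4 ^ n = 2 ^ (2 * n))%N by rewrite expnM.
rewrite lnnX // natrM.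
by rewrite -[leRHS]mulr1 ler_wpM2l ?mulr_ge0 // ln2_le1.
Qed.

Definition harm n : R := \sum_(0 <= m < n) m.+1%:R^-1.

Lemma harm_ge n : lnn n.+1 <= harm n.
Proof.
elim: n => [|n IH]; first by rewrite /harm big_geq // ln1.
rewrite /harm big_nat_recr //= -/(harm n).
have -> : (n.+2%:R : R) = n.+1%:R * (1 + n.+1%:R^-1).
  by rewrite mulrDr mulr1 divff ?pnatr_eq0 // -natr1.
rewrite lnM ?posrE ?ltr0n //.
apply: lerD IH _; apply: le_ln1Dx.
by apply: (@lt_le_trans _ _ 0); rewrite ?invr_ge0 ?ler0n // ltrN10.
Qed.

Lemma harm_le n : harm n <= 1 + lnn n.
Proof.
elim: n => [|n IH]; first by rewrite /harm big_geq // ln0 // addr0.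
rewrite /harm big_nat_recr //= -/(harm n).
case: n IH => [|n] IH; first by rewrite /harm big_geq // ln1 invr1 add0r addr0.
apply: le_trans (lerD IH (lexx _)) _; rewrite -addrA lerD2l.
have n0 : (0 : R) < n.+1%:R by rewrite ltr0n.
have n1 : (0 : R) < n.+2%:R by rewrite ltr0n.
have := @le_ln1Dx R (- n.+2%:R^-1); rewrite ltrN2 invf_lt1 // ltr1n => /(_ isT).
have -> : 1 - n.+2%:R^-1 = n.+1%:R / n.+2%:R :> R.
  have -> : n.+2%:R = n.+1%:R + 1 :> R by rewrite natr1.
  by field; lra.
rewrite ln_div ?posrE //; move: (ln n.+1%:R) (ln n.+2%:R) (n.+2%:R^-1) => a b c.
lra.
Qed.

(* By Abel summation against [theta]. *)
Lemma sum_lnp_div_le n :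
  \sum_(0 <= p < n.+1 | prime p) lnn p / p%:R <= 4 + 2 * lnn n.+1.
Proof.
pose S n : R := \sum_(0 <= p < n.+1 | prime p) lnn p / p%:R.
have SS m : S m.+1 = S m + (if prime m.+1 then lnn m.+1 else 0) / m.+1%:R.
  rewrite /S big_mkcond big_nat_recr //= -big_mkcond; congr (_ + _).
  by case: ifP; rewrite ?mul0r.
have E m : S m = theta m / m.+1%:R + \sum_(0 <= j < m) theta j.+1 / (j.+1%:R * j.+2%:R).
  elim: m => [|m IH].
    by rewrite /S /theta unlock /= mul0r addr0.
  rewrite SS IH big_nat_recr //=; set T := \sum_(0 <= j < m) _.
  rewrite thetaS; set l := (if _ then _ else _).
  have -> : m.+2%:R = m.+1%:R + 1 :> R by rewrite natr1.
  have n0 : (0 : R) < m.+1%:R by rewrite ltr0n.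
  by field; lra.
rewrite -/(S n) E.
have h1 : theta n / n.+1%:R <= 2.
  rewrite ler_pdivrMr ?ltr0n //; apply: le_trans (theta_le n) _.
  by rewrite ler_pM2l // ler_nat.
have h2 : \sum_(0 <= j < n) theta j.+1 / (j.+1%:R * j.+2%:R) <= 2 * harm n.+1.
  rewrite /harm mulr_sumr [leRHS]big_nat_recl //= -[leLHS]add0r.
  apply: lerD; first by rewrite invr1 mulr1.
  apply: ler_sum => j _; rewrite invfM mulrA ler_pM2r ?invr_gt0 ?ltr0n //.
  by rewrite ler_pdivrMr ?ltr0n // theta_le.
apply: le_trans (lerD h1 h2) _.
by move: (harm_le n.+1); move: (harm n.+1) (ln _) => a b; lra.
Qed.

End RealPrimes.

Lemma eq_lew (disp : Order.disp_t) (T : porderType disp) (a b : T) : a = b -> (a <= b)%O.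
Proof. by move->. Qed.

(** * Euler products, Rankin's trick and the sieve *)

Section DivisorSums.
Variable R : realType.

Lemma sum_sub_le (T : eqType) (s u : seq T) (G : T -> R) :
  uniq s -> {subset s <= u} -> (forall x, x \in u -> 0 <= G x) ->
  \sum_(x <- s) G x <= \sum_(x <- u) G x.
Proof.
elim: s u => [|x s IH] u /=.
  by move=> _ _ G0; rewrite big_nil big_seq; apply: sumr_ge0.
move=> /andP[xs us] sub G0.
have xu : x \in u by apply: sub; rewrite mem_head.
rewrite big_cons (perm_big _ (perm_to_rem xu)) big_cons /= lerD2l.
apply: IH => // y; last by move=> /mem_rem/G0.
move=> ys; have yu : y \in u by apply: sub; rewrite inE ys orbT.
have yx : y != x by apply: contraNneq xs => <-.
by have := perm_mem (perm_to_rem xu) y; rewrite inE (negbTE yx) /= => <-.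
Qed.

(** Since [G] is nonnegative, overcounting is harmless: a parametrisation has to be onto, and its
    uniqueness is never checked. *)
Lemma sum_cover_le (T U : eqType) (s : seq T) (t : seq U) (h : U -> T) (G : T -> R) :
  uniq s -> (forall x, x \in s -> exists2 b, b \in t & h b = x) ->
  (forall b, b \in t -> 0 <= G (h b)) ->
  \sum_(x <- s) G x <= \sum_(b <- t) G (h b).
Proof.
move=> us cov G0; rewrite -(big_map h xpredT G).
apply: sum_sub_le => // x; last by case/mapP => b bt ->; apply: G0.
by case/cov => b bt <-; apply: map_f.
Qed.

(** Its divisors are exactly the squarefree numbers whose primes are [<= n] and satisfy [Q], so that
    sums over such numbers become finite sums over divisors. *)
Definition prodQ (Q : pred nat) n := (\prod_(0 <= p < n.+1 | prime p && Q p) p)%N.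

Lemma prodQS Q n :
  prodQ Q n.+1 = (prodQ Q n * (if prime n.+1 && Q n.+1 then n.+1 else 1))%N.
Proof. by rewrite /prodQ big_mkcond big_nat_recr //= -big_mkcond. Qed.

Lemma prodQ_gt0 Q n : (0 < prodQ Q n)%N.
Proof. by apply: prodn_cond_gt0 => p /andP[/prime_gt0]. Qed.

Lemma prime_dvd_prodQ Q n q : prime q -> (q %| prodQ Q n)%N = (q <= n)%N && Q q.
Proof.
move=> pr; elim: n => [|n IH].
  rewrite /prodQ unlock /= dvdn1 leqn0.
  by case: q pr => [|[|]].
rewrite prodQS Euclid_dvdM // IH.
case: ifP => [/andP[pr' Qn]|h].
  rewrite dvdn_prime2 // [(q <= n.+1)%N]leq_eqVlt ltnS.
  by have [->|ne] := eqVneq q n.+1; rewrite ?Qn ?orbT ?orbF.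
rewrite dvdn1 [q == 1%N]gtn_eqF ?prime_gt1 // orbF [(q <= n.+1)%N]leq_eqVlt ltnS.
have [e|//] := eqVneq q n.+1; move: h; rewrite -e pr /= => ->.
by rewrite andbF.
Qed.

Definition divsum (P : nat) (F : nat -> R) := \sum_(A <- divisors P) F A / A%:R.

Lemma divsum_ge0 P F : (forall A, 0 <= F A) -> 0 <= divsum P F.
Proof. by move=> F0; apply: sumr_ge0 => A _; rewrite divr_ge0. Qed.

Lemma divsumM_ge P q F : prime q -> (0 < P)%N -> ~~ (q %| P)%N -> (forall A, 0 <= F A) ->
  divsum P F + q%:R^-1 * divsum P (fun A => F (A * q)%N) <= divsum (P * q) F.
Proof.
move=> pr P0 qP F0.
have -> : q%:R^-1 * divsum P (fun A => F (A * q)%N) =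
  \sum_(A <- map (muln^~ q) (divisors P)) F A / A%:R.
  rewrite big_map mulr_sumr; apply: eq_bigr => A _.
  by rewrite natrM invfM; ring.
rewrite /divsum -big_cat; apply: sum_sub_le.
- rewrite cat_uniq divisors_uniq map_inj_uniq ?divisors_uniq ?andbT /=; last first.
    by move=> a b /eqP; rewrite eqn_pmul2r ?prime_gt0 // => /eqP.
  apply/hasPn => x /mapP[A]; rewrite -dvdn_divisors // => AP ->.
  apply/negP; rewrite -dvdn_divisors // => AqP; move/negP: qP; apply.
  by apply: dvdn_trans AqP; rewrite dvdn_mull.
- have Pq0 : (0 < P * q)%N by rewrite muln_gt0 P0 prime_gt0.
  move=> x; rewrite mem_cat -!dvdn_divisors // => /orP[h|/mapP[A]].
    by rewrite dvdn_mulr.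
  by rewrite -dvdn_divisors // => AP ->; rewrite dvdn_mul.
by move=> x _; rewrite divr_ge0.
Qed.

Lemma divsumM_le P q F : prime q -> (0 < P)%N -> ~~ (q %| P)%N -> (forall A, 0 <= F A) ->
  divsum (P * q) F <= divsum P F + q%:R^-1 * divsum P (fun A => F (A * q)%N).
Proof.
move=> pr P0 qP F0.
have -> : q%:R^-1 * divsum P (fun A => F (A * q)%N) =
  \sum_(A <- map (muln^~ q) (divisors P)) F A / A%:R.
  rewrite big_map mulr_sumr; apply: eq_bigr => A _.
  by rewrite natrM invfM; ring.
rewrite /divsum -big_cat; apply: sum_sub_le; first exact: divisors_uniq.
- have Pq0 : (0 < P * q)%N by rewrite muln_gt0 P0 prime_gt0.
  move=> x; rewrite mem_cat -!dvdn_divisors // => h.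
  have [qx|qx] := boolP (q %| x)%N.
    apply/orP; right; apply/mapP; exists (x %/ q)%N; last by rewrite divnK.
    by rewrite -dvdn_divisors // -(@dvdn_pmul2r q) ?prime_gt0 // divnK.
  by rewrite Gauss_dvdl // ?h // in h; rewrite ?h // coprime_sym prime_coprime.
by move=> x _; rewrite divr_ge0.
Qed.

Lemma le_divsum P F G : (forall A, (A %| P)%N -> F A <= G A) -> (0 < P)%N ->
  divsum P F <= divsum P G.
Proof.
move=> h P0; rewrite /divsum big_seq [leRHS]big_seq; apply: ler_sum => A.
by rewrite -dvdn_divisors // => AP; rewrite ler_wpM2r ?invr_ge0 // h.
Qed.

Lemma divsumZ P F c : divsum P (fun A => c * F A) = c * divsum P F.
Proof. by rewrite /divsum mulr_sumr; apply: eq_bigr => A _; rewrite mulrA. Qed.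

(** Primes are treated one at a time. For [q] in [E], a divisor containing [q] is charged to the one
    without it at cost [c/q]. A kept prime calls for the induction hypothesis at [A -> F (A q)] as
    well, hence the quantification over [F]. *)
Lemma prodQ_sub (Q E : pred nat) n (c : R) (F : nat -> R) :
  0 <= c -> (forall A, 0 <= F A) ->
  (forall A q, (0 < A)%N -> prime q -> F (A * q)%N <= c * F A) ->
  divsum (prodQ Q n) F <=
    \prod_(0 <= p < n.+1 | prime p && E p) (1 + c / p%:R)
     * divsum (prodQ (fun p => Q p && ~~ E p) n) F.
Proof.
move=> c0; elim: n F => [|n IH] F F0 Fq.
  by rewrite /prodQ unlock /= mul1r.
rewrite !prodQS [X in X * _]big_mkcond [X in X * _]big_nat_recr //= -big_mkcond.
set C := \prod_(0 <= p < n.+1 | _) _ in IH *.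
have C0 : 0 <= C by apply: prodr_ge0 => p _; rewrite addr_ge0 // divr_ge0.
have [pr|npr] /= := boolP (prime n.+1); last by rewrite !muln1 mulr1; apply: IH.
set q := n.+1 in pr *.
have qP Q' : ~~ (q %| prodQ Q' n)%N by rewrite prime_dvd_prodQ // ltnn.
have F0' A : 0 <= F (A * q)%N by [].
have Fq' A q' : (0 < A)%N -> prime q' -> F (A * q' * q)%N <= c * F (A * q)%N.
  by move=> A0 pr'; rewrite mulnAC Fq // muln_gt0 A0 prime_gt0.
have IHq := IH (fun A => F (A * q)%N) F0' Fq'; have IH0 := IH F F0 Fq.
have [Qq|Qq] /= := boolP (Q q); last first.
  rewrite !muln1; apply: le_trans IH0 _; rewrite ler_wpM2r ?divsum_ge0 //.
  by rewrite -[leLHS]mulr1 ler_wpM2l //; case: ifP => // _; rewrite lerDl divr_ge0.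
have up := divsumM_le pr (prodQ_gt0 Q n) (qP Q) F0.
have [Eq|Eq] /= := boolP (E q); last first.
  rewrite mulr1; apply: le_trans up _.
  apply: le_trans (ler_wpM2l C0 (divsumM_ge pr (prodQ_gt0 _ n) (qP _) F0)).
  rewrite mulrDr lerD // mulrCA ler_wpM2l // invr_ge0 //.
rewrite muln1 -mulrA [X in C * X]mulrC mulrA.
apply: le_trans up _; rewrite mulrDr mulr1; apply: lerD => //.
apply: (@le_trans _ _ (q%:R^-1 * (c * divsum (prodQ Q n) F))).
  rewrite ler_wpM2l ?invr_ge0 // -divsumZ; apply: le_divsum; last exact: prodQ_gt0.
  by move=> A AP; apply: Fq => //; apply: dvdn_gt0 AP; apply: prodQ_gt0.
have -> D : q%:R^-1 * (c * D) = c / q%:R * D by rewrite mulrA [q%:R^-1 * c]mulrC.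
by rewrite [leRHS]mulrC ler_wpM2l // divr_ge0.
Qed.

Definition below (Q : pred nat) (n : nat) : nat_pred := [pred p | (p <= n)%N && Q p].

Lemma sum_primepow_le (Q : pred nat) n X (G : nat -> R) : (forall A, 0 <= G A) ->
  prime n.+1 ->
  \sum_(0 <= A < X.+1 | (below Q n.+1).-nat A) G A <=
  \sum_(0 <= v < X.+1) \sum_(0 <= A < X.+1 | (below Q n).-nat A) G (A * n.+1 ^ v)%N.
Proof.
move=> G0 pr; rewrite -big_filter.
under [leRHS]eq_bigr do rewrite -big_filter.
rewrite (_ : \sum_(0 <= v < X.+1) _ =
  \sum_(b <- [seq (v, A) | v <- index_iota 0 X.+1,
       A <- [seq A <- index_iota 0 X.+1 | (below Q n).-nat A]])
     G (b.2 * n.+1 ^ b.1)%N); last by rewrite big_allpairs.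
apply: (@sum_cover_le _ _ _ _ (fun b : nat * nat => (b.2 * n.+1 ^ b.1)%N) G) => //.
  by rewrite filter_uniq // iota_uniq.
move=> A; rewrite mem_filter mem_index_iota => /andP[Anat]; rewrite leq0n ltnS => AX.
have A0 : (0 < A)%N by case/andP: Anat.
exists (logn n.+1 A, A`_(n.+1)^')%N; last by rewrite /= mulnC -p_part partnC.
apply/allpairsPdep; exists (logn n.+1 A), (A`_(n.+1)^')%N; split => //.
  rewrite mem_index_iota leq0n ltnS; apply: leq_trans AX.
  have h := dvdn_leq A0 (pfactor_dvdnn n.+1 A).
  by apply: leq_trans h; apply/ltnW/ltn_expl/prime_gt1.
rewrite mem_filter mem_index_iota leq0n ltnS; apply/andP; split; last first.
  by apply: leq_trans AX; apply: dvdn_leq => //; apply: dvdn_part.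
apply/pnatP => [|p prp pdvd]; first exact: part_gt0.
have pA : (p %| A)%N by apply: dvdn_trans pdvd (dvdn_part _ _).
have := pnatPpi Anat; move=> /(_ p); rewrite mem_primes prp A0 pA => /(_ isT).
rewrite !inE => /andP[pn ->]; rewrite andbT.
move: pn; rewrite leq_eqVlt ltnS => /orP[/eqP e|//].
have := pnatPpi (part_pnat n.+1^' A); move=> /(_ p).
rewrite mem_primes prp part_gt0 pdvd => /(_ isT).
by rewrite !inE e eqxx.
Qed.

Lemma nat_below0 Q A : (below Q 0).-nat A = (A == 1%N).
Proof.
apply/idP/eqP => [h|->]; last by [].
apply/eqP; rewrite eqn_leq; case/andP: (h) => -> _; rewrite andbT leqNgt.
apply/negP => A1; have pp := pdiv_prime A1.
have := pnatPpi h; move=> /(_ (pdiv A)); rewrite pi_pdiv A1 => /(_ isT).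
by rewrite !inE leqn0 => /andP[/eqP e]; rewrite e in pp.
Qed.

Lemma nat_belowS Q n A : ~~ (prime n.+1 && Q n.+1) ->
  (below Q n.+1).-nat A = (below Q n).-nat A.
Proof.
move=> h; apply/idP/idP; last first.
  by apply: sub_in_pnat => p _; rewrite !inE => /andP[/leqW -> ->].
apply: sub_in_pnat => p; rewrite mem_primes => /andP[pr _]; rewrite !inE => /andP[+ Qp].
rewrite Qp leq_eqVlt ltnS => /orP[/eqP e|->//].
by rewrite -e pr Qp in h.
Qed.

(* Induction on [n]: at a prime [q] the exponents [0] and [1] are kept in
   [divsum], and the rest is paid for by a factor close to [1]. *)
Lemma euler_le (Q : pred nat) n X (g : nat -> R) (W om : nat -> R) (F : nat -> R) :
  (forall v, 0 <= g v) -> (forall A, 0 <= F A) ->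
  (forall A q v, (0 < A)%N -> prime q -> F (A * q ^ v)%N <= g v * F A) ->
  W 1%N = 1 -> (forall A, 0 <= W A) ->
  (forall q, 1 <= om q) ->
  (forall A q v, (0 < A)%N -> prime q -> W (A * q ^ v)%N = W A * om q ^+ v) ->
  \sum_(0 <= A < X.+1 | (below Q n).-nat A) F A * W A / A%:R <=
  \prod_(0 <= q < n.+1 | prime q)
     (1 + g 1%N * (om q - 1) / q%:R + \sum_(2 <= v < X.+1) g v * (om q / q%:R) ^+ v)
   * divsum (prodQ Q n) F.
Proof.
move=> g0 + + W1 W0 om1 WM; elim: n F => [|n IH] F F0 Fq.
  rewrite (eq_bigl (fun A => A == 1%N)); last by move=> A; rewrite nat_below0.
  apply: (@le_trans _ _ (\sum_(A <- [:: 1%N]) F A * W A / A%:R)).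
    rewrite -big_filter; apply: sum_sub_le.
    - by rewrite filter_uniq // iota_uniq.
    - by move=> A; rewrite mem_filter => /andP[/eqP -> _]; rewrite mem_head.
    by move=> A _; rewrite divr_ge0 // mulr_ge0.
  have -> : prodQ Q 0 = 1%N by rewrite /prodQ big_mkcond big_nat1.
  by rewrite [X in X * _]big_mkcond big_nat1 /= mul1r /divsum (_ : divisors 1 = [:: 1%N]) // !big_seq1 W1 mulr1.
rewrite [X in X * _]big_mkcond [X in X * _]big_nat_recr //= -big_mkcond.
set C := \prod_(0 <= q < n.+1 | prime q) _ in IH *.
set e := g 1%N * (om n.+1 - 1) / n.+1%:R; set t := \sum_(2 <= v < X.+1) _.
have om0 q : 0 <= om q by apply: le_trans (om1 q).
have t0 q : 0 <= \sum_(2 <= v < X.+1) g v * (om q / q%:R) ^+ v.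
  by apply: sumr_ge0 => v _; rewrite mulr_ge0 // exprn_ge0 // divr_ge0.
have e0 q : 0 <= g 1%N * (om q - 1) / q%:R.
  by rewrite divr_ge0 // mulr_ge0 // subr_ge0.
have C0 : 0 <= C by apply: prodr_ge0 => q _; rewrite !addr_ge0.
have [pr|npr] := boolP (prime n.+1); last first.
  rewrite mulr1 (eq_bigl (fun A => (below Q n).-nat A)); last first.
    by move=> A; rewrite nat_belowS // (negbTE npr).
  by rewrite prodQS (negbTE npr) muln1; apply: IH.
have [Qq|nQq] := boolP (Q n.+1); last first.
  rewrite (eq_bigl (fun A => (below Q n).-nat A)); last first.
    by move=> A; rewrite nat_belowS // (negbTE nQq) andbF.
  rewrite prodQS (negbTE nQq) andbF muln1; apply: le_trans (IH _ F0 Fq) _.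
  rewrite ler_wpM2r ?divsum_ge0 // -[leLHS]mulr1 ler_wpM2l //.
  by rewrite -addrA lerDl addr_ge0 // /e /t.
set q := n.+1 in pr Qq e t *.
have q0 : (0 < q)%N by [].
pose S F' := \sum_(0 <= A < X.+1 | (below Q n).-nat A) F' A * W A / A%:R.
have S0 F' : (forall A, 0 <= F' A) -> 0 <= S F'.
  by move=> h; apply: sumr_ge0 => A _; rewrite divr_ge0 // mulr_ge0.
apply: le_trans (sum_primepow_le _ _ _ pr) _.
  by move=> A; rewrite divr_ge0 // mulr_ge0.
rewrite -/q.
have GE v A : (0 < A)%N -> F (A * q ^ v)%N * W (A * q ^ v)%N / (A * q ^ v)%:R =
   (om q / q%:R) ^+ v * (F (A * q ^ v)%N * W A / A%:R).
  move=> A0; rewrite WM // natrM natrX invfM expr_div_n -exprVn; ring.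
have inner v : \sum_(0 <= A < X.+1 | (below Q n).-nat A)
    F (A * q ^ v)%N * W (A * q ^ v)%N / (A * q ^ v)%:R =
    (om q / q%:R) ^+ v * S (fun A => F (A * q ^ v)%N).
  by rewrite mulr_sumr; apply: eq_bigr => A /andP[A0 _]; apply: GE.
under eq_bigr do rewrite inner.
have Sle v : S (fun A => F (A * q ^ v)%N) <= g v * S F.
  rewrite mulr_sumr; apply: ler_sum => A /andP[A0 _].
  by rewrite [leRHS]mulrA ler_wpM2r ?invr_ge0 // [leRHS]mulrA ler_wpM2r //; apply: Fq.
have omq0 : 0 <= om q / q%:R by rewrite divr_ge0.
pose Sq := S (fun A => F (A * q)%N).
have bnd : \sum_(0 <= v < X.+1) (om q / q%:R) ^+ v * S (fun A => F (A * q ^ v)%N) <=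
   S F + q%:R^-1 * Sq + (e + t) * S F.
  have Sq0 : 0 <= Sq by apply: S0.
  have SF0 : 0 <= S F by apply: S0.
  have iq : 0 <= q%:R^-1 :> R by rewrite invr_ge0.
  have ee : 0 <= e by apply: e0.
  have tt : 0 <= t by apply: t0.
  have tail : \sum_(2 <= v < X.+1) (om q / q%:R) ^+ v * S (fun A => F (A * q ^ v)%N)
      <= t * S F.
    rewrite /t mulr_suml; apply: ler_sum => v _.
    by rewrite [g v * _]mulrC -mulrA ler_wpM2l // exprn_ge0.
  have first : S (fun A => F (A * q ^ 0)%N) = S F.
    by apply: eq_bigr => A _; rewrite expn0 muln1.
  (* The share [1/q] is accounted for by the divisors of [prodQ] containing [q]; only the excess
     [(om q - 1)/q] enters the extra Euler factor. *)
  have second : (om q / q%:R) ^+ 1 * S (fun A => F (A * q ^ 1)%N) <= q%:R^-1 * Sq + e * S F.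
    rewrite expr1; have -> : S (fun A => F (A * q ^ 1)%N) = Sq.
      by apply: eq_bigr => A _; rewrite expn1.
    have SqF : Sq <= g 1%N * S F by have := Sle 1%N; rewrite expn1.
    rewrite (_ : om q / q%:R * Sq = q%:R^-1 * Sq + (om q - 1) / q%:R * Sq); last by ring.
    rewrite lerD2l (_ : e * S F = (om q - 1) / q%:R * (g 1%N * S F)); last by rewrite /e; ring.
    by rewrite ler_wpM2l // divr_ge0 // subr_ge0.
  rewrite big_ltn // expr0 mul1r first.
  have [X0|X1] := posnP X.
    rewrite [X in _ + X]big_geq ?X0 // addr0 -addrA lerDl addr_ge0 // mulr_ge0 //.
    exact: addr_ge0.
  rewrite big_ltn // mulrDl -addrA lerD2l addrA.
  exact: lerD.
apply: le_trans bnd _.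
have IH0 := IH F F0 Fq.
have IHq : Sq <= C * divsum (prodQ Q n) (fun A => F (A * q)%N).
  apply: IH => // A q' v A0 pr'; rewrite mulnAC; apply: Fq => //.
  by rewrite muln_gt0 A0.
have qP : ~~ (q %| prodQ Q n)%N by rewrite prime_dvd_prodQ // ltnn.
have low := divsumM_ge pr (prodQ_gt0 Q n) qP F0.
have eq_prodQ : prodQ Q q = (prodQ Q n * q)%N by rewrite /q prodQS -/q pr Qq.
rewrite eq_prodQ; set D := divsum (prodQ Q n * q) F in low *.
set D0 := divsum (prodQ Q n) F in IH0 low; set Dq := divsum _ _ in IHq low.
have et0 : 0 <= e + t by apply: addr_ge0; [apply: e0 | apply: t0].
have iq : 0 <= q%:R^-1 :> R by rewrite invr_ge0.
have Dq0 : 0 <= Dq by apply: divsum_ge0.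
have D00 : 0 <= D0 by apply: divsum_ge0.
have D0D : D0 <= D by apply: le_trans low; rewrite lerDl mulr_ge0.
apply: (@le_trans _ _ (C * D + (e + t) * (C * D))); last first.
  apply: eq_lew; ring.
apply: lerD.
  apply: le_trans (ler_wpM2l C0 low); rewrite mulrDr; apply: lerD => //.
  by rewrite mulrCA ler_wpM2l.
by rewrite ler_wpM2l //; apply: le_trans IH0 _; rewrite ler_wpM2l.
Qed.

End DivisorSums.

(** * Rankin's trick for weakly submultiplicative functions *)

Section Rankin.
Variable R : realType.
Local Notation lnn n := (ln (n%:R : R)).

Lemma expR_le_inv (x : R) : x < 1 -> expR x <= (1 - x)^-1.
Proof.
move=> x1; have h := expR_ge1Dx (- x); have e := expRxMexpNx_1 x.
have x0 := expR_gt0 x; have x2 := expR_gt0 (- x).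
rewrite -[leRHS]mul1r ler_pdivlMr; last lra.
nra.
Qed.

Lemma expR_le_lin (x : R) : 0 <= x -> x <= 1 / 2 -> expR x <= 1 + 2 * x.
Proof.
move=> x0 x1; apply: le_trans (expR_le_inv _) _; first lra.
by rewrite -[leLHS]mul1r ler_pdivrMr; nra.
Qed.

Lemma geom_sum_le (r : R) N : 0 <= r -> r < 1 -> \sum_(0 <= v < N) r ^+ v <= (1 - r)^-1.
Proof.
move=> r0 r1; have h : 0 < 1 - r by lra.
suff -> : \sum_(0 <= v < N) r ^+ v = (1 - r ^+ N) / (1 - r).
  rewrite -[leRHS]mul1r ler_wpM2r ?invr_ge0 ?(ltW h) //.
  by rewrite gerBl exprn_ge0.
elim: N => [|N IH]; first by rewrite big_geq // expr0 subrr mul0r.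
rewrite big_nat_recr //= IH exprS; field; lra.
Qed.

(** The loss in the weak submultiplicativity of [Nt] on [k]-vectors when a prime power [q^v] is
    adjoined. *)
Definition gpow (k v : nat) : R := (2 * v.+1)%:R ^+ k.

Lemma gpow_ge0 k v : 0 <= gpow k v. Proof. exact: exprn_ge0. Qed.

Lemma gpow_ge1 k v : 1 <= gpow k v.
Proof. by apply: exprn_ege1; rewrite ler1n. Qed.

Lemma gpow_series k : exists2 K : R, 0 < K &
  forall N, \sum_(0 <= v < N) gpow k v.+2 * (3 / 4) ^+ v <= K.
Proof.
(* [d] is so small that [(1+d)^k <= 8/7]. By Bernoulli, [(v+3)^k] is at most a constant times
   [(8/7)^(v+3)], and [8/7 * 3/4 = 6/7] still gives a geometric series, of sum 7. *)
pose d : R := (8 * k.+1%:R)^-1.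
have k0 : (0 : R) < k.+1%:R by rewrite ltr0n.
have d0 : 0 < d by rewrite invr_gt0 mulr_gt0.
have kd : k%:R * d <= 1 / 8.
  rewrite /d ler_pdivrMr ?mulr_gt0 //.
  have -> : 1 / 8 * (8 * k.+1%:R) = k.+1%:R :> R by field.
  by rewrite ler_nat.
pose r := (1 + d) ^+ k.
have r1 : 1 <= r by apply: exprn_ege1; rewrite lerDl ltW.
have r87 : r <= 8 / 7.
  apply: (@le_trans _ _ (expR (k%:R * d))).
    rewrite expRM_natl; apply: lerXn2r; rewrite ?nnegrE ?expR_ge0 ?expR_ge1Dx //.
    by rewrite addr_ge0 // ltW.
  apply: le_trans (expR_le_inv _) _; first lra.
  by rewrite -[leLHS]mul1r ler_pdivrMr; lra.
have d2 : 0 <= (2 / d) ^+ k by rewrite exprn_ge0 // divr_ge0 // ltW.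
pose K0 := (2 / d) ^+ k * r ^+ 3.
have K00 : 0 <= K0 by rewrite mulr_ge0 // exprn_ge0 // (le_trans ler01).
exists (K0 * 7 + 1); first by rewrite ltr_wpDl // mulr_ge0.
move=> N; have term v : gpow k v.+2 * (3 / 4) ^+ v <= K0 * (6 / 7) ^+ v.
  have b : (v.+3)%:R <= d^-1 * (1 + d) ^+ v.+3.
    rewrite mulrC ler_pdivlMr //.
    have bern n : n%:R * d <= (1 + d) ^+ n.
      elim: n => [|n IH]; first by rewrite mul0r expr0.
      rewrite exprS -natr1 mulrDl mul1r.
      have : 1 <= (1 + d) ^+ n by apply: exprn_ege1; rewrite lerDl ltW.
      by move: IH; move: ((1 + d) ^+ n) (n%:R) => a b; nra.
    exact: bern.
  have -> : K0 * (6 / 7) ^+ v = (2 / d) ^+ k * (r ^+ 3 * (6 / 7) ^+ v).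
    by rewrite /K0 -mulrA.
  apply: (@le_trans _ _ ((2 / d) ^+ k * r ^+ v.+3 * (3 / 4) ^+ v)).
    rewrite ler_wpM2r ?exprn_ge0 ?divr_ge0 //.
    have -> : r ^+ v.+3 = ((1 + d) ^+ v.+3) ^+ k by rewrite /r -!exprM mulnC.
    rewrite /gpow -exprMn.
    apply: lerXn2r; rewrite ?nnegrE //.
      by rewrite mulr_ge0 ?divr_ge0 ?exprn_ge0 ?addr_ge0 // ltW.
    by rewrite natrM -mulrA ler_pM2l.
  rewrite -mulrA ler_wpM2l // -(addn3 v) exprD -mulrA mulrCA ler_wpM2l //.
    by rewrite exprn_ge0 // (le_trans ler01).
  rewrite -exprMn; apply: lerXn2r; rewrite ?nnegrE ?mulr_ge0 //; try lra.
apply: (@le_trans _ _ (\sum_(0 <= v < N) K0 * (6 / 7) ^+ v)).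
  by apply: ler_sum => v _; apply: term.
rewrite -mulr_sumr; apply: (@le_trans _ _ (K0 * 7)); last by rewrite lerDl.
rewrite ler_wpM2l //; apply: le_trans (geom_sum_le _ _ _) _; try lra.
by rewrite -[leLHS]mul1r ler_pdivrMr; lra.
Qed.

Lemma sum_inv_sq_le n : \sum_(0 <= q < n.+1 | prime q) (q%:R ^+ 2)^-1 <= 1 :> R.
Proof.
suff h m : \sum_(0 <= q < m.+2 | prime q) (q%:R ^+ 2)^-1 <= 1 - m.+1%:R^-1 :> R.
  apply: (@le_trans _ _ (1 - n.+1%:R^-1)); last by rewrite gerBl invr_ge0.
  apply: le_trans (h n); rewrite [leRHS]big_mkcond big_nat_recr //= -big_mkcond.
  by rewrite lerDl; case: ifP => // _; rewrite invr_ge0 exprn_ge0.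
elim: m => [|m IH].
  by rewrite big_mkcond !big_nat_recr //= big_geq // !addr0 invr1 subrr.
rewrite big_mkcond big_nat_recr //= -big_mkcond /=.
apply: le_trans (lerD IH (_ : _ <= (m.+2%:R ^+ 2)^-1)) _.
  by case: ifP => // _; rewrite invr_ge0 exprn_ge0.
have -> : m.+2%:R = m.+1%:R + 1 :> R by rewrite natr1.
have : 0 < m.+1%:R :> R by rewrite ltr0n.
move: (m.+1%:R) => x x0.
have h1 : ((x + 1) ^+ 2)^-1 <= (x * (x + 1))^-1.
  have x1 : 0 < x + 1 by lra.
  by rewrite lef_pV2 ?posrE ?exprn_gt0 ?mulr_gt0 // expr2 ler_pM2r //; lra.
have h2 : x^-1 - (x + 1)^-1 = (x * (x + 1))^-1 by field; lra.
by rewrite -h2 in h1; move: h1; move: (x^-1) ((x + 1)^-1) => a b; lra.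
Qed.

Lemma prod_1D_le (I : Type) (s : seq I) (P : pred I) (e : I -> R) :
  (forall i, P i -> 0 <= e i) ->
  \prod_(i <- s | P i) (1 + e i) <= expR (\sum_(i <- s | P i) e i).
Proof.
move=> e0; rewrite expR_sum; apply: ler_prod => i /e0 h.
by rewrite expR_ge1Dx andbT addr_ge0.
Qed.

Definition smooth_part z A := (A`_(below predT z))%N.

Lemma smooth_partX q v z : prime q ->
  smooth_part z (q ^ v) = if (q <= z)%N then (q ^ v)%N else 1%N.
Proof.
move=> pr; rewrite /smooth_part; case: ifP => h.
  by rewrite part_pnat_id // pnatX pnatE // inE h.
by rewrite part_p'nat // pnatX pnatE // !inE h.
Qed.

Definition rweight (z : nat) (eta : R) A := expR (eta * lnn (smooth_part z A)).

Lemma rankin_le k : exists2 C : R, 0 < C &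
  forall (Q : pred nat) n X z (eta : R) (F : nat -> R),
  0 <= eta -> eta * lnn z <= 1 / 4 ->
  (forall A, 0 <= F A) ->
  (forall A q v, (0 < A)%N -> prime q -> F (A * q ^ v)%N <= gpow k v * F A) ->
  \sum_(0 <= A < X.+1 | (below Q n).-nat A) F A * rweight z eta A / A%:R <=
  C * divsum (prodQ Q n) F.
Proof.
have [K K0 HK] := gpow_series k.
exists (expR (6 * gpow k 1 + 2 * K)); first exact: expR_gt0.
move=> Q n X z eta F eta0 etaz F0 FM.
pose om q : R := if (q <= z)%N then expR (eta * lnn q) else 1.
have om1 q : 1 <= om q.
  rewrite /om; case: ifP => // _; apply: le_trans (expR_ge1Dx _).
  by rewrite lerDl mulr_ge0 // lnn_ge0.
have omle q : (0 < q)%N -> om q - 1 <= if (q <= z)%N then 2 * (eta * lnn q) else 0.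
  move=> q0; rewrite /om; case: ifP => qz; last by rewrite subrr.
  rewrite lerBlDl; apply: expR_le_lin; first by rewrite mulr_ge0 // lnn_ge0.
  apply: (@le_trans _ _ (1 / 4)); last lra.
  by apply: le_trans etaz; rewrite ler_wpM2l // lnn_le.
have om2 q : (0 < q)%N -> om q ^+ 2 <= 2.
  move=> q0; rewrite /om; case: ifP => qz; last by rewrite expr1n; lra.
  rewrite -expRM_natl; apply: le_trans (expR_le_inv (_ : _ < 1)) _.
    suff : eta * lnn q <= 1 / 4 by move: (eta * _) => a; lra.
    by apply: le_trans etaz; rewrite ler_wpM2l // lnn_le.
  have : eta * lnn q <= 1 / 4 by apply: le_trans etaz; rewrite ler_wpM2l // lnn_le.
  move: (eta * _) => a ha.
  by rewrite -[leLHS]mul1r ler_pdivrMr; lra.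
have W1 : rweight z eta 1 = 1.
  by rewrite /rweight /smooth_part partn1 ln1 mulr0 expR0.
have W0 A : 0 <= rweight z eta A by exact: expR_ge0.
have WM A q v : (0 < A)%N -> prime q ->
   rweight z eta (A * q ^ v)%N = rweight z eta A * om q ^+ v.
  move=> A0 pr; rewrite /rweight /om.
  have q0 := prime_gt0 pr; have qv0 : (0 < q ^ v)%N by rewrite expn_gt0 q0.
  rewrite {1}/smooth_part partnM // -/(smooth_part z A) -/(smooth_part z (q ^ v)).
  rewrite smooth_partX // lnnM ?part_gt0 //; last by case: ifP.
  rewrite mulrDr expRD; congr (_ * _).
  case: ifP => _; last by rewrite ln1 mulr0 expR0 expr1n.
  by rewrite lnnX // mulrCA expRM_natl.
have := euler_le Q n X (gpow_ge0 k) F0 FM W1 W0 om1 WM.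
move=> h; apply: le_trans h _; rewrite ler_wpM2r ?divsum_ge0 //.
have om0 q : 0 <= om q by apply: le_trans (om1 q).
have tail q : prime q ->
  \sum_(2 <= v < X.+1) gpow k v * (om q / q%:R) ^+ v <= 2 * K * (q%:R ^+ 2)^-1.
  move=> pr; have q0 := prime_gt0 pr; have q1 := prime_gt1 pr.
  have q0' : (0 : R) < q%:R by rewrite ltr0n.
  have q2' : (2 : R) <= q%:R by rewrite ler_nat.
  (* [om q <= sqrt 2] and [q >= 2]; the ratio 3/4 is the one in [gpow_series]. *)
  have omq : om q / q%:R <= 3 / 4.
    rewrite ler_pdivrMr //; have := om2 q q0; have := om0 q; move: (om q) => a a0 a2.
    have : a ^+ 2 <= (3 / 4 * q%:R) ^+ 2 by rewrite exprMn !expr2 in a2 *; nra.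
    by rewrite ler_sqr ?nnegrE // mulr_ge0.
  rewrite -{1}(add0n 2%N) big_addn.
  apply: (@le_trans _ _ (\sum_(0 <= v < X.+1 - 2) 2 * (q%:R ^+ 2)^-1 * (gpow k v.+2 * (3 / 4) ^+ v))).
    apply: ler_sum => v _; rewrite addn2.
    have -> : (om q / q%:R) ^+ v.+2 = om q ^+ 2 * (q%:R ^+ 2)^-1 * (om q / q%:R) ^+ v.
      by rewrite -exprVn -exprMn -exprD.
    rewrite [leRHS]mulrCA ler_wpM2l ?gpow_ge0 //.
    apply: ler_pM; rewrite ?mulr_ge0 ?exprn_ge0 ?invr_ge0 ?divr_ge0 //.
      by rewrite ler_wpM2r ?invr_ge0 ?exprn_ge0 // om2.
    by apply: lerXn2r; rewrite ?nnegrE ?divr_ge0 //; lra.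
  rewrite -mulr_sumr [2 * K * _]mulrAC ler_wpM2l //.
have t0 q : 0 <= \sum_(2 <= v < X.+1) gpow k v * (om q / q%:R) ^+ v.
  by apply: sumr_ge0 => v _; rewrite mulr_ge0 ?gpow_ge0 // exprn_ge0 // divr_ge0.
have e0 q : 0 <= gpow k 1 * (om q - 1) / q%:R.
  by rewrite divr_ge0 // mulr_ge0 ?gpow_ge0 // subr_ge0.
under eq_bigr do rewrite -addrA.
apply: le_trans (prod_1D_le _ _) _; first by move=> q _; rewrite addr_ge0.
rewrite ler_expR big_split /=; apply: lerD; last first.
  apply: (@le_trans _ _ (\sum_(0 <= q < n.+1 | prime q) 2 * K * (q%:R ^+ 2)^-1)).
    exact: ler_sum.
  by rewrite -mulr_sumr -[leRHS]mulr1 ler_wpM2l ?sum_inv_sq_le // mulr_ge0 // ltW.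
have -> : \sum_(0 <= q < n.+1 | prime q) gpow k 1 * (om q - 1) / q%:R =
   gpow k 1 * \sum_(0 <= q < n.+1 | prime q) (om q - 1) / q%:R.
  by rewrite mulr_sumr; apply: eq_bigr => q _; rewrite mulrA.
rewrite [6 * _]mulrC ler_wpM2l ?gpow_ge0 //.
apply: (@le_trans _ _ (2 * eta * \sum_(0 <= q < z.+1 | prime q) lnn q / q%:R)).
  rewrite mulr_sumr.
  apply: (@le_trans _ _ (\sum_(0 <= q < n.+1 | prime q && (q <= z)%N) 2 * eta * (lnn q / q%:R))).
    rewrite [leRHS]big_mkcondr /=; apply: ler_sum => q pr.
    have := omle q (prime_gt0 pr); case: ifP => qz.
      by move=> h; rewrite -[2 * eta * _]mulrA [eta * _]mulrA mulrA ler_wpM2r ?invr_ge0.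
    by move=> h; rewrite mulr_le0_ge0 // invr_ge0.
  rewrite -big_filter -[leRHS]big_filter; apply: sum_sub_le.
  - by rewrite filter_uniq // iota_uniq.
  - move=> q; rewrite !mem_filter !mem_index_iota !ltnS => /andP[/andP[-> ->] _] //.
  by move=> q _; rewrite !mulr_ge0 ?invr_ge0 ?lnn_ge0.
(* As [log z >= 1/2], the bound [4 + 2 log (z+1)] is at most [12 log z]; with [eta log z <= 1/4]
   this yields the 6 in the constant. For [z <= 1] there is no prime to sum over. *)
apply: (@le_trans _ _ (2 * eta * (if (1 < z)%N then 12 * lnn z else 0))).
  rewrite ler_wpM2l ?mulr_ge0 //; case: ifP => z1.
    apply: le_trans (sum_lnp_div_le _ z) _.
    have h1 := lnn_ge_half R z1.
    have h2 : lnn z.+1 <= 2 * lnn z.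
      rewrite -lnnX ?(ltnW z1) //; apply: lnn_le => //.
      by rewrite expnS expn1; nia.
    by move: h1 h2; move: (ln z%:R) (ln z.+1%:R) => a b; lra.
  rewrite big_mkcond big_nat_cond big1 // => q /andP[hq _].
  by case: ifP => // /prime_gt1; lia.
case: ifP => z1; last by rewrite mulr0; lra.
by rewrite -mulrA [eta * _]mulrCA; move: etaz; move: (eta * _) => a; lra.
Qed.

End Rankin.

(** * Reciprocal sums over smooth and rough numbers *)

Section RoughReciprocals.
Variable R : realType.
Local Notation lnn n := (ln (n%:R : R)).

Lemma nat_above (x : R) : exists n : nat, x <= n%:R.
Proof.
exists (Num.truncn x).+1; have [x0|x0] := leP 0 x; last first.
  by apply: le_trans (ltW x0) _.
by apply/ltW; rewrite truncnS_gt.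
Qed.

Definition rough z : nat_pred := [pred p | (z <= p)%N].
Definition rsum (z X : nat) : R := \sum_(0 <= m < X.+1 | (rough z).-nat m) m%:R^-1.

Lemma harm_list n : harm R n = \sum_(m <- iota 1 n) m%:R^-1.
Proof.
rewrite /harm /index_iota subn0 -[1%N]addn0 iotaDl big_map.
by apply: eq_bigr => m _; rewrite add1n.
Qed.

(** Markov's inequality: the weight of [rankin_le] is at least [B^eta] on the terms that are
    kept. *)
Lemma rankin_tail k : exists2 C : R, 0 < C &
  forall (Q : pred nat) n z B (eta : R) (F : nat -> R),
  0 <= eta -> eta * lnn z <= 1 / 4 ->
  (forall A, 0 <= F A) ->
  (forall A q v, (0 < A)%N -> prime q -> F (A * q ^ v)%N <= gpow R k v * F A) ->
  (0 < B)%N ->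
  \sum_(A <- divisors (prodQ Q n) | (B <= smooth_part z A)%N) F A / A%:R <=
  C * expR (- (eta * lnn B)) * divsum (prodQ Q n) F.
Proof.
have [C C0 HC] := rankin_le R k; exists C => // Q n z B eta F eta0 etaz F0 FM B0.
apply: (@le_trans _ _ (\sum_(A <- divisors (prodQ Q n)) expR (- (eta * lnn B)) * (F A * rweight z eta A / A%:R))).
  rewrite big_mkcond big_seq [leRHS]big_seq; apply: ler_sum => A _.
  case: ifP => hB; last by rewrite mulr_ge0 ?expR_ge0 // divr_ge0 // mulr_ge0 // expR_ge0.
  rewrite mulrA ler_wpM2r ?invr_ge0 // mulrCA -[leLHS]mulr1 ler_wpM2l //.
  rewrite /rweight -expRD; apply: le_trans (expR_ge1Dx _).
  rewrite lerDl addrC subr_ge0 ler_wpM2l //; exact: lnn_le.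
rewrite -mulr_sumr mulrAC mulrC ler_wpM2r ?expR_ge0 //.
apply: le_trans (HC Q n (prodQ Q n) z eta F eta0 etaz F0 FM).
rewrite -[leRHS]big_filter; apply: sum_sub_le; first exact: divisors_uniq.
  move=> A; rewrite -dvdn_divisors ?prodQ_gt0 // => AP.
  have A0 : (0 < A)%N by apply: dvdn_gt0 AP; apply: prodQ_gt0.
  rewrite mem_filter mem_index_iota /= ltnS dvdn_leq ?prodQ_gt0 // andbT.
  apply/pnatP => // p pr pA; rewrite !inE -prime_dvd_prodQ //.
  exact: dvdn_trans AP.
by move=> A _; rewrite divr_ge0 // mulr_ge0 // expR_ge0.
Qed.

Lemma gpow0_mul_ge1 A q v : (0 < A)%N -> prime q -> (1 : R) <= gpow R 0 v * 1.
Proof. by move=> _ _; rewrite /gpow expr0 mulr1. Qed.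

(** By self-improvement: squarefree smooth numbers from [z^a] on carry at most half of their total
    [M] by Rankin, and the others form part of a harmonic sum, so [M <= 2(1 + a log z)]. Then
    [rankin_le], whose weight is at least 1, passes from squarefree to all smooth numbers. *)
Lemma smooth_sum_le : exists2 C : R, 0 < C & forall z X, (1 < z)%N ->
  \sum_(0 <= A < X.+1 | (below predT z).-nat A) A%:R^-1 <= C * lnn z.
Proof.
have [C C0 HC] := rankin_le R 0; have [C' C'0 HC'] := rankin_tail 0.
(* Makes [C' exp (-a/4)] at most 1/2, because [exp (a/4) >= 1 + a/4]. *)
have [a ha] := nat_above (8 * C').
exists (C * (4 + 2 * a%:R)); first by rewrite mulr_gt0 // ltr_wpDr // mulr_ge0.
move=> z X z1; have z0 : (0 < z)%N by apply: ltnW.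
have lz := lnn_ge_half R z1.
pose eta : R := (4 * lnn z)^-1.
have etaz : eta * lnn z = 1 / 4 by rewrite /eta; field; lra.
have eta0 : 0 <= eta by rewrite invr_ge0 mulr_ge0 // lnn_ge0.
pose F (_ : nat) : R := 1.
have F0 A : 0 <= F A by rewrite /F.
have M1 : divsum (prodQ predT z) F <= 2 * (1 + a%:R * lnn z).
  set M := divsum _ _.
  have M0 : 0 <= M by apply: divsum_ge0.
  have tail := HC' predT z z (z ^ a)%N eta F eta0 _ F0 (@gpow0_mul_ge1) _.
  rewrite etaz lexx expn_gt0 z0 in tail; have {}tail := tail isT isT.
  have eB : eta * lnn (z ^ a)%N = a%:R / 4.
    by rewrite lnnX // mulrCA etaz; field.
  rewrite eB -/M in tail.
  have half : C' * expR (- (a%:R / 4)) <= 1 / 2.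
    rewrite expRN ler_pdivrMr ?expR_gt0 //.
    have := expR_ge1Dx (a%:R / 4 : R); move: (expR _) ha => x; move: (a%:R) => y.
    lra.
  have bulk : \sum_(A <- divisors (prodQ predT z) | ~~ (z ^ a <= smooth_part z A)%N) F A / A%:R
     <= 1 + a%:R * lnn z.
    apply: (@le_trans _ _ (harm R (z ^ a))); last by rewrite -lnnX // harm_le.
    rewrite harm_list; under eq_bigr do rewrite /F mul1r.
    rewrite -big_filter; apply: sum_sub_le; first by rewrite filter_uniq // divisors_uniq.
      move=> A; rewrite mem_filter -dvdn_divisors ?prodQ_gt0 // => /andP[hA AP].
      have A0 : (0 < A)%N by apply: dvdn_gt0 AP; apply: prodQ_gt0.
      rewrite mem_iota A0 add1n ltnS ltnW // ltnNge; move: hA.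
      rewrite /smooth_part part_pnat_id //.
      apply/pnatP => // p pr pA; rewrite !inE -prime_dvd_prodQ //.
      exact: dvdn_trans AP.
    by move=> A _; rewrite invr_ge0.
  have ME : M = \sum_(A <- divisors (prodQ predT z) | (z ^ a <= smooth_part z A)%N) F A / A%:R
    + \sum_(A <- divisors (prodQ predT z) | ~~ (z ^ a <= smooth_part z A)%N) F A / A%:R.
    by rewrite /M /divsum (bigID (fun A => (z ^ a <= smooth_part z A)%N)).
  move: half tail bulk ME M0; move: (C' * _) (\sum_(_ <- _ | _) _) (\sum_(_ <- _ | _) _).
  by move=> c S1 S2; move: M (a%:R * _) => M' y hc h1 h2 e M0; nra.
have full := HC predT z X z eta F eta0 _ F0 (@gpow0_mul_ge1).
rewrite etaz lexx in full; have {}full := full isT.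
apply: (@le_trans _ _ (C * divsum (prodQ predT z) F)).
  apply: le_trans full; apply: ler_sum => A _.
  rewrite /F mul1r -[leLHS]mul1r ler_wpM2r ?invr_ge0 //.
  by apply: le_trans (expR_ge1Dx _); rewrite lerDl mulr_ge0 // lnn_ge0.
rewrite -mulrA ler_wpM2l ?(ltW C0) //; apply: le_trans M1 _.
by move: lz; move: (ln _) (a%:R) => x y; nra.
Qed.

Lemma rsumE z X : rsum z X = \sum_(m <- [seq m <- iota 0 X.+1 | (rough z).-nat m]) m%:R^-1.
Proof. by rewrite /rsum /index_iota subn0 big_filter. Qed.

Lemma rough'_nat_lt z l : (0 < l)%N -> (l < z)%N -> ((rough z)^').-nat l.
Proof.
move=> l0 lz; apply/pnatP => // p pr pl; rewrite !inE -ltnNge.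
by apply: leq_ltn_trans lz; apply: dvdn_leq.
Qed.

Lemma coprime_parts_inj (pi : nat_pred) m l m' l' :
  pi.-nat m -> pi.-nat m' -> (pi^').-nat l -> (pi^').-nat l' ->
  (m * l = m' * l')%N -> m = m' /\ l = l'.
Proof.
move=> pm pm' pl pl' e.
have [m0 _] := andP pm; have [m0' _] := andP pm'.
have [l0 _] := andP pl; have [l0' _] := andP pl'.
have f a b : pi.-nat a -> (pi^').-nat b -> ((a * b)`_pi)%N = a.
  move=> pa pb; have [a0 _] := andP pa; have [b0 _] := andP pb; rewrite partnM //.
  by rewrite part_pnat_id // part_p'nat // muln1.
have em : m = m' by rewrite -(f m l) // e f.
split => //; move: e; rewrite em => /eqP; rewrite eqn_pmul2l // => /eqP //.
Qed.

(** Products of a rough [m <= X] and an [l < z] are distinct and at most [X z], so the product of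
    the two reciprocal sums stays below the harmonic sum up to [X z]. *)
Lemma rsum_le z X : (1 < z)%N -> (z <= X)%N -> rsum z X <= 4 * lnn X / lnn z.
Proof.
move=> z1 zX; have lz := lnn_gt0 R z1.
have z0 : (0 < z)%N by apply: ltnW.
have X0 : (0 < X)%N by apply: leq_trans zX.
have lX := lnn_ge_half R (leq_trans z1 zX).
rewrite ler_pdivlMr //.
have h1 : lnn z <= harm R z.-1 by have := harm_ge R z.-1; rewrite prednK.
have h2 : rsum z X * harm R z.-1 <= harm R (X * z).
  rewrite rsumE !harm_list mulr_suml.
  under eq_bigr do rewrite mulr_sumr.
  rewrite (_ : \sum_(_ <- _) _ = \sum_(b <- [seq (m, l) |
     m <- [seq m <- iota 0 X.+1 | (rough z).-nat m], l <- iota 1 z.-1])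
     (fun b : nat * nat => (b.1 * b.2)%:R^-1) b); last first.
    by rewrite big_allpairs; apply: eq_bigr => m _; apply: eq_bigr => l _; rewrite natrM invfM.
  rewrite -(big_map (fun b : nat * nat => (b.1 * b.2)%N) xpredT (fun n => n%:R^-1)).
  apply: sum_sub_le.
  - rewrite map_inj_in_uniq.
      by rewrite allpairs_uniq ?filter_uniq ?iota_uniq // => -[a b] [c d].
    move=> [m l] [m' l'] /allpairsP[[a b] [/= + + [-> ->]]] /allpairsP[[c d] [/= + + [-> ->]]].
    rewrite !mem_filter !mem_iota => /andP[ra _] hb /andP[rc _] hd e.
    by have [-> ->] := coprime_parts_inj ra rc (rough'_nat_lt (z := z) (l := b) ltac:(lia) ltac:(lia))
      (rough'_nat_lt (z := z) (l := d) ltac:(lia) ltac:(lia)) e.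
  - move=> n /mapP[[m l] /allpairsP[[a b] [/= + + [-> ->]]] ->] /=.
    rewrite mem_filter !mem_iota => /andP[/andP[ra _] ha] hb.
    rewrite muln_gt0 ra /=; apply/andP; split; first lia.
    by rewrite add1n ltnS leq_mul //; lia.
  by move=> n _; rewrite invr_ge0.
apply: (@le_trans _ _ (rsum z X * harm R z.-1)).
  by rewrite ler_wpM2l // /rsum sumr_ge0 // => m _; rewrite invr_ge0.
apply: le_trans h2 _; apply: le_trans (harm_le _ _) _.
have l2 : lnn z <= lnn X by apply: lnn_le.
rewrite lnnM //; move: lX l2; move: (ln X%:R) (ln z%:R) => a b; lra.
Qed.

(** Every [n <= Y] is a rough times a smooth number, so the harmonic sum is at most the product of
    the two reciprocal sums, and the smooth one is [O(log z)]. *)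
Lemma rsum_ge : exists2 c : R, 0 < c & forall z Y, (1 < z)%N ->
  c * lnn Y.+1 / lnn z <= rsum z Y.
Proof.
have [C C0 HC] := smooth_sum_le; exists C^-1; first by rewrite invr_gt0.
move=> z Y z1; have lz := lnn_gt0 R z1.
rewrite ler_pdivrMr // mulrC ler_pdivrMr //.
apply: le_trans (harm_ge _ _) _.
apply: (@le_trans _ _ (rsum z Y * \sum_(0 <= A < Y.+1 | (below predT z).-nat A) A%:R^-1)); last first.
  rewrite -mulrA [_ * C]mulrC ler_wpM2l ?HC //.
  by rewrite /rsum sumr_ge0 // => m _; rewrite invr_ge0.
rewrite rsumE harm_list -[\sum_(0 <= A < Y.+1 | _) _]big_filter mulr_suml.
under [leRHS]eq_bigr do rewrite mulr_sumr.
rewrite [leRHS](_ : _ = \sum_(b <- [seq (m, l) |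
     m <- [seq m <- iota 0 Y.+1 | (rough z).-nat m],
     l <- [seq A <- index_iota 0 Y.+1 | (below predT z).-nat A]])
     (fun n : nat => n%:R^-1) ((fun b : nat * nat => (b.1 * b.2)%N) b)); last first.
  by rewrite big_allpairs; apply: eq_bigr => m _; apply: eq_bigr => l _; rewrite natrM invfM.
apply: (sum_cover_le (h := fun b : nat * nat => (b.1 * b.2)%N) (G := fun n : nat => n%:R^-1)).
- exact: iota_uniq.
- move=> n; rewrite mem_iota => hn; have n0 : (0 < n)%N by lia.
  exists (n`_(rough z), n`_(rough z)^')%N; last by rewrite /= partnC.
  apply: (allpairs_f pair).
    rewrite mem_filter part_pnat mem_iota add0n leq0n ltnS.
    by apply: leq_trans (_ : (n <= Y)%N); [apply: dvdn_leq => //; apply: dvdn_part | lia].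
  rewrite mem_filter mem_index_iota leq0n ltnS; apply/andP; split; last first.
    by apply: leq_trans (_ : (n <= Y)%N); [apply: dvdn_leq => //; apply: dvdn_part | lia].
  apply: sub_in_pnat (part_pnat (rough z)^' n) => p _; rewrite !inE andbT; lia.
by move=> b _; rewrite invr_ge0.
Qed.

End RoughReciprocals.

(** * Counting rough numbers by logarithmic weights *)

Section RoughCount.
Variable R : realType.
Local Notation lnn n := (ln (n%:R : R)).

Lemma trunc_log2_le u : (0 < u)%N -> ((trunc_log 2 u.*2).+1)%:R <= 6 * lnn u.+1.
Proof.
move=> u0; set e := trunc_log 2 _.
have h1 : lnn (2 ^ e)%N <= lnn (u.+1 ^ 2)%N.
  apply: lnn_le; first by rewrite expn_gt0.
  apply: leq_trans (trunc_logP _ _) _ => //; first lia.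
  by rewrite expnS expn1; nia.
rewrite !lnnX // in h1.
have h2 := lnn_ge_half R (u0 : (1 < u.+1)%N); have h3 := ln_ge_half R.
rewrite -natr1; have e0 : 0 <= e%:R :> R by [].
move: h1 h2 h3 e0; move: (ln (2 : R)) (ln _) (e%:R) => a b x; nra.
Qed.

Lemma window_count : exists2 K : R, 0 < K & forall u, (0 < u)%N ->
  u%:R <= K * (primes_in u u.*2)%:R * lnn u.+1.
Proof.
exists (2 ^ 12 * 6)%:R; first by rewrite ltr0n muln_gt0 expn_gt0.
move=> u u0; have := primes_in_lower u0; rewrite -(ler_nat R) => h.
have t := trunc_log2_le u0.
move: (2 ^ 12)%N (primes_in u u.*2) h => N c h; apply: le_trans h _.
rewrite natrM; apply: le_trans (ler_wpM2l _ t) _ => //.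
by apply: eq_lew; rewrite !natrM; ring.
Qed.

Lemma primes_inE a b : (primes_in a b)%:R = \sum_(a.+1 <= p < b.+1 | prime p) 1 :> R.
Proof. by rewrite natr_sum. Qed.

Lemma window_theta : exists2 K : R, 0 < K & forall u, (0 < u)%N ->
  u%:R <= K * \sum_(u.+1 <= p < u.*2.+1 | prime p) lnn p.
Proof.
have [K K0 HK] := window_count; exists K => // u u0.
apply: le_trans (HK _ u0) _; rewrite -mulrA ler_wpM2l ?(ltW K0) //.
rewrite primes_inE mulr_suml big_nat_cond [leRHS]big_nat_cond.
by apply: ler_sum => p hp; rewrite mul1r lnn_le //; lia.
Qed.

Lemma isqrt_ex Y : exists s, (s ^ 2 <= Y < s.+1 ^ 2)%N.
Proof.
elim: Y => [|Y [s hs]]; first by exists 0%N.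
have [h|h] := leqP (s.+1 ^ 2) Y.+1; last by exists s; lia.
exists s.+1; rewrite h /=; move: hs h; rewrite !expnS !expn0; nia.
Qed.

Lemma lnn_sum n X : (0 < n)%N -> (n <= X)%N ->
  lnn n = \sum_(0 <= p < X.+1 | prime p) (logn p n)%:R * lnn p.
Proof.
move=> n0 nX; rewrite -{1}(partnT n0) (widen_partn _ nX) /=.
have -> : lnn (\prod_(0 <= p < X.+1 | p \in predT) p ^ logn p n)%N =
   \sum_(0 <= p < X.+1) lnn (p ^ logn p n)%N.
  elim: X {nX} => [|X IH]; first by rewrite !unlock /= lognE /= expn0 muln1 ln1 addr0.
  have P0 : (0 < \prod_(0 <= p < X.+1) p ^ logn p n)%N.
    apply: prodn_gt0 => p; case: p => [|p]; first by rewrite lognE.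
    by rewrite expn_gt0.
  have q0 : (0 < X.+1 ^ logn X.+1 n)%N by rewrite expn_gt0.
  by rewrite [in LHS]big_nat_recr //= lnnM // IH -big_nat_recr.
rewrite [RHS]big_mkcond; apply: eq_bigr => p _.
case: ifP => [/prime_gt0 p0|pr]; first by rewrite lnnX.
by rewrite lognE pr expn0 ln1.
Qed.

(** Chebyshev's [psi]. The at most [sqrt Y] primes up to [sqrt Y] contribute at most [log Y], which
    is [O(sqrt Y)], each; above, the exponent is 1 and [theta] takes over. *)
Lemma psi_le Y : \sum_(0 <= p < Y.+1 | prime p) (trunc_log p Y)%:R * lnn p <= 4 * Y%:R.
Proof.
have [->|Y0] := posnP Y.
  by rewrite big_mkcond big_nat1 /= mulr0.
have [s /andP[sY Ys]] := isqrt_ex Y.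
rewrite (bigID (fun p => (p <= s)%N)) /=.
have -> : 4 * Y%:R = 2 * Y%:R + 2 * Y%:R :> R by ring.
apply: lerD.
  apply: (@le_trans _ _ (\sum_(0 <= p < Y.+1 | prime p && (p <= s)%N) lnn Y)).
    apply: ler_sum => p /andP[pr ps]; rewrite -lnnX ?prime_gt0 //.
    apply: lnn_le; first by rewrite expn_gt0 prime_gt0.
    by apply: trunc_logP => //; apply: prime_gt1.
  apply: (@le_trans _ _ (\sum_(p <- iota 1 s) lnn Y)).
    rewrite -big_filter; apply: sum_sub_le.
    - by rewrite filter_uniq // iota_uniq.
    - by move=> p; rewrite mem_filter mem_iota => /andP[/andP[/prime_gt0 -> ps] _]; rewrite add1n ltnS.
    by move=> p _; apply: lnn_ge0.
  rewrite big_const_seq count_predT size_iota iter_addr_0 -[lnn Y *+ s]mulr_natl.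
  have h1 : lnn Y <= 2 * s%:R.
    apply: (@le_trans _ _ (lnn (s.+1 ^ 2)%N)); first by apply: lnn_le => //; apply: ltnW.
    rewrite lnnX // ler_wpM2l //.
    have := @le_ln1Dx R s%:R; rewrite -natr1 addrC; apply.
    by apply: lt_le_trans (ltrN10 _) _.
  have h2 : s%:R * s%:R <= Y%:R :> R by rewrite -natrM ler_nat mulnn.
  apply: (@le_trans _ _ (s%:R * (2 * s%:R))); first by rewrite ler_wpM2l.
  by rewrite mulrCA ler_wpM2l.
apply: le_trans (theta_le R Y).
rewrite /theta big_mkcondr /= big_seq_cond [leRHS]big_seq_cond; apply: ler_sum => p /andP[hp pr].
case: ifP => ps; last exact: lnn_ge0.
rewrite -[leRHS]mul1r ler_wpM2r ?lnn_ge0 // lern1.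
rewrite -ltnS -(ltn_exp2l _ _ (prime_gt1 pr)).
apply: leq_ltn_trans (trunc_logP (prime_gt1 pr) Y0) _.
apply: leq_trans Ys _; rewrite leq_exp2r //; lia.
Qed.

Definition phi z X : R := \sum_(0 <= n < X.+1 | (rough z).-nat n) 1.

Lemma phi_multiples z X q : (0 < q)%N -> (rough z).-nat q ->
  \sum_(0 <= n < X.+1 | (rough z).-nat n && (q %| n)%N) 1 <=
  \sum_(0 <= m < X.+1 | (rough z).-nat m && (m * q <= X)%N) 1 :> R.
Proof.
move=> q0 rq; rewrite -big_filter -[leRHS]big_filter.
apply: (sum_cover_le (h := fun m => (m * q)%N) (G := fun=> 1)) => //.
  by rewrite filter_uniq // iota_uniq.
move=> n; rewrite mem_filter mem_index_iota => /andP[/andP[rn qn] hn].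
exists (n %/ q)%N; last by rewrite divnK.
rewrite mem_filter mem_index_iota divnK //; apply/andP; split.
  apply/andP; split; last by lia.
  apply: pnat_dvd rn; exact: dvdn_div.
by have := leq_div n q; lia.
Qed.

(** Expand [log n] over the prime powers dividing [n], write [n = m p^a] with [m] again rough, and
    sum over [p^a <= X/m] first: that is [psi], at most [4 X/m]. *)
Lemma sum_lnn_rough z X :
  \sum_(0 <= n < X.+1 | (rough z).-nat n) lnn n <= 4 * X%:R * rsum R z X.
Proof.
apply: (@le_trans _ _ (\sum_(0 <= n < X.+1 | (rough z).-nat n)
   \sum_(0 <= p < X.+1 | prime p) \sum_(1 <= a < X.+1 | (p ^ a %| n)%N) lnn p)).
  rewrite big_nat_cond [leRHS]big_nat_cond; apply: ler_sum => n /andP[hn rn].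
  have n0 : (0 < n)%N by case/andP: rn.
  rewrite (@lnn_sum n X) //; try lia.
  apply: ler_sum => p pr; rewrite logn_count_dvd // natr_sum mulr_suml.
  rewrite [leRHS]big_mkcond /= [leRHS](@big_cat_nat _ _ _ n) //=; last by lia.
  rewrite -[leLHS]addr0; apply: lerD.
    by apply: ler_sum => a _; case: (_ %| _)%N; rewrite ?mul1r ?mul0r.
  by apply: sumr_ge0 => a _; case: ifP => // _; apply: lnn_ge0.
rewrite exchange_big /=.
apply: (@le_trans _ _ (\sum_(0 <= p < X.+1 | prime p) \sum_(0 <= m < X.+1 | (rough z).-nat m)
    \sum_(1 <= a < X.+1 | (m * p ^ a <= X)%N) lnn p)).
  apply: ler_sum => p pr.
  under eq_bigr do rewrite big_mkcond.
  under [leRHS]eq_bigr do rewrite big_mkcond.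
  rewrite exchange_big [leRHS]exchange_big /= big_nat_cond [leRHS]big_nat_cond.
  apply: ler_sum => a /andP[ha _]; rewrite -!big_mkcondr /=.
  have E (P : pred nat) : \sum_(0 <= i < X.+1 | P i) lnn p =
      lnn p * \sum_(0 <= i < X.+1 | P i) 1.
    by rewrite mulr_sumr; apply: eq_bigr => i _; rewrite mulr1.
  rewrite !E ler_wpM2l ?lnn_ge0 //.
  have p0 := prime_gt0 pr.
  have [zp|pz] := leqP z p.
    apply: phi_multiples; first by rewrite expn_gt0 p0.
    by rewrite pnatX pnatE // inE zp.
  rewrite big1 ?sumr_ge0 // => n /andP[rn dv].
  have pn : (p %| n)%N by apply: dvdn_trans dv; rewrite dvdn_exp //; lia.
  have := pnatPpi rn; move=> /(_ p); rewrite mem_primes pr pn (andP rn).1 => /(_ isT).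
  by rewrite !inE leqNgt pz.
rewrite exchange_big /= /rsum mulr_sumr big_nat_cond [leRHS]big_nat_cond.
apply: ler_sum => m /andP[hm rm]; have m0 : (0 < m)%N by case/andP: rm.
set Y := (X %/ m)%N.
have YX : (Y <= X)%N by apply: leq_div.
apply: (@le_trans _ _ (4 * Y%:R)); last first.
  by rewrite -mulrA ler_wpM2l // ler_pdivlMr ?ltr0n // -natrM ler_nat leq_trunc_div.
apply: le_trans (psi_le Y).
apply: (@le_trans _ _ (\sum_(0 <= p < X.+1 | prime p) (trunc_log p Y)%:R * lnn p)).
  apply: ler_sum => p pr; apply: (@le_trans _ _ (\sum_(a <- iota 1 (trunc_log p Y)) lnn p)).
    rewrite -big_filter; apply: sum_sub_le.
    - by rewrite filter_uniq // iota_uniq.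
    - move=> a; rewrite mem_filter mem_index_iota mem_iota => /andP[ma /andP[-> _]].
      rewrite add1n ltnS; apply: trunc_log_max; first exact: prime_gt1.
      by rewrite leq_divRL // mulnC.
    by move=> a _; apply: lnn_ge0.
  by rewrite big_const_seq count_predT size_iota iter_addr_0 -[lnn p *+ _]mulr_natl.
rewrite big_mkcond (@big_cat_nat _ _ _ Y.+1) //= -[leRHS]addr0 -big_mkcond lerD2l.
rewrite big_nat_cond big1 // => p /andP[hp _]; case: ifP => // pr.
suff -> : trunc_log p Y = 0%N by rewrite mul0r.
by apply/eqP; rewrite trunc_log_eq0; lia.
Qed.

(** Integers above [sqrt X] have logarithm at least [(log X)/2], so [sum_lnn_rough] and [rsum_le]
    bound their number with constant [2 * 4 * 4 = 32]. Those below [sqrt X] add at most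
    [2 X / log z]. *)
Lemma phi_le z X : (1 < z)%N -> (z <= X)%N -> phi z X <= 34 * X%:R / lnn z.
Proof.
move=> z1 zX; have lz := lnn_gt0 R z1.
have X1 : (1 < X)%N by apply: leq_trans zX.
have lX := lnn_gt0 R X1.
have lzX : lnn z <= lnn X by apply: lnn_le => //; apply: ltnW.
have [s /andP[sX Xs]] := isqrt_ex X.
rewrite /phi (bigID (fun n => (n <= s)%N)) /=.
have -> : 34 * X%:R / lnn z = 2 * X%:R / lnn z + 32 * X%:R / lnn z by field; lra.
apply: lerD.
  apply: (@le_trans _ _ (\sum_(n <- iota 1 s) 1)).
    rewrite -big_filter; apply: sum_sub_le => //.
      by rewrite filter_uniq // iota_uniq.
    move=> n; rewrite mem_filter mem_iota => /andP[/andP[/andP[n0 _] ns] _].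
    by rewrite n0 add1n ltnS.
  rewrite big_const_seq count_predT size_iota iter_addr_0 ler_pdivlMr //.
  have h1 : lnn X <= 2 * s%:R.
    apply: (@le_trans _ _ (lnn (s.+1 ^ 2)%N)); first by apply: lnn_le; lia.
    rewrite lnnX // ler_wpM2l //.
    have := @le_ln1Dx R s%:R; rewrite -natr1 addrC; apply.
    by apply: lt_le_trans (ltrN10 _) _.
  have h2 : s%:R * s%:R <= X%:R :> R by rewrite -natrM ler_nat mulnn.
  have s0 : 0 <= s%:R :> R by [].
  apply: (@le_trans _ _ (s%:R * (2 * s%:R))).
    by rewrite ler_wpM2l // (le_trans lzX).
  by rewrite mulrCA ler_wpM2l.
have rs := rsum_le R z1 zX.
have sl := sum_lnn_rough z X.
apply: (@le_trans _ _ (2 / lnn X * \sum_(0 <= n < X.+1 | (rough z).-nat n) lnn n)).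
  rewrite mulr_sumr big_mkcondr /=; apply: ler_sum => n rn.
  case: ifP => ns; last by rewrite mulr_ge0 ?lnn_ge0 // divr_ge0 // ltW.
  have n0 : (0 < n)%N by case/andP: rn.
  rewrite mulrAC ler_pdivlMr // mul1r -lnnX //; apply: lnn_le; first by lia.
  apply/ltnW; apply: leq_trans Xs _; rewrite leq_exp2r //; lia.
have c0 : 0 <= 2 / lnn X by rewrite divr_ge0 // ltW.
apply: le_trans (ler_wpM2l c0 sl) _.
have c1 : 0 <= 2 / lnn X * (4 * X%:R) by rewrite mulr_ge0 // mulr_ge0.
rewrite mulrA; apply: le_trans (ler_wpM2l c1 rs) _.
apply: eq_lew; field.
by apply/andP; split; lra.
Qed.

(** Dual to the upper bound: the primes of an [n <= X] have total logarithm at most [log X], and the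
    products [m p] with [m] rough up to [X/(2z)] and [p] in [(u, 2u]], [u = X/(2m) >= z], supply
    enough pairs. *)
Lemma phi_ge : exists2 c : R, 0 < c &
  forall z X, (1 < z)%N -> (4 * z ^ 2 <= X)%N -> c * X%:R / lnn z <= phi z X.
Proof.
have [c c0 Hc] := rsum_ge R.
have [K K0 HK] := window_theta.
exists (c / (8 * K)); first by rewrite divr_gt0 // mulr_gt0.
move=> z X z1 zX.
have lz := lnn_gt0 R z1.
have X1 : (1 < X)%N by move: zX; rewrite expnS expn1; nia.
have lX := lnn_gt0 R X1.
pose M := (X %/ (2 * z))%N.
have main : X%:R / (4 * K) * rsum R z M <= lnn X * phi z X.
  apply: (@le_trans _ _ (\sum_(0 <= n < X.+1 | (rough z).-nat n)
     \sum_(0 <= p < X.+1 | prime p && (p %| n)%N) lnn p)); last first.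
    rewrite /phi mulr_sumr big_nat_cond [leRHS]big_nat_cond; apply: ler_sum => n /andP[hn rn].
    have n0 : (0 < n)%N by case/andP: rn.
    rewrite mulr1; apply: (@le_trans _ _ (lnn n)); last by apply: lnn_le; lia.
    rewrite (@lnn_sum n X) //; try lia.
    rewrite big_mkcondr /=; apply: ler_sum => p pr; case: ifP => pn.
      rewrite -[leLHS]mul1r ler_wpM2r ?lnn_ge0 // ler1n logn_gt0.
      by rewrite mem_primes pr n0 pn.
    by rewrite mulr_ge0 // lnn_ge0.
  apply: (@le_trans _ _ (\sum_(0 <= m < X.+1 | (rough z).-nat m && (m <= M)%N)
    \sum_(0 <= p < X.+1 | [&& prime p, z <= p & m * p <= X]%N) lnn p)).
    apply: (@le_trans _ _ (\sum_(0 <= m < X.+1 | (rough z).-nat m && (m <= M)%N) X%:R / (4 * K) / m%:R)).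
      rewrite -mulr_sumr /rsum ler_wpM2l ?divr_ge0 ?mulr_ge0 // ?(ltW K0) //.
      rewrite -big_filter -[leRHS]big_filter; apply: sum_sub_le.
      - by rewrite filter_uniq // iota_uniq.
      - move=> m; rewrite !mem_filter !mem_index_iota => /andP[-> hm] /=.
        by have := leq_div X (2 * z); rewrite -/M; lia.
      by move=> m _; rewrite invr_ge0.
    apply: ler_sum => m /andP[rm mM]; have m0 : (0 < m)%N by case/andP: rm.
    pose u := (X %/ m %/ 2)%N.
    have zu : (z <= u)%N.
      rewrite /u -divnMA leq_divRL ?muln_gt0 ?m0 //.
      apply: leq_trans (leq_trunc_div X (2 * z)); rewrite -/M; nia.
    have u0 : (0 < u)%N by lia.
    have um : (2 * u * m <= X)%N.
      by have := leq_trunc_div X (m * 2); rewrite divnMA -/u; lia.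
    apply: (@le_trans _ _ (\sum_(u.+1 <= p < u.*2.+1 | prime p) lnn p)).
      have wt := HK _ u0.
      rewrite -(ler_pM2l K0); apply: le_trans wt.
      rewrite mulrA ler_pdivrMr ?ltr0n // -natrM.
      have -> : K * (X%:R / (4 * K)) = X%:R / 4 by field; lra.
      rewrite ler_pdivrMr // -natrM ler_nat.
      have h := ltn_ceil X (m0 : (0 < m)%N); have h2 := ltn_ceil (X %/ m) (isT : (0 < 2)%N).
      rewrite -/u in h2; nia.
    rewrite -big_filter -[leRHS]big_filter; apply: sum_sub_le.
    - by rewrite filter_uniq // iota_uniq.
    - move=> p; rewrite !mem_filter !mem_index_iota => /andP[-> hp] /=.
      apply/andP; split; first by apply/andP; split; nia.
      by rewrite ltnS; nia.
    by move=> p _; apply: lnn_ge0.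
  rewrite (exchange_big_dep (fun p => prime p && (z <= p)%N)) /=; last first.
    by move=> m p _ /and3P[-> ->].
  rewrite [leRHS](exchange_big_dep prime) /=; last by move=> m p _ /andP[].
  rewrite big_mkcondr /=; apply: ler_sum => p pr.
  case: ifP => zp; last by apply: sumr_ge0 => n _; apply: lnn_ge0.
  have p0 := prime_gt0 pr.
  rewrite -big_filter -[leRHS]big_filter.
  rewrite [leLHS](_ : _ = \sum_(n <- [seq (m * p)%N | m <- [seq i <- index_iota 0 X.+1 |
     (rough z).-nat i && (i <= M)%N & [&& prime p, (z <= p)%N & (i * p <= X)%N]]]) lnn p); last first.
    by rewrite big_map.
  apply: sum_sub_le.
  - rewrite map_inj_uniq ?filter_uniq ?iota_uniq //.
    by move=> a b /eqP; rewrite eqn_pmul2r // => /eqP.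
  - move=> n /mapP[m]; rewrite mem_filter => /andP[/andP[/andP[rm _] /and3P[_ _ hX]] _] ->.
    rewrite mem_filter mem_index_iota /= ltnS hX andbT pr dvdn_mull // !andbT.
    by rewrite pnatM rm pnatE // inE zp.
  by move=> n _; apply: lnn_ge0.
(* [M + 1 > X/(2z)] and [4 z^2 <= X] give [(M+1)^2 >= X]. *)
have lM : 1 / 2 * lnn X <= lnn M.+1.
  suff : lnn X <= 2 * lnn M.+1 by move: (ln X%:R) (ln M.+1%:R) => a b; lra.
  rewrite -lnnX //; apply: lnn_le; first lia.
  have h := @ltn_ceil X (2 * z)%N ltac:(lia); rewrite -/M in h.
  move: zX h; rewrite !expnS !expn0; nia.
have HM := Hc z M z1.
rewrite -(ler_pM2l lX); apply: le_trans main.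
have h : X%:R / (4 * K) * (c * lnn M.+1 / lnn z) <= X%:R / (4 * K) * rsum R z M.
  by rewrite ler_wpM2l // divr_ge0 // mulr_ge0 // ltW.
apply: le_trans h.
have -> : lnn X * (c / (8 * K) * X%:R / lnn z) = (X%:R / (4 * K) * (c / lnn z)) * (1 / 2 * lnn X).
  by field; apply/andP; split; lra.
have -> : X%:R / (4 * K) * (c * lnn M.+1 / lnn z) = (X%:R / (4 * K) * (c / lnn z)) * lnn M.+1.
  by field; apply/andP; split; lra.
rewrite ler_wpM2l // mulr_ge0 // divr_ge0 // ?mulr_ge0 // ltW //.
Qed.

End RoughCount.

(** * Dyadic cells of divisor vectors *)

Section DyadicCells.
Local Open Scope nat_scope.

Local Notation lg := (trunc_log 2).

Lemma lg_mul a b : 0 < a -> 0 < b ->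
  exists e : bool, lg (a * b) = lg a + (lg b + e).
Proof.
move=> a0 b0.
have /andP[a1 a2] := trunc_log_bounds (isT : 1 < 2) a0.
have /andP[b1 b2] := trunc_log_bounds (isT : 1 < 2) b0.
have [h|h] := leqP (2 ^ (lg a + lg b).+1) (a * b).
  exists true; rewrite addn1 addnS; apply: trunc_log_eq => //.
  by rewrite h /= -addnS -addSn expnD ltn_mul.
exists false; rewrite addn0; apply: trunc_log_eq => //.
by rewrite h andbT expnD leq_mul.
Qed.

(** Give to [e_0] all that [A] can take, [gcd(d_0, A)]; the rest of [d_0] is coprime to [A / e_0],
    so it divides [B]. Continue with the two quotients. *)
Lemma prod_dvd_split k (d : 'I_k -> nat) A B : 0 < A -> 0 < B ->
  \prod_i d i %| A * B ->
  exists e f : 'I_k -> nat, [/\ forall i, d i = e i * f i,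
    \prod_i e i %| A & \prod_i f i %| B].
Proof.
elim: k d A B => [|k IH] d A B A0 B0.
  by exists (fun=> 1), (fun=> 1); rewrite !big_ord0 !dvd1n; split => // -[].
rewrite big_ord_recl /= => dv.
have d0 : 0 < d ord0.
  by have := dvdn_gt0 (m := A * B) _ dv; rewrite !muln_gt0 A0 B0 => /(_ isT) /andP[].
pose e0 := gcdn (d ord0) A; pose f0 := d ord0 %/ e0.
have eg : 0 < e0 by rewrite gcdn_gt0 d0.
have dE : d ord0 = e0 * f0 by rewrite /f0 mulnC divnK // dvdn_gcdl.
have range_part : e0 %| A by apply: dvdn_gcdr.
have f0g : 0 < f0 by move: d0; rewrite dE muln_gt0 => /andP[].
have cop : coprime f0 (A %/ e0).
  rewrite /coprime -(eqn_pmul2l eg) muln_gcdr -dE [e0 * (A %/ e0)]mulnC divnK //.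
  by rewrite muln1.
have fB : f0 %| B.
  rewrite -(Gauss_dvdr _ cop) -(dvdn_pmul2l eg) -dE mulnA [e0 * _]mulnC divnK //.
  by apply: dvdn_trans dv; apply: dvdn_mulr.
have A1 : 0 < A %/ e0 by rewrite divn_gt0 // dvdn_leq.
have B1 : 0 < B %/ f0 by rewrite divn_gt0 // dvdn_leq.
have E : d ord0 * ((A %/ e0) * (B %/ f0)) = A * B.
  by rewrite dE mulnACA [e0 * _]mulnC [f0 * _]mulnC !divnK.
have dv' : \prod_(i < k) d (lift ord0 i) %| (A %/ e0) * (B %/ f0).
  by rewrite -(dvdn_pmul2l d0) E.
have [e [f [h1 h2 h3]]] := IH _ _ _ A1 B1 dv'.
exists (fun i => if unlift ord0 i is Some j then e j else e0),
  (fun i => if unlift ord0 i is Some j then f j else f0); split.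
- by move=> i; case: unliftP => [j ->|->]; [apply: h1 | exact: dE].
- rewrite big_ord_recl unlift_none -(divnK range_part) mulnC dvdn_pmul2r //.
  by under eq_bigr do rewrite liftK.
- rewrite big_ord_recl unlift_none -(divnK fB) mulnC dvdn_pmul2r //.
  by under eq_bigr do rewrite liftK.
Qed.

Lemma bool_double_bound (b : bool) a v : a <= v -> b + a.*2 < 2 * v.+1.
Proof. by case: b; lia. Qed.

Section Nt.
Variable k : nat.
Notation vec := {ffun 'I_k -> nat}.

Definition box B : seq vec :=
  [seq [ffun i => nat_of_ord (f i)] | f : {ffun 'I_k -> 'I_B} <- enum {ffun 'I_k -> 'I_B}].

Lemma mem_box B m : (m \in box B) = [forall i, m i < B].
Proof.
apply/mapP/forallP => [[f _ ->] i|h]; first by rewrite ffunE.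
exists [ffun i => Ordinal (h i)]; first by rewrite mem_enum.
by apply/ffunP => i; rewrite !ffunE.
Qed.

Lemma size_box B : size (box B) = B ^ k.
Proof. by rewrite size_map -cardE card_ffun !card_ord. Qed.

(** Controls overlaps: numbers confined to an interval of ratio 2 have at most two dyadic exponents
    in each coordinate. *)
Lemma size_two_values (s : seq vec) (c : 'I_k -> nat) : uniq s ->
  (forall m i, m \in s -> c i <= m i <= (c i).+1) -> size s <= 2 ^ k.
Proof.
move=> us h; rewrite -(size_box 2) -(size_map (fun m : vec => [ffun i => m i + c i] : vec) (box 2)).
apply: uniq_leq_size => // m ms; apply/mapP.
exists [ffun i => m i - c i]; last first.
  by apply/ffunP => i; rewrite !ffunE subnK //; have := h m i ms; lia.
by rewrite mem_box; apply/forallP => i; rewrite ffunE; have := h m i ms; lia.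
Qed.

Implicit Types (t : 'I_k -> nat).

Definition okd t A (d : vec) :=
  (\prod_i d i %| A) && [forall i, (below predT (t i)).-nat (d i)].
Definition lgv (d : vec) : vec := [ffun i => lg (d i)].
(* The dyadic cells of the vectors [d] satisfying [okd t A], a discrete stand-in
   for the union of cubes whose volume is [L]. *)
Definition Mlist t A := undup [seq lgv d | d <- box A.+1 & okd t A d].
Definition Nt t A := size (Mlist t A).

Lemma okd_gt0 t A d i : okd t A d -> 0 < d i.
Proof. by case/andP => _ /forallP /(_ i) /andP[]. Qed.

Lemma okd_dvd t A d i : okd t A d -> d i %| A.
Proof. by case/andP => h _; apply: dvdn_trans h; rewrite (bigD1 i) //= dvdn_mulr. Qed.

Lemma okd_box t A d : 0 < A -> okd t A d -> d \in box A.+1.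
Proof.
move=> A0 h; rewrite mem_box; apply/forallP => i.
by rewrite ltnS; apply: dvdn_leq => //; apply: okd_dvd h.
Qed.

Lemma MlistP t A m : 0 < A ->
  reflect (exists2 d, okd t A d & m = lgv d) (m \in Mlist t A).
Proof.
move=> A0; rewrite mem_undup; apply: (iffP mapP) => [[d]|[d h ->]].
  by rewrite mem_filter => /andP[h _] ->; exists d.
by exists d => //; rewrite mem_filter h (okd_box A0 h).
Qed.

Lemma Mlist_uniq t A : uniq (Mlist t A). Proof. exact: undup_uniq. Qed.

Lemma Nt_le t t' A A' : 0 < A -> 0 < A' ->
  (forall d, okd t A d -> okd t' A' d) -> Nt t A <= Nt t' A'.
Proof.
move=> A0 A0' h; apply: uniq_leq_size; first exact: Mlist_uniq.
by move=> m /(MlistP _ _ A0)[d hd ->]; apply/(MlistP _ _ A0'); exists d => //; apply: h.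
Qed.

Lemma Nt_gt0 t A : 0 < A -> 0 < Nt t A.
Proof.
move=> A0; suff : lgv [ffun=> 1] \in Mlist t A by rewrite /Nt; case: Mlist.
apply/MlistP => //; exists [ffun=> 1] => //; apply/andP; split.
  by rewrite big1 ?dvd1n // => i _; rewrite ffunE.
by apply/forallP => i; rewrite ffunE.
Qed.

Lemma Nt_eq t t' A : 0 < A ->
  (forall i p, prime p -> p %| A -> (p <= t i) = (p <= t' i)) -> Nt t A = Nt t' A.
Proof.
move=> A0 h; apply/eqP; rewrite eqn_leq; apply/andP; split.
  apply: Nt_le => // d hd; have /andP[dv /forallP sm] := hd; apply/andP; split => //.
  apply/forallP => i; apply: sub_in_pnat (sm i) => p; rewrite mem_primes => /and3P[pr _ pd].
  by rewrite !inE !andbT h //; apply: dvdn_trans pd (okd_dvd _ hd).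
apply: Nt_le => // d hd; have /andP[dv /forallP sm] := hd; apply/andP; split => //.
apply/forallP => i; apply: sub_in_pnat (sm i) => p; rewrite mem_primes => /and3P[pr _ pd].
by rewrite !inE !andbT h //; apply: dvdn_trans pd (okd_dvd _ hd).
Qed.

(** A vector for [A q^v] splits off powers [q^a], [a <= v], coordinatewise. Its cell is a cell of
    [A] shifted by [lg (q^a)] plus a carry bit, which leaves [2(v+1)] choices per coordinate. *)
Lemma Nt_pow t A q v : 0 < A -> prime q ->
  Nt t (A * q ^ v) <= (2 * v.+1) ^ k * Nt t A.
Proof.
move=> A0 pr; have q0 := prime_gt0 pr.
have qv0 : 0 < q ^ v by rewrite expn_gt0 q0.
have Aq0 : 0 < A * q ^ v by rewrite muln_gt0 A0.
(* [c i] encodes both data: [(c i)./2] is the exponent [a], the parity is the carry. *)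
pose sh (m : vec) (c : {ffun 'I_k -> 'I_(2 * v.+1)}) : vec :=
  [ffun i => m i + (lg (q ^ (c i)./2) + odd (c i))].
have -> : (2 * v.+1) ^ k * Nt t A =
  size [seq sh m c | m <- Mlist t A, c <- enum {ffun 'I_k -> 'I_(2 * v.+1)}].
  by rewrite size_allpairs -cardE card_ffun !card_ord mulnC.
apply: uniq_leq_size; first exact: Mlist_uniq.
move=> m /(MlistP _ _ Aq0)[d hd ->].
have /andP[dv /forallP sm] := hd.
have [e [f [h1 h2 h3]]] := prod_dvd_split A0 qv0 dv.
have he : okd t A [ffun i => e i].
  apply/andP; split; first by under eq_bigr do rewrite ffunE.
  apply/forallP => i; rewrite ffunE; apply: pnat_dvd (sm i).
  by rewrite h1 dvdn_mulr.
have ha i : exists c : 'I_(2 * v.+1), lg (d i) == lg (e i) + (lg (q ^ c./2) + odd c).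
  have fi : f i %| q ^ v by apply: dvdn_trans h3; rewrite (bigD1 i) //= dvdn_mulr.
  have /(dvdn_pfactor _ _ pr)[a av fE] := fi.
  have e0 : 0 < e i by have := okd_gt0 i he; rewrite ffunE.
  have f0 : 0 < q ^ a by rewrite expn_gt0 q0.
  have [b lgE] := lg_mul e0 f0.
  have hc := bool_double_bound b av.
  exists (Ordinal hc); apply/eqP; rewrite /= h1 fE lgE; congr (_ + (lg (q ^ _) + _)).
    by rewrite half_bit_double.
  by rewrite oddD odd_double addbF; case: b {lgE hc}.
pose c := [ffun i => xchoose (ha i)].
have -> : lgv d = sh (lgv [ffun i => e i]) c.
  by apply/ffunP => i; rewrite !ffunE; exact/eqP/(xchooseP (ha i)).
apply: allpairs_f; last by rewrite mem_enum.
by apply/MlistP => //; exists [ffun i => e i].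
Qed.

End Nt.

End DyadicCells.

(** * Lower bound *)

Section Excess.
Variable R : realType.
Local Notation lnn n := (ln (n%:R : R)).

(** Multiply by [log w <= log p] and use the sum of [log p / p] up to [w^h]; [10 = 8 + 2] comes from
    [4 <= 8 log w] and [log (w^h + 1) <= (h+1) log w]. *)
Lemma sum_window_le w h N : (1 < w)%N ->
  \sum_(0 <= p < N.+1 | prime p && (w <= p <= w ^ h)%N) p%:R^-1 <= (10 + 2 * h)%:R :> R.
Proof.
move=> w1; have lw := lnn_ge_half R w1; have lw0 := lnn_gt0 R w1.
have w0 : (0 < w)%N by apply: ltnW.
rewrite -(ler_pM2l lw0) mulr_sumr.
apply: (@le_trans _ _ (\sum_(0 <= p < (w ^ h).+1 | prime p) lnn p / p%:R)).
  apply: (@le_trans _ _ (\sum_(0 <= p < N.+1 | prime p && (w <= p <= w ^ h)%N) lnn p / p%:R)).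
    apply: ler_sum => p /andP[pr /andP[wp _]]; rewrite ler_wpM2r ?invr_ge0 //.
    exact: lnn_le.
  rewrite -big_filter -[leRHS]big_filter; apply: sum_sub_le.
  - by rewrite filter_uniq // iota_uniq.
  - move=> p; rewrite !mem_filter !mem_index_iota => /andP[/andP[-> /andP[_ pw]] _].
    by rewrite ltnS.
  by move=> p _; rewrite divr_ge0 // lnn_ge0.
apply: le_trans (sum_lnp_div_le _ _) _.
have l2 : lnn (w ^ h).+1 <= h.+1%:R * lnn w.
  rewrite -lnnX //; apply: lnn_le => //; rewrite expnS.
  have : (0 < w ^ h)%N by rewrite expn_gt0 w0.
  by nia.
have e1 : (10 + 2 * h)%:R = 10 + 2 * h%:R :> R by rewrite natrD natrM.
have e2 : h.+1%:R = h%:R + 1 :> R by rewrite natr1.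
rewrite e1; move: l2 lw; rewrite e2.
by move: (ln (w ^ h).+1%:R) (ln w%:R) (h%:R) => a b c; nra.
Qed.

Lemma excess_prod_le K (w : 'I_K -> nat) h n (E : pred nat) (c : R) :
  0 <= c -> (forall i, (1 < w i)%N) ->
  (forall p, prime p -> E p -> exists i, (w i <= p <= w i ^ h)%N) ->
  \prod_(0 <= p < n.+1 | prime p && E p) (1 + c / p%:R) <=
  expR (c * (K * (10 + 2 * h))%:R).
Proof.
move=> c0 w1 HE; apply: le_trans (prod_1D_le _ _) _.
  by move=> p _; rewrite divr_ge0.
rewrite ler_expR -mulr_sumr ler_wpM2l //.
apply: (@le_trans _ _ (\sum_(i < K)
   \sum_(0 <= p < n.+1 | prime p && (w i <= p <= w i ^ h)%N) p%:R^-1)); last first.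
  apply: (@le_trans _ _ (\sum_(i < K) (10 + 2 * h)%:R)).
    by apply: ler_sum => i _; apply: sum_window_le.
  by rewrite sumr_const card_ord -[_ *+ K]mulr_natl natrM.
under [leRHS]eq_bigr do rewrite big_mkcond.
rewrite exchange_big big_mkcond /=; apply: ler_sum => p _.
case: ifP => [/andP[pr Ep]|_]; last first.
  by apply: sumr_ge0 => i _; case: ifP => // _; rewrite invr_ge0.
have [i hi] := HE p pr Ep; rewrite (bigD1 i) //= pr hi /= lerDl.
by apply: sumr_ge0 => j _; case: ifP => // _; rewrite invr_ge0.
Qed.

Lemma root_ex h Y : (0 < h)%N -> (0 < Y)%N -> exists v, (0 < v)%N /\ (v ^ h <= Y < v.+1 ^ h)%N.
Proof.
move=> h0 Y0.
have ex : exists v, (v ^ h <= Y)%N by exists 1%N; rewrite exp1n.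
have ub v : (v ^ h <= Y)%N -> (v <= Y)%N.
  move=> hv; apply: leq_trans hv; case: v => // v.
  by rewrite -{1}[v.+1]expn1 leq_pexp2l.
case: (ex_maxnP ex ub) => v hv mv; exists v; split; last first.
  by rewrite hv /= ltnNge; apply/negP => /mv; rewrite ltnn.
by apply: mv; rewrite exp1n.
Qed.

End Excess.

Section NtReal.
Variables (R : realType) (k : nat) (t : 'I_k.+1 -> nat).

Definition FN (A : nat) : R := (Nt t A)%:R.

Lemma FN_ge0 A : 0 <= FN A. Proof. exact: ler0n. Qed.

Lemma FN_pow A q v : (0 < A)%N -> prime q -> FN (A * q ^ v)%N <= gpow R k.+1 v * FN A.
Proof.
by move=> A0 pr; rewrite /FN /gpow -natrX -natrM ler_nat; apply: Nt_pow.
Qed.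

Lemma FN_mul A q : (0 < A)%N -> prime q -> FN (A * q)%N <= gpow R k.+1 1 * FN A.
Proof. by move=> A0 pr; have := @FN_pow A q 1%N A0 pr; rewrite expn1. Qed.

Definition Ssum : R := divsum (prodQ predT (t ord_max)) FN.

Lemma Ssum_ge1 : 1 <= Ssum.
Proof.
rewrite /Ssum /divsum.
have P0 := prodQ_gt0 predT (t ord_max).
apply: (@le_trans _ _ (\sum_(A <- [:: 1%N]) FN A / A%:R)).
  by rewrite big_seq1 divr1 /FN ler1n Nt_gt0.
apply: sum_sub_le => //.
  by move=> A; rewrite inE => /eqP ->; rewrite -dvdn_divisors // dvd1n.
by move=> A _; rewrite divr_ge0 // FN_ge0.
Qed.
End NtReal.

Section LowerMass.
Variables (R : realType) (k : nat).
Local Notation lnn n := (ln (n%:R : R)).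
Implicit Types Y v : 'I_k.+1 -> nat.

Definition window_prime Y v : pred nat := fun p => [exists i, (v i < p <= 2 * Y i)%N].
(* Ensures [d_i^2 <= Y_i] for every [d] counted by [Nt Y A], so that the primes
   completing [d_i] to a number in [(Y_i, 2 Y_i]] are larger than the square root
   of [Y_i]. *)
Definition small_smooth_parts Y A := [forall i, (smooth_part (Y i) A ^ 2 <= Y i)%N].

(** Clearing the windows costs a constant since [2 Y_i <= (v_i + 1)^(h+1)]. Afterwards the
    [Y_i]-smooth part of [A] is its [v_i]-smooth part, which by Rankin rarely reaches [v_i^(h/2)];
    the exceptions over all [i] amount to at most half. *)
Lemma lower_mass : exists h, exists2 c : R, 0 < c &
  (6 <= h)%N /\
  forall Y v, (forall i, (2 < Y i)%N) -> (forall i, (Y i <= Y ord_max)%N) ->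
    (forall i, (0 < v i)%N /\ (v i ^ h <= Y i < (v i).+1 ^ h)%N) ->
  c * Ssum R Y <=
  \sum_(A <- divisors (prodQ (fun p => ~~ window_prime Y v p) (Y ord_max)) | small_smooth_parts Y A) FN R Y A / A%:R.
Proof.
have [C C0 HC] := rankin_tail R k.+1.
have [a ha] := nat_above (8 * (k.+1%:R * C)).
pose h' := (a + 3)%N.
(* The smooth part is held below [v^h'], and its square must not exceed [Y >= v^h]; hence the 2. The
   size of [a] gives each coordinate an exceptional share of at most [1/(2(k+1))]. *)
exists (2 * h')%N.
pose c1 : R := expR (gpow R k.+1 1 * (k.+1 * (10 + 2 * (2 * h').+1))%:R).
have c10 : 0 < c1 := expR_gt0 _.
exists (2 * c1)^-1; first by rewrite invr_gt0 mulr_gt0.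
split; first by rewrite /h'; lia.
move=> Y v Y2 Ymax Hv.
set Q := (fun p => ~~ window_prime Y v p); set P := prodQ Q (Y ord_max).
pose T : R := divsum P (FN R Y).
have T0 : 0 <= T by apply: divsum_ge0; apply: FN_ge0.
have ST : Ssum R Y <= c1 * T.
  have := prodQ_sub predT (window_prime Y v) (Y ord_max) (gpow_ge0 R k.+1 1) (@FN_ge0 R k Y) (@FN_mul R k Y).
  move=> h; apply: le_trans h _; rewrite ler_wpM2r //.
  apply: (@excess_prod_le R k.+1 (fun i => (v i).+1)) => //.
  - exact: gpow_ge0.
  - by move=> i; have [] := Hv i.
  move=> p pr /existsP[i /andP[vp pY]]; exists i.
  rewrite vp /=; apply: leq_trans pY _; rewrite expnS.
  by have [v0 /andP[_ h2]] := Hv i; apply: leq_mul => //; apply: ltnW.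
have bad i : \sum_(A <- divisors P | ~~ (smooth_part (Y i) A ^ 2 <= Y i)%N) FN R Y A / A%:R
    <= (2 * k.+1%:R)^-1 * T.
  have [v0 /andP[vY Yv]] := Hv i.
  have spE A : A \in divisors P -> smooth_part (Y i) A = smooth_part (v i) A.
    rewrite -dvdn_divisors ?prodQ_gt0 // => AP.
    apply: eq_in_partn => p; rewrite mem_primes => /and3P[pr _ pA].
    have : (p %| P)%N by apply: dvdn_trans AP.
    rewrite prime_dvd_prodQ // => /andP[_ /existsPn /(_ i)].
    have vYi : (v i <= Y i)%N.
      by apply: leq_trans vY; rewrite -{1}[v i]expn1 leq_pexp2l // /h'; lia.
    by rewrite !inE !andbT; lia.
  have [v1|v1] := leqP (v i) 1.
    rewrite big_seq_cond big1 ?mulr_ge0 ?invr_ge0 // => A /andP[AP].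
    rewrite spE // /smooth_part.
    have -> : (A`_(below predT (v i)) = 1)%N.
      apply: part_p'nat; apply/pnatP.
        by move: AP; rewrite -dvdn_divisors ?prodQ_gt0 // => /dvdn_gt0; apply; apply: prodQ_gt0.
      by move=> p /prime_gt1 p1 _; rewrite !inE andbT; lia.
    by have := Y2 i; lia.
  pose eta : R := (4 * lnn (v i))^-1.
  have lv := lnn_gt0 R v1.
  have etaz : eta * lnn (v i) = 1 / 4 by rewrite /eta; field; lra.
  have eta0 : 0 <= eta by rewrite invr_ge0 mulr_ge0 // lnn_ge0.
  have := HC Q (Y ord_max) (v i) (v i ^ h')%N eta (FN R Y) eta0 _ (@FN_ge0 R k Y) (@FN_pow R k Y) _.
  rewrite etaz lexx expn_gt0 v0 => /(_ isT isT) tail.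
  apply: (@le_trans _ _ (\sum_(A <- divisors P | (v i ^ h' <= smooth_part (v i) A)%N) FN R Y A / A%:R)).
    rewrite big_seq_cond [leRHS]big_seq_cond -[leLHS]big_filter -[leRHS]big_filter.
    apply: sum_sub_le; first by rewrite filter_uniq // divisors_uniq.
      move=> A; rewrite !mem_filter => /andP[/andP[AP hA] _]; rewrite AP andbT /= leqNgt.
      move: hA; rewrite spE //; apply: contraNN => hlt.
      apply: leq_trans vY; rewrite mulnC expnM leq_exp2r //; exact: ltnW.
    by move=> A _; rewrite divr_ge0 // FN_ge0.
  apply: le_trans tail _; rewrite ler_wpM2r //.
  have -> : eta * lnn (v i ^ h')%N = h'%:R / 4 by rewrite lnnX // mulrCA etaz; field.
  rewrite expRN ler_pdivrMr ?expR_gt0 // mulrC ler_pdivlMr ?mulr_gt0 //.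
  apply: le_trans (expR_ge1Dx _); move: ha; rewrite /h' natrD.
  move: (k.+1%:R) (a%:R) => x y; nra.
have TE : T = \sum_(A <- divisors P | small_smooth_parts Y A) FN R Y A / A%:R +
   \sum_(A <- divisors P | ~~ small_smooth_parts Y A) FN R Y A / A%:R.
  by rewrite /T /divsum (bigID (small_smooth_parts Y)).
have badle : \sum_(A <- divisors P | ~~ small_smooth_parts Y A) FN R Y A / A%:R <= 1 / 2 * T.
  apply: (@le_trans _ _ (\sum_(i < k.+1)
    \sum_(A <- divisors P | ~~ (smooth_part (Y i) A ^ 2 <= Y i)%N) FN R Y A / A%:R)).
    under [leRHS]eq_bigr do rewrite big_mkcond.
    rewrite exchange_big big_mkcond /=; apply: ler_sum => A _.
    case: ifP => [/forallPn[i hi]|_]; last first.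
      by apply: sumr_ge0 => i _; case: ifP => // _; rewrite divr_ge0 // FN_ge0.
    rewrite (bigD1 i) //= hi lerDl.
    by apply: sumr_ge0 => j _; case: ifP => // _; rewrite divr_ge0 // FN_ge0.
  apply: (@le_trans _ _ (\sum_(i < k.+1) (2 * k.+1%:R)^-1 * T)).
    by apply: ler_sum => i _; apply: bad.
  rewrite sumr_const card_ord -[_ *+ _]mulr_natl mulrA ler_wpM2r //.
  by rewrite invfM mulrCA divff ?pnatr_eq0 // mulr1 mul1r.
rewrite mulrC ler_pdivrMr ?mulr_gt0 //; apply: le_trans ST _.
have key (x y z w : R) : y <= 1 / 2 * z -> z = x + y -> 0 < w -> w * z <= x * (2 * w) by nra.
exact: key badle TE c10.
Qed.

End LowerMass.

(** [v^3 <= X] and, for [v >= 2], [v^3 >= 4v]: there is room to take a prime cofactor above [v] from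
    the upper half of the range. This is the origin of [6 <= h]. *)
Lemma le_half_of_pow6 v Z X : (v ^ 6 <= Z)%N -> (Z < X.+1 ^ 2)%N -> (1 < X)%N ->
  (v <= X./2)%N.
Proof.
move=> vZ ZX X1; have [v1|v1] := leqP v 1; first by lia.
have : (v ^ 3 < X.+1)%N by rewrite -ltn_sqr -expnM; apply: leq_ltn_trans ZX.
have : (4 * v <= v ^ 3)%N by clear -v1; rewrite !expnS expn0; nia.
by clear; move: (v ^ 3)%N => c; lia.
Qed.

(** Where the sieve does not apply, [X] is bounded by a power of [Z], so [log X] may be replaced by
    [log Z]. *)
Lemma half_le_pow6 Z X : ~~ (4 * (2 * Z).+1 ^ 2 <= X)%N -> (2 < Z)%N -> (X./2.+1 <= Z ^ 6)%N.
Proof.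
move=> h Z2; apply: (@leq_trans (4 * (2 * Z).+1 ^ 2)).
  by move: h; clear; move: ((2 * Z).+1 ^ 2)%N => c; lia.
apply: (@leq_trans (Z ^ 2 * (Z ^ 2) ^ 2)); last by rewrite -expnM -expnD.
by clear -Z2; apply: leq_mul; rewrite ?leq_exp2r //; rewrite !expnS !expn0; nia.
Qed.

Lemma half_window X : (1 < X)%N -> [/\ (0 < X./2)%N, (X <= 3 * X./2)%N & ((X./2).*2 <= X)%N].
Proof. by move=> h; split; lia. Qed.

(** * Counting completing primes and cofactors *)

Section LowerLocal.
Variable R : realType.
Local Notation lnn n := (ln (n%:R : R)).

(** With [u = Y %/ d], every prime of [(u, 2u]] qualifies; their number is at least of order
    [u / log Y], and each has [1/p >= 1/(2u)]. *)
Lemma coord_ge : exists2 c : R, 0 < c & forall Y d B,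
  (2 < Y)%N -> (0 < d)%N -> (d ^ 2 <= Y)%N -> (2 * Y < B)%N ->
  c / lnn Y <= \sum_(p < B | prime p && (Y < d * p <= 2 * Y)%N) (p : nat)%:R^-1.
Proof.
have [K K0 HK] := window_count R.
exists (4 * K)^-1; first by rewrite invr_gt0 mulr_gt0.
move=> Y d B Y2 d0 dY YB.
rewrite -(big_mkord (fun p => prime p && (Y < d * p <= 2 * Y)%N) (fun p => (p%:R : R)^-1)).
pose u := (Y %/ d)%N.
have dY' : (d <= Y)%N by apply: leq_trans dY; rewrite -{1}[d]expn1 leq_pexp2l.
have u0 : (0 < u)%N by rewrite divn_gt0.
have h1 := leq_trunc_div Y d; have h2 := ltn_ceil Y d0; rewrite -/u in h1 h2.
have wc := HK u u0.
have u0' : (0 : R) < u%:R by rewrite ltr0n.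
have ly := lnn_gt0 R (ltnW Y2).
have lu : lnn u.+1 <= 2 * lnn Y.
  rewrite -lnnX ?(ltnW (ltnW Y2)) //; apply: lnn_le => //.
  by rewrite expnS expn1; nia.
apply: (@le_trans _ _ ((primes_in u u.*2)%:R / (2 * u)%:R)).
  have key : u%:R <= K * (primes_in u u.*2)%:R * (2 * lnn Y).
    by apply: le_trans wc _; rewrite ler_wpM2l // mulr_ge0 // ltW.
  rewrite ler_pdivlMr ?ltr0n ?muln_gt0 // -invfM mulrC ler_pdivrMr ?mulr_gt0 // natrM.
  move: key; move: ((primes_in u u.*2)%:R) (ln Y%:R) (u%:R) => n l x; lra.
apply: (@le_trans _ _ (\sum_(u.+1 <= p < u.*2.+1 | prime p) ((2 * u)%:R : R)^-1)).
  by rewrite primes_inE mulr_suml; under eq_bigr do rewrite mul1r.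
apply: (@le_trans _ _ (\sum_(u.+1 <= p < u.*2.+1 | prime p) (p%:R : R)^-1)).
  rewrite big_nat_cond [leRHS]big_nat_cond; apply: ler_sum => p /andP[hp pr].
  by rewrite lef_pV2 ?posrE ?ltr0n ?ler_nat; lia.
rewrite -[leLHS]big_filter -[leRHS]big_filter; apply: sum_sub_le.
- by rewrite filter_uniq // iota_uniq.
- move=> p; rewrite !mem_filter !mem_index_iota => /andP[-> hp] /=.
  apply/andP; split; first by apply/andP; split; nia.
  nia.
by move=> p _; rewrite invr_ge0.
Qed.

(* When [X] is too small for the sieve, a single prime above [v] (or [1]) is used
   as the cofactor instead. *)
Definition cofactor_ok Z v X b :=
  if (4 * (2 * Z).+1 ^ 2 <= X)%N then (rough (2 * Z).+1).-nat b
  else (b == 1%N) || (prime b && (v < b)%N).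

Lemma bcount_ge : exists2 c : R, 0 < c & forall Z v X,
  (2 < Z)%N -> (0 < v)%N -> (v ^ 6 <= Z)%N -> (0 < X)%N -> (Z < X.+1 ^ 2)%N ->
  c * X%:R / lnn Z <= \sum_(0 <= b < X.+1 | cofactor_ok Z v X b) 1.
Proof.
have [c c0 Hc] := phi_ge R; have [K K0 HK] := window_count R.
(* One term per case: the sieve, [X = 1] with [b = 1], and prime cofactors in [(X./2, X]]. There
   [18 = 3 * 6] comes from [X <= 3 X./2] and [log (X./2 + 1) <= 6 log Z]. *)
pose c' := Num.min (c / 2) (Num.min (1 / 2) (18 * K)^-1).
have c'1 : c' <= c / 2 by rewrite ge_min lexx.
have c'2 : c' <= 1 / 2 by rewrite ge_min ge_min lexx /= orbT.
have c'3 : c' <= (18 * K)^-1 by rewrite ge_min ge_min lexx !orbT.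
have c'0 : 0 < c' by rewrite lt_min divr_gt0 //= lt_min divr_gt0 //= invr_gt0 mulr_gt0.
exists c' => //.
move=> Z v X Z2 v0 vZ X0 ZX.
have Z0 : (0 < Z)%N by lia.
have lZ := lnn_gt0 R (ltnW Z2 : (1 < Z)%N).
have X0' : (0 : R) < X%:R by rewrite ltr0n.
rewrite /cofactor_ok; case: (boolP (4 * (2 * Z).+1 ^ 2 <= X)%N) => hX.
  have := Hc (2 * Z).+1 X ltac:(lia) hX; rewrite /phi => h; apply: le_trans h.
  have l2 : lnn (2 * Z).+1 <= 2 * lnn Z.
    rewrite -lnnX //; apply: lnn_le => //.
    by rewrite expnS expn1; nia.
  have l3 : 0 < lnn (2 * Z).+1 by apply: lnn_gt0; lia.
  rewrite ler_pdivlMr // mulrAC ler_pdivrMr //.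
  apply: (@le_trans _ _ (c / 2 * X%:R * (2 * lnn Z))).
    apply: ler_pM; rewrite ?lnn_ge0 //; first by rewrite mulr_ge0 // ltW.
    by rewrite ler_wpM2r.
  by apply: eq_lew; field.
have lZh := lnn_ge_half R (ltnW Z2 : (1 < Z)%N).
have [X1|X1] := leqP X 1.
  have -> : X = 1%N by lia.
  rewrite big_mkcond !big_nat_recr //= big_geq // !add0r mulr1 ler_pdivrMr // mul1r.
  by apply: le_trans c'2 _; apply: le_trans lZh _.
have vu := le_half_of_pow6 vZ ZX X1; have uZ := half_le_pow6 hX Z2.
have [] := half_window X1; move: vu uZ; move: X./2 => u vu uZ u0 X3 uX.
have wc := HK u u0.
have lu : lnn u.+1 <= 6 * lnn Z.
  by rewrite -lnnX //; apply: lnn_le.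
apply: (@le_trans _ _ (\sum_(u.+1 <= p < u.*2.+1 | prime p) 1)).
  rewrite -primes_inE ler_pdivrMr //.
  have hX3 : X%:R <= 3 * u%:R :> R by rewrite -natrM ler_nat.
  apply: (@le_trans _ _ ((18 * K)^-1 * (3 * u%:R))).
    by apply: ler_pM => //; rewrite ltW.
  have key : u%:R <= K * (primes_in u u.*2)%:R * (6 * lnn Z).
    by apply: le_trans wc _; rewrite ler_wpM2l // mulr_ge0 // ltW.
  rewrite mulrC ler_pdivrMr ?mulr_gt0 //.
  move: key; move: ((primes_in u u.*2)%:R) (ln Z%:R) (u%:R) => n l x; lra.
rewrite -big_filter -[leRHS]big_filter; apply: sum_sub_le => //.
  by rewrite filter_uniq // iota_uniq.
move=> p; rewrite !mem_filter !mem_index_iota => /andP[-> hp] /=.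
by clear -hp vu uX; apply/andP; split; [apply/orP; right | ]; lia.
Qed.

End LowerLocal.

Section PSum.
Variables (R : realType) (k : nat).
Local Notation lnn n := (ln (n%:R : R)).
Implicit Types Y : 'I_k.+1 -> nat.

Definition fits Y (d : {ffun 'I_k.+1 -> nat}) B (p : {ffun 'I_k.+1 -> 'I_B}) :=
  [forall i, prime (p i) && (Y i < d i * p i <= 2 * Y i)%N].

Definition compat Y A B (p : {ffun 'I_k.+1 -> 'I_B}) :=
  has (fun d => okd Y A d && fits Y d p) (box k.+1 A.+1).

(** One representative [d] per cell: distributing the product over coordinates gives [Nt Y A] times
    the bounds of [coord_ge]. A given [p] is hit by at most [2^(k+1)] cells, because [d_i] is
    confined to [(Y_i/p_i, 2 Y_i/p_i]]. *)
Lemma psum_ge : exists2 c : R, 0 < c & forall Y A B,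
  (0 < A)%N -> (forall i, (2 < Y i)%N) -> (forall i, (2 * Y i < B)%N) ->
  (forall d i, okd Y A d -> (d i ^ 2 <= Y i)%N) ->
  c * FN R Y A / \prod_i lnn (Y i) <=
  \sum_(p : {ffun 'I_k.+1 -> 'I_B} | compat Y A p) \prod_i (p i : nat)%:R^-1.
Proof.
have [c c0 Hc] := coord_ge R.
exists (c ^+ k.+1 / 2 ^+ k.+1); first by rewrite divr_gt0 ?exprn_gt0.
move=> Y A B A0 Y2 YB dY.
have [dsel Hsel] : exists dsel : {ffun 'I_k.+1 -> nat} -> {ffun 'I_k.+1 -> nat},
    forall m, m \in Mlist Y A -> okd Y A (dsel m) /\ lgv (dsel m) = m.
  have H m : exists d, m \in Mlist Y A -> okd Y A d /\ lgv d = m.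
    have [mM|_] := boolP (m \in Mlist Y A); last by exists m.
    by have /(MlistP _ _ A0)[d hd ->] := mM; exists d.
  by have [f Hf] := choice H; exists f.
pose G m i (j : 'I_B) : R :=
  if prime j && (Y i < dsel m i * j <= 2 * Y i)%N then (j : nat)%:R^-1 else 0.
have G0 m i j : 0 <= G m i j by rewrite /G; case: ifP => // _; rewrite invr_ge0.
have lo : FN R Y A * (c ^+ k.+1 / \prod_i lnn (Y i)) <=
    \sum_(m <- Mlist Y A) \prod_i \sum_(j < B) G m i j.
  rewrite /FN /Nt -sum1_size natr_sum mulr_suml big_seq [leRHS]big_seq.
  apply: ler_sum => m mM; rewrite mul1r.
  have [hd _] := Hsel m mM.
  have -> : c ^+ k.+1 / \prod_i lnn (Y i) = \prod_(i < k.+1) (c / lnn (Y i)).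
    by rewrite prodf_div prodr_const card_ord.
  apply: ler_prod => i _; have Yi1 : (1 < Y i)%N by apply: ltnW.
  rewrite divr_ge0 ?(ltW c0) ?lnn_ge0 //=.
  rewrite /G -big_mkcond /=; apply: Hc => //; first exact: okd_gt0 hd.
  exact: dY.
have hi : \sum_(m <- Mlist Y A) \prod_i \sum_(j < B) G m i j <=
   2 ^+ k.+1 * \sum_(p : {ffun 'I_k.+1 -> 'I_B} | compat Y A p) \prod_i (p i : nat)%:R^-1.
  under eq_bigr do rewrite bigA_distr_bigA /=.
  rewrite exchange_big /= mulr_sumr [leRHS]big_mkcond /=.
  apply: ler_sum => f _.
  have Gz m : m \in Mlist Y A -> \prod_i G m i (f i) =
      if fits Y (dsel m) f then \prod_i (f i : nat)%:R^-1 else 0.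
    move=> mM; case: ifP => [/forallP hf|/negbT/forallPn[i hi]].
      by apply: eq_bigr => i _; rewrite /G hf.
    by rewrite (bigD1 i) //= /G (negbTE hi) mul0r.
  rewrite big_seq (eq_bigr _ Gz) -big_seq -big_mkcond /=.
  case: ifP => hc; last first.
    rewrite big_seq_cond big1 // => m /andP[mM fm].
    have [hd _] := Hsel m mM; move/negP: hc; case; apply/hasP; exists (dsel m).
      exact: okd_box hd.
    by rewrite hd.
  rewrite -big_filter big_const_seq count_predT iter_addr_0 -[X in X <= _]mulr_natl.
  rewrite ler_wpM2r ?prodr_ge0 //.
  rewrite -natrX ler_nat.
  apply: (@size_two_values k.+1 _ (fun i => trunc_log 2 (Y i %/ f i).+1)).
    by rewrite filter_uniq // Mlist_uniq.
  move=> m i; rewrite mem_filter => /andP[/forallP /(_ i) /andP[pr hf] mM].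
  have [hd <-] := Hsel m mM; rewrite ffunE.
  have f0 := prime_gt0 pr; have d0 := okd_gt0 i hd.
  have h1 := ltn_ceil (Y i) f0; have h2 := leq_trunc_div (Y i) (f i).
  set q := (Y i %/ f i)%N in h1 h2 *.
  have q1 : (q.+1 <= dsel m i)%N by nia.
  have q2 : (dsel m i <= q.+1.*2)%N by nia.
  rewrite leq_trunc_log //= -trunc_log2_double //; exact: leq_trunc_log.
apply: le_trans (_ : _ <= 2 ^- k.+1 * (FN R Y A * (c ^+ k.+1 / \prod_i lnn (Y i)))) _.
  by apply: eq_lew; rewrite mulrCA !mulrA; congr (_ * _); ring.
rewrite mulrC ler_pdivrMr ?exprn_gt0 // [leRHS]mulrC.
exact: le_trans lo hi.
Qed.

End PSum.

(** The range [X] left for the cofactor is at least [Z %/ A >= A], hence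
    [Z < A (Z %/ A + 1) <= (X+1)^2]. The factor [y_k] in the hypothesis on [x] enters here. *)
Lemma quotient_large A W Z M x : (0 < A)%N -> (0 < W)%N -> (A ^ 2 <= Z)%N -> (W <= M)%N ->
  (M * Z <= x)%N -> (0 < x %/ (A * W))%N /\ (Z < (x %/ (A * W)).+1 ^ 2)%N.
Proof.
move=> A0 W0 AZ WM Mx.
have h : (Z %/ A <= x %/ (A * W))%N.
  have -> : (Z %/ A = (W * Z) %/ (A * W))%N by rewrite [(W * Z)%N]mulnC divnMr.
  by apply: leq_div2r; apply: leq_trans Mx; rewrite leq_mul2r WM orbT.
have hA : (A <= Z %/ A)%N by rewrite leq_divRL // mulnn.
split; first by apply: leq_trans h; apply: leq_trans hA.
have c := ltn_ceil Z A0; apply: leq_trans c _.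
rewrite expnS expn1; apply: leq_mul; first by rewrite ltnS.
by apply: leq_trans hA _; apply: leqW.
Qed.

(** * Products [A p_1...p_k b] and the multiplicity of representations *)

Section Lower.
Variables (R : realType) (k : nat).
Local Notation lnn n := (ln (n%:R : R)).
Implicit Types Y v : 'I_k.+1 -> nat.

Lemma okd_good Y A d i : (0 < A)%N -> small_smooth_parts Y A -> okd Y A d -> (d i ^ 2 <= Y i)%N.
Proof.
move=> A0 /forallP/(_ i) h hd; apply: leq_trans h; rewrite leq_exp2r //.
apply: dvdn_leq; first exact: part_gt0.
have dn : (below predT (Y i)).-nat (d i) by case/andP: hd => _ /forallP.
by rewrite -(part_pnat_id dn) partn_dvd // (okd_dvd i hd).
Qed.

(** Each [p_i] lies in a window, each prime of the cofactor lies in a window or above [Z], and [A]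
    avoids all windows, so [A] is the non-window part of [n] up to [Z]. The window primes of [n] are
    the [p_i] and at most the cofactor itself, whence [k + 2]. *)
Lemma lower_fiber Y v A B (p : {ffun 'I_k.+1 -> 'I_B}) X n :
  let Q := (fun q => ~~ window_prime Y v q) in let Z := Y ord_max in
  let w := (A * \prod_i p i)%N in
  (forall i, (v i ^ 2 <= Y i)%N) -> (forall i, (Y i <= Z)%N) ->
  (A %| prodQ Q Z)%N -> small_smooth_parts Y A -> compat Y A p -> (0 < n)%N -> (w %| n)%N ->
  cofactor_ok Z (v ord_max) X (n %/ w) ->
  [/\ A = (n`_(below Q Z))%N,
      forall i, (p i : nat) \in [seq q <- primes n | window_prime Y v q],
      (size [seq q <- primes n | window_prime Y v q] <= k.+2)%N &
      exists d : 'I_k.+1 -> nat, (\prod_i d i %| n)%N /\ forall i, (Y i < d i <= 2 * Y i)%N].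
Proof.
move=> Q Z w v2 YZ AP gA cp n0 wn Bb.
have A0 : (0 < A)%N by apply: dvdn_gt0 AP; apply: prodQ_gt0.
have [d _ /andP[hd /forallP hf]] := hasP cp.
have pr i : prime (p i) by case/andP: (hf i).
have dp i : (Y i < d i * p i <= 2 * Y i)%N by case/andP: (hf i).
have d0 i : (0 < d i)%N := okd_gt0 i hd.
have Ep i : window_prime Y v (p i).
  apply/existsP; exists i; have := dp i; have := d0 i => di dpi.
  have d2 := okd_good i A0 gA hd; have v2i := v2 i.
  apply/andP; split; last first.
    by move: di dpi; clear; move: (d i) (nat_of_ord (p i)) (Y i) => a b c; nia.
  (* Otherwise [(d_i p_i)^2 <= Y_i^2], since [d_i^2] and [v_i^2] are both at most [Y_i]. *)
  rewrite ltnNge; apply/negP => pv.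
  have : ((d i * p i) ^ 2 <= (Y i) ^ 2)%N.
    rewrite expnMn [(Y i ^ 2)%N]expnS expn1; apply: leq_mul => //.
    by apply: leq_trans v2i; rewrite leq_exp2r.
  by rewrite leq_exp2r // leqNgt; case/andP: dpi => ->.
pose b := (n %/ w)%N.
have nE : n = (b * w)%N by rewrite divnK.
have b0 : (0 < b)%N by move: n0; rewrite nE muln_gt0 => /andP[].
have w0 : (0 < w)%N by move: n0; rewrite nE muln_gt0 => /andP[].
have pp0 : (0 < \prod_i p i)%N by move: w0; rewrite /w muln_gt0 => /andP[].
have bprimes q : prime q -> (q %| b)%N -> window_prime Y v q -> q = b.
  move=> prq qb /existsP[i /andP[_ qY]]; move: Bb; rewrite /cofactor_ok -/b; case: ifP => _.
    move=> rb; have := pnatPpi rb; move=> /(_ q); rewrite mem_primes prq b0 qb => /(_ isT).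
    by rewrite !inE; have := YZ i; move: qY; clear; lia.
  case/orP => [/eqP b1|/andP[prb _]]; first by move: qb prq; rewrite b1 dvdn1 => /eqP ->.
  by move: qb; rewrite dvdn_prime2 // => /eqP.
have bQ : ((below Q Z)^').-nat b.
  apply/pnatP => // q prq qb; rewrite !inE negb_and negbK.
  have [qZ|//] := leqP q Z; rewrite /=.
  move: Bb; rewrite /cofactor_ok -/b; case: ifP => _.
    move=> rb; have := pnatPpi rb; move=> /(_ q); rewrite mem_primes prq b0 qb => /(_ isT).
    by rewrite !inE; move: qZ; clear; lia.
  case/orP => [/eqP b1|/andP[prb vb]]; first by move: qb prq; rewrite b1 dvdn1 => /eqP ->.
  move: qb; rewrite dvdn_prime2 // => /eqP e.
  by apply/existsP; exists ord_max; rewrite -e in vb; move: qZ vb; rewrite /Z; clear; lia.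
have AQ : (below Q Z).-nat A.
  apply/pnatP => // q prq qA; rewrite !inE -prime_dvd_prodQ //.
  exact: dvdn_trans AP.
have pQ : ((below Q Z)^').-nat (\prod_i p i)%N.
  elim/big_ind: _ => // [a c ha hc|i _]; first by rewrite pnatM ha.
  by rewrite pnatE // !inE negb_and negbK Ep orbT.
split.
- rewrite {1}nE /w mulnC -mulnA partnM ?muln_gt0 ?pp0 //.
  rewrite part_pnat_id // part_p'nat ?muln1 // pnatM pQ bQ //.
- move=> i; rewrite mem_filter Ep mem_primes pr n0 /=.
  by apply: dvdn_trans wn; rewrite /w (bigD1 i) //= mulnCA dvdn_mulr.
- rewrite -[k.+2](_ : size (b :: codom (fun i => p i : nat)) = _); last first.
    by rewrite /= size_codom card_ord.
  apply: uniq_leq_size; first by rewrite filter_uniq // primes_uniq.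
  move=> q; rewrite mem_filter mem_primes => /and3P[Eq prq /andP[_]].
  rewrite {1}nE /w Euclid_dvdM // => /orP[qb|].
    by rewrite (bprimes q) // mem_head.
  rewrite Euclid_dvdM // => /orP[qA|].
    have : (q %| prodQ Q Z)%N by apply: dvdn_trans AP.
    by rewrite prime_dvd_prodQ // /Q Eq andbF.
  rewrite Euclid_dvd_prod // big_has => /hasP[i _]; rewrite dvdn_prime2 // => /eqP ->.
  by rewrite inE; apply/orP; right; apply: codom_f.
exists (fun i => (d i * p i)%N); split => //.
rewrite big_split /=; apply: dvdn_trans wn; rewrite /w dvdn_mul //.
by case/andP: hd.
Qed.

Lemma lower_bound : exists2 c : R, 0 < c & forall Y x (P : pred nat),
  (forall i, (2 < Y i)%N) -> (forall i, (Y i <= Y ord_max)%N) ->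
  (2 ^ k.+1 * \prod_i Y i * Y ord_max <= x)%N ->
  (forall n (d : 'I_k.+1 -> nat), (0 < n)%N -> (\prod_i d i %| n)%N ->
     (forall i, (Y i < d i <= 2 * Y i)%N) -> P n) ->
  c * x%:R * Ssum R Y / (\prod_i lnn (Y i) * lnn (Y ord_max)) <=
  \sum_(0 <= n < x.+1 | (0 < n)%N && P n) 1.
Proof.
have [h [c1 c10 [h6 Hmass]]] := lower_mass R k.
have [c2 c20 Hp] := psum_ge R k.
have [c3 c30 Hb] := bcount_ge R.
(* Maximal multiplicity: [n] determines [A], and each of the [k+1] primes is one of at most
   [k+2]. *)
pose N := (k.+2 ^ k.+1)%N.
have N0 : (0 : R) < N%:R by rewrite ltr0n expn_gt0.
exists (c1 * c2 * c3 / (2 * N%:R)); first by rewrite divr_gt0 ?mulr_gt0.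
move=> Y x P Y2 YZ Hx HP.
pose Z := Y ord_max; pose B := (2 * Z).+1.
have [v Hv] : exists v : 'I_k.+1 -> nat,
    forall i, (0 < v i)%N /\ (v i ^ h <= Y i < (v i).+1 ^ h)%N.
  apply: (fin_all_exists (P := fun i n => (0 < n)%N /\ (n ^ h <= Y i < n.+1 ^ h)%N)) => i.
  by apply: root_ex; [apply: leq_trans h6 | apply: leq_trans (Y2 i)].
have vpow j i : (j <= h)%N -> (v i ^ j <= Y i)%N.
  move=> jh; have [v0 /andP[hv _]] := Hv i; apply: leq_trans hv.
  by rewrite leq_pexp2l.
have v2 i : (v i ^ 2 <= Y i)%N by apply: vpow; apply: leq_trans h6.
set Q := (fun p => ~~ window_prime Y v p).
pose L := [seq A <- divisors (prodQ Q Z) | small_smooth_parts Y A].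
have LP A : A \in L -> [/\ (0 < A)%N, (A %| prodQ Q Z)%N & small_smooth_parts Y A].
  rewrite mem_filter -dvdn_divisors ?prodQ_gt0 // => /andP[gA AP]; split => //.
  by apply: dvdn_gt0 AP; apply: prodQ_gt0.
pose w A (p : {ffun 'I_k.+1 -> 'I_B}) := (A * \prod_i p i)%N.
pose cond n A (p : {ffun 'I_k.+1 -> 'I_B}) :=
  [&& compat Y A p, (0 < n)%N, (w A p %| n)%N & cofactor_ok Z (v ord_max) (x %/ w A p) (n %/ w A p)].
have up : \sum_(A <- L) \sum_(p : {ffun 'I_k.+1 -> 'I_B}) \sum_(0 <= n < x.+1 | cond n A p) 1
    <= N%:R * \sum_(0 <= n < x.+1 | (0 < n)%N && P n) 1 :> R.
  under eq_bigr do (under eq_bigr do rewrite big_mkcond; rewrite exchange_big).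
  rewrite exchange_big /= mulr_sumr [leRHS]big_mkcond /=; apply: ler_sum => n _.
  pose V := [seq ap <- [seq (A, p) | A <- L, p <- enum {ffun 'I_k.+1 -> 'I_B}]
    | cond n ap.1 ap.2].
  have -> : \sum_(A <- L) \sum_(p : {ffun 'I_k.+1 -> 'I_B}) (if cond n A p then 1 else 0)
     = (size V)%:R :> R.
    rewrite -sum1_size natr_sum /V big_filter [RHS]big_mkcond [RHS]big_allpairs.
    by apply: eq_bigr => A _; rewrite big_enum.
  have VP ap : ap \in V -> ap.1 \in L /\ cond n ap.1 ap.2.
    by rewrite mem_filter => /andP[-> /allpairsP[[A p] [/= ? _ ->]]].
  case E : V => [|ap0 V'].
    by rewrite /=; case: ifP => // _; rewrite mulr1 ltW.
  have ap0V : ap0 \in V by rewrite E mem_head.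
  have fib ap : ap \in V -> _ := fun h => let: conj h1 h2 := VP ap h in
    let: And3 _ h3 h4 := LP ap.1 h1 in let: And4 h5 h6 h7 h8 := and4P h2 in
    lower_fiber v2 YZ h3 h4 h5 h6 h7 h8.
  have [_ [_ _ Lsz [d [dn dY]]]] := (tt, fib ap0 ap0V).
  have n0 : (0 < n)%N by case: (VP _ ap0V) => _ /and4P[].
  rewrite n0 (HP n d) // mulr1 ler_nat -E.
  set Lp := [seq q <- primes n | window_prime Y v q] in Lsz.
  pose Rj := [pred j : 'I_B | (j : nat) \in Lp].
  have cR : (#|Rj| <= k.+2)%N.
    apply: leq_trans Lsz; rewrite cardE -(size_map val); apply: uniq_leq_size.
      by rewrite map_inj_uniq ?enum_uniq //; apply: val_inj.
    by move=> q /mapP[j]; rewrite mem_enum => ? ->.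
  apply: (@leq_trans #|(ffun_on Rj : pred {ffun 'I_k.+1 -> 'I_B})|); last first.
    by rewrite card_ffun_on card_ord leq_exp2r.
  rewrite cardE -(size_map snd V); apply: uniq_leq_size.
    rewrite map_inj_in_uniq; last first.
      move=> [A p] [A' p'] /fib[e1 _ _ _] /fib[e2 _ _ _] /= e3.
      by rewrite /= in e1 e2; rewrite e1 e2 e3.
    rewrite filter_uniq // allpairs_uniq ?enum_uniq ?filter_uniq ?divisors_uniq //.
    by move=> [a b] [c d'].
  move=> p /mapP[[A p'] /fib[_ hp _ _] ->]; rewrite mem_enum; apply/ffun_onP => i.
  by rewrite inE; apply: hp.
(* For fixed [A] and [p] the integers are [n = b w] with [b <= X]; the 2 absorbs the rounding in
   [X = x %/ w]. *)
have low A p : A \in L -> compat Y A p ->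
   c3 * x%:R / (2 * (w A p)%:R) / lnn Z <= \sum_(0 <= n < x.+1 | cond n A p) 1.
  move=> AL cp; have [A0 AP gA] := LP A AL.
  have [d _ /andP[hd /forallP hf]] := hasP cp.
  have p0 i : (0 < p i)%N by case/andP: (hf i) => /prime_gt0.
  have pp0 : (0 < \prod_i p i)%N by apply: prodn_gt0.
  have pM : (\prod_i p i <= 2 ^ k.+1 * \prod_i Y i)%N.
    rewrite -[X in (_ <= 2 ^ X * _)%N]card_ord -prod_nat_const -big_split /=.
    apply: leq_prod => i _; have /andP[_ /andP[_ hi]] := hf i.
    by apply: leq_trans hi; rewrite leq_pmull // (okd_gt0 i hd).
  have AZ : (A ^ 2 <= Z)%N.
    have := forallP gA ord_max; rewrite -/Z /smooth_part part_pnat_id //.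
    apply/pnatP => // q prq qA; rewrite !inE andbT.
    have : (q %| prodQ Q Z)%N by apply: dvdn_trans AP.
    by rewrite prime_dvd_prodQ // => /andP[].
  have [X0 ZX] := quotient_large A0 pp0 AZ pM Hx.
  rewrite -/(w A p) in X0 ZX; set X := (x %/ w A p)%N in X0 ZX.
  have w0 : (0 < w A p)%N by rewrite muln_gt0 A0.
  have v6 : (v ord_max ^ 6 <= Z)%N by apply: vpow.
  have [v0 _] := Hv ord_max.
  have bc := Hb Z (v ord_max) X (Y2 _) v0 v6 X0 ZX.
  have lZ : 0 < lnn Z by apply: lnn_gt0; apply: ltnW; apply: Y2.
  apply: (@le_trans _ _ (c3 * X%:R / lnn Z)).
    rewrite ler_wpM2r ?invr_ge0 ?(ltW lZ) // -mulrA ler_wpM2l ?(ltW c30) //.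
    rewrite ler_pdivrMr ?mulr_gt0 ?ltr0n // -!natrM ler_nat.
    have := ltn_ceil x w0; rewrite -/X; move: X0; clear; move: (w A p) X => a b; nia.
  apply: le_trans bc _.
  have -> : \sum_(0 <= b < X.+1 | cofactor_ok Z (v ord_max) X b) 1 =
    \sum_(n <- [seq (b * w A p)%N | b <- [seq b <- index_iota 0 X.+1 | cofactor_ok Z (v ord_max) X b]]) 1 :> R.
    by rewrite big_map big_filter.
  rewrite -[leRHS]big_filter; apply: sum_sub_le => //.
    rewrite map_inj_uniq ?filter_uniq ?iota_uniq //.
    by move=> a b /eqP; rewrite eqn_pmul2r // => /eqP.
  move=> n /mapP[b]; rewrite mem_filter mem_index_iota => /andP[Bb hb] ->.
  have b0 : (0 < b)%N.
    move: Bb; rewrite /cofactor_ok; case: ifP => _; first by case/andP.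
    by case/orP => [/eqP ->|/andP[/prime_gt0]].
  rewrite mem_filter mem_index_iota /cond cp muln_gt0 b0 w0 dvdn_mull // mulnK // Bb /=.
  rewrite ltnS; apply: leq_trans (leq_trunc_div x (w A p)).
  by rewrite leq_mul2r -/X; move: hb; clear; lia.
have lZ : 0 < lnn Z by apply: lnn_gt0; apply: ltnW; apply: Y2.
have Pl0 : 0 < \prod_i lnn (Y i).
  by apply: prodr_gt0 => i _; apply: lnn_gt0; apply: ltnW; apply: Y2.
have mass := Hmass Y v Y2 YZ Hv; rewrite -/Q -/Z -big_filter -/L in mass.
rewrite -(ler_pM2l N0); apply: le_trans up.
have K0 : 0 <= c3 * x%:R / (2 * lnn Z) by rewrite divr_ge0 ?mulr_ge0 ?(ltW c30) ?(ltW lZ).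
have K1 : 0 <= c3 * x%:R / (2 * lnn Z) * (c2 / \prod_i lnn (Y i)).
  by rewrite mulr_ge0 // divr_ge0 // ltW.
apply: (@le_trans _ _ (c3 * x%:R / (2 * lnn Z) * (c2 / \prod_i lnn (Y i)) * (c1 * Ssum R Y))).
  apply: eq_lew; rewrite -/Z.
  move: Pl0 lZ N0; move: (\prod_i lnn (Y i)) (ln Z%:R) (N%:R) (Ssum R Y) (x%:R).
  by move=> a b c d e a0 b0 d0; field; apply/and3P; split; lra.
apply: le_trans (ler_wpM2l K1 mass) _.
rewrite mulr_sumr big_seq [leRHS]big_seq; apply: ler_sum => A AL.
have [A0 AP gA] := LP A AL.
have dY d i : okd Y A d -> (d i ^ 2 <= Y i)%N by apply: okd_good.
have YB i : (2 * Y i < B)%N by rewrite /B ltnS leq_mul2l YZ orbT.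
have ps := Hp Y A B A0 Y2 YB dY.
apply: (@le_trans _ _ (c3 * x%:R / (2 * lnn Z) / A%:R * (c2 * FN R Y A / \prod_i lnn (Y i)))).
  apply: eq_lew; ring.
have K2 : 0 <= c3 * x%:R / (2 * lnn Z) / A%:R by rewrite divr_ge0.
apply: le_trans (ler_wpM2l K2 ps) _.
rewrite mulr_sumr big_mkcond /=; apply: ler_sum => p _.
case: ifP => cp; last by apply: sumr_ge0.
apply: le_trans (low A p AL cp).
apply: eq_lew.
rewrite /w natrM natr_prod prodfV !invfM; ring.
Qed.

End Lower.

(** * Upper bound *)

Section UpperLocal.
Variable R : realType.
Local Notation lnn n := (ln (n%:R : R)).

(** Excluding [b = 1] keeps the bound valid for [X < z]: a rough [b > 1] is at least [z]. *)
Lemma rough_gt1_count_le z X : (1 < z)%N ->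
  \sum_(0 <= b < X.+1 | (1 < b)%N && (rough z).-nat b) 1 <= 34 * X%:R / lnn z.
Proof.
move=> z1; have lz := lnn_gt0 R z1.
have [zX|Xz] := leqP z X.
  apply: le_trans (phi_le R z1 zX); rewrite /phi -big_filter -[leRHS]big_filter.
  apply: sum_sub_le => //; first by rewrite filter_uniq // iota_uniq.
  by move=> b; rewrite !mem_filter => /andP[/andP[_ ->] ->].
rewrite big_nat_cond big1 ?divr_ge0 ?mulr_ge0 ?(ltW lz) // => b /andP[hb /andP[b1 rb]].
have := pnatPpi rb; move=> /(_ (pdiv b)); rewrite pi_pdiv b1 => /(_ isT).
by rewrite !inE; have := pdiv_leq (ltnW b1); move: hb Xz; clear; lia.
Qed.

(** Here [1/p < 2M/w] and [1 <= log p / L]; summing [log p] by [theta] up to [K w / M] gives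
    [4K/L]. *)
Lemma prime_window_sum_le K w M (L : R) N : (0 < w)%N -> (0 < M)%N -> 0 < L ->
  \sum_(p < N | [&& prime p, (w < 2 * M * p)%N, (M * p <= K * w)%N & L <= lnn p])
    (p : nat)%:R^-1 <= (4 * K)%:R / L :> R.
Proof.
move=> w0 M0 L0.
rewrite -(big_mkord (fun p => [&& prime p, (w < 2 * M * p)%N, (M * p <= K * w)%N & L <= lnn p])
  (fun p => (p%:R : R)^-1)).
pose T := (K * w %/ M)%N.
have w0' : (0 : R) < w%:R by rewrite ltr0n.
rewrite ler_pdivlMr // mulrC mulr_sumr.
apply: (@le_trans _ _ (\sum_(0 <= p < T.+1 | prime p) (2 * M)%:R / w%:R * lnn p)).
  apply: (@le_trans _ _ (\sum_(0 <= p < N | [&& prime p, (w < 2 * M * p)%N,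
     (M * p <= K * w)%N & L <= lnn p]) (2 * M)%:R / w%:R * lnn p)).
    apply: ler_sum => p /and4P[pr h1 h2 h3]; rewrite mulrC.
    apply: ler_pM => //; rewrite ?invr_ge0 ?(ltW L0) //.
    have p0 : (0 : R) < p%:R by rewrite ltr0n prime_gt0.
    rewrite ler_pdivlMr // mulrC ler_pdivrMr // -natrM ler_nat; exact: ltnW.
  rewrite -[leLHS]big_filter -[leRHS]big_filter; apply: sum_sub_le.
  - by rewrite filter_uniq // iota_uniq.
  - move=> p; rewrite !mem_filter !mem_index_iota => /andP[/and4P[-> _ h _] _].
    by rewrite ltnS /T leq_divRL // mulnC.
  by move=> p _; rewrite mulr_ge0 ?lnn_ge0 // divr_ge0.
rewrite -mulr_sumr; apply: le_trans (ler_wpM2l _ (theta_le R T)) _.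
  by rewrite divr_ge0.
rewrite mulrAC ler_pdivrMr // -!natrM ler_nat.
have := leq_trunc_div (K * w) M; rewrite -/T; clear; move: T => T; nia.
Qed.

End UpperLocal.

(** * Estimates for one class of decompositions *)

Section UpperClass.
Variables (R : realType) (k : nat).
Local Notation lnn n := (ln (n%:R : R)).
Implicit Types (w t : 'I_k.+1 -> nat) (lam : 'I_k.+1 -> R).

(* [lam i / rho] is the lower bound imposed on [log (p i)], and [Lam / rho] the one
   on the logarithm of the sifting limit [p ord_max]. *)
Definition valid w t lam (Lam rho : R) K A B (p : {ffun 'I_k.+1 -> 'I_B}) :=
  [&& [forall i, prime (p i)], [forall i, lam i <= rho * lnn (p i)],
      Lam <= rho * lnn (p ord_max) &
      has (fun e => okd t A e && [forall i, (w i < p i * e i <= K * w i)%N]) (box k.+1 A.+1)].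

(** A valid [p] is charged to the cell [m] of one of its witnesses [e], which confines [p_i] to
    [(w_i / 2^(m_i+1), K w_i / 2^(m_i)]]; for fixed [m] the coordinates separate. *)
Lemma class_psum w t lam Lam rho K A B :
  (0 < A)%N -> (forall i, (0 < w i)%N) -> (forall i, 0 < lam i) -> 0 < rho ->
  \sum_(p : {ffun 'I_k.+1 -> 'I_B} | valid w t lam Lam rho K A p) \prod_i (p i : nat)%:R^-1
  <= ((4 * K)%:R * rho) ^+ k.+1 / \prod_i lam i * FN R t A.
Proof.
move=> A0 w0 lam0 rho0.
pose G (m : {ffun 'I_k.+1 -> nat}) (i : 'I_k.+1) (j : 'I_B) : R :=
  if [&& prime j, (w i < 2 * 2 ^ m i * j)%N, (2 ^ m i * j <= K * w i)%N &
      lam i / rho <= lnn j] then (j : nat)%:R^-1 else 0.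
have G0 m i j : 0 <= G m i j by rewrite /G; case: ifP => // _; rewrite invr_ge0.
apply: (@le_trans _ _ (\sum_(m <- Mlist t A) \prod_i \sum_(j < B) G m i j)); last first.
  rewrite /FN /Nt -sum1_size natr_sum mulr_sumr; apply: ler_sum => m _; rewrite mulr1.
  have -> : ((4 * K)%:R * rho) ^+ k.+1 / \prod_i lam i =
     \prod_(i < k.+1) ((4 * K)%:R / (lam i / rho)).
    under [RHS]eq_bigr do rewrite invfM invrK mulrA mulrAC.
    by rewrite prodf_div prodr_const card_ord.
  apply: ler_prod => i _; rewrite sumr_ge0 //= /G -big_mkcond /=.
  by apply: prime_window_sum_le => //; rewrite ?expn_gt0 // divr_gt0.
under [leRHS]eq_bigr do rewrite bigA_distr_bigA /=.
rewrite exchange_big /= big_mkcond /=; apply: ler_sum => f _.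
have pr0 m : 0 <= \prod_i G m i (f i) by apply: prodr_ge0.
case: ifP => [/and4P[/forallP fpr /forallP flam _ /hasP[e _ /andP[he /forallP hw]]]|_]; last first.
  by apply: sumr_ge0.
have mM : lgv e \in Mlist t A by apply/MlistP => //; exists e.
rewrite (bigD1_seq _ mM (Mlist_uniq _ _)) /= -[leLHS]addr0; apply: lerD; last exact: sumr_ge0.
apply: eq_lew; apply: eq_bigr => i _.
rewrite /G fpr ffunE; have e0 := okd_gt0 i he.
have /andP[e1 e2] := trunc_log_bounds (isT : (1 < 2)%N) e0.
have /andP[h1 h2] := hw i.
rewrite ler_pdivrMr // mulrC flam andbT /= ifT //.
apply/andP; split.
  apply: leq_trans h1 _; rewrite -expnS [(p in (_ <= p)%N)]mulnC.
  by rewrite leq_mul2l (ltnW e2) orbT.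
by apply: leq_trans h2; rewrite mulnC leq_mul2l e1 orbT.
Qed.

(** For fixed [A] and [p] the cofactor is rough with limit [p ord_max], whose logarithm is at least
    [Lam / rho]; the sum over [p] is then [class_psum]. *)
Lemma class_count w t lam Lam rho K B X (cA : pred nat) :
  (forall i, (0 < w i)%N) -> (forall i, 0 < lam i) -> 0 < rho -> 0 < Lam ->
  (forall A, cA A -> (0 < A)%N) ->
  \sum_(p : {ffun 'I_k.+1 -> 'I_B}) \sum_(0 <= A < X.+1 | cA A && valid w t lam Lam rho K A p)
    \sum_(0 <= n < X.+1 | [&& (A * \prod_i p i %| n)%N, (1 < n %/ (A * \prod_i p i))%N &
        (rough (p ord_max)).-nat (n %/ (A * \prod_i p i))%N]) 1
  <= 34 * X%:R * rho / Lam * (((4 * K)%:R * rho) ^+ k.+1 / \prod_i lam i)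
      * \sum_(0 <= A < X.+1 | cA A) FN R t A / A%:R.
Proof.
move=> w0 lam0 rho0 Lam0 cA0.
pose c := 34 * X%:R * rho / Lam.
have c0 : 0 <= c by rewrite divr_ge0 ?mulr_ge0 // ltW.
apply: (@le_trans _ _ (\sum_(0 <= A < X.+1 | cA A)
   \sum_(p : {ffun 'I_k.+1 -> 'I_B} | valid w t lam Lam rho K A p) c / A%:R * \prod_i (p i : nat)%:R^-1)).
  under eq_bigr do rewrite big_mkcondr.
  rewrite exchange_big /=; apply: ler_sum => A hA; have A0 := cA0 A hA.
  rewrite [leRHS]big_mkcond /=; apply: ler_sum => p _.
  case: ifP => // /and4P[/forallP fpr _ fLam _].
  set W := (A * \prod_i p i)%N.
  have pp0 : (0 < \prod_i p i)%N by apply: prodn_gt0 => i; apply: prime_gt0.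
  have W0 : (0 < W)%N by rewrite muln_gt0 A0.
  have p1 := prime_gt1 (fpr ord_max).
  apply: (@le_trans _ _ (\sum_(0 <= b < (X %/ W).+1 | (1 < b)%N && (rough (p ord_max)).-nat b) 1)).
    have -> : \sum_(0 <= b < (X %/ W).+1 | (1 < b)%N && (rough (p ord_max)).-nat b) 1 =
      \sum_(b <- [seq b <- index_iota 0 (X %/ W).+1 | (1 < b)%N && (rough (p ord_max)).-nat b])
         (fun=> 1) ((fun b => b * W)%N b) :> R.
      by rewrite big_filter.
    rewrite -[leLHS]big_filter.
    apply: (sum_cover_le (h := fun b => (b * W)%N) (G := fun=> 1)) => //.
      by rewrite filter_uniq // iota_uniq.
    move=> n; rewrite mem_filter mem_index_iota => /andP[/and3P[Wn n1 rn] hn].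
    exists (n %/ W)%N; last by rewrite divnK.
    rewrite mem_filter mem_index_iota n1 rn /= ltnS leq_div2r //.
  apply: le_trans (rough_gt1_count_le _ _ p1) _.
  have lp := lnn_gt0 R p1.
  have -> : c / A%:R * \prod_i (p i : nat)%:R^-1 = 34 * (X%:R / W%:R) * (rho / Lam).
    by rewrite /c /W natrM natr_prod prodfV !invfM; ring.
  rewrite ler_pdivrMr //; apply: (@le_trans _ _ (34 * (X%:R / W%:R) * 1)).
    by rewrite mulr1 ler_wpM2l // ler_pdivlMr ?ltr0n // -natrM ler_nat leq_trunc_div.
  rewrite -[leRHS]mulrA ler_wpM2l ?mulr_ge0 ?invr_ge0 //.
  by rewrite mulrAC ler_pdivlMr // mul1r.
rewrite mulr_sumr; apply: ler_sum => A hA; have A0 := cA0 A hA.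
rewrite -mulr_sumr.
have h := class_psum t Lam K B A0 w0 lam0 rho0.
have cA1 : 0 <= c / A%:R by rewrite divr_ge0.
apply: le_trans (ler_wpM2l cA1 h) _.
by apply: eq_lew; rewrite -/c; ring.
Qed.

(** Unlike in [rankin_tail], [A] runs over all smooth numbers: the [A] of the upper-bound
    decomposition need not be squarefree. *)
Lemma rankin_full : exists2 C : R, 0 < C & forall t N X z (eta beta : R),
  0 <= eta -> eta * lnn z <= 1 / 4 ->
  \sum_(0 <= A < X.+1 | (below predT N).-nat A && (beta <= lnn (smooth_part z A))) FN R t A / A%:R
  <= C * expR (- (eta * beta)) * divsum (prodQ predT N) (FN R t).
Proof.
have [C C0 HC] := rankin_le R k.+1; exists C => // t N X z eta beta eta0 etaz.
have := HC predT N X z eta (FN R t) eta0 etaz (@FN_ge0 R k t) (@FN_pow R k t).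
move=> h; rewrite mulrAC mulrC.
apply: le_trans (ler_wpM2l (expR_ge0 _) h).
rewrite mulr_sumr big_mkcondr /=; apply: ler_sum => A _.
case: ifP => hb; last by rewrite mulr_ge0 ?expR_ge0 // divr_ge0 // mulr_ge0 ?FN_ge0 // expR_ge0.
rewrite mulrA ler_wpM2r ?invr_ge0 // mulrCA -[leLHS]mulr1 ler_wpM2l ?FN_ge0 //.
rewrite /rweight -expRD; apply: le_trans (expR_ge1Dx _).
by rewrite lerDl addrC subr_ge0 ler_wpM2l.
Qed.

(** Primes in the windows [(Y_i, 4 Y_i]] are dropped at bounded cost; for the remaining [A] the
    thresholds [Y_i] and [4 Y_i] separate the same primes, so [Nt] does not change. *)
Lemma Ssum_4Y : exists2 C : R, 0 < C & forall Y : 'I_k.+1 -> nat,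
  (forall i, (0 < Y i)%N) ->
  Ssum R (fun i => 4 * Y i)%N <= C * Ssum R Y.
Proof.
pose C : R := expR (gpow R k.+1 1 * (k.+1 * (10 + 2 * 2))%:R).
exists C; first exact: expR_gt0.
move=> Y Y0; rewrite /Ssum; set t := (fun i => 4 * Y i)%N.
pose E : pred nat := fun p => [exists i, (Y i < p <= 4 * Y i)%N].
have := prodQ_sub predT E (t ord_max) (gpow_ge0 R k.+1 1) (@FN_ge0 R k t) (@FN_mul R k t).
move=> h; apply: le_trans h _.
apply: ler_pM.
- by apply: prodr_ge0 => p _; rewrite addr_ge0 // divr_ge0 // gpow_ge0.
- by apply: divsum_ge0; apply: FN_ge0.
- apply: (@excess_prod_le R k.+1 (fun i => (Y i).+1)) => //.
    exact: gpow_ge0.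
  move=> p pr /existsP[i /andP[h1 h2]]; exists i; rewrite h1 /=.
  by apply: leq_trans h2 _; rewrite expnS expn1; clear; move: (Y i) => y; nia.
rewrite /divsum; set P := prodQ (fun p => predT p && ~~ E p) _.
have P0 : (0 < P)%N by apply: prodQ_gt0.
have nE p A : (A %| P)%N -> prime p -> (p %| A)%N -> (p <= t ord_max)%N && ~~ E p.
  move=> AP pr pA; have : (p %| P)%N by apply: dvdn_trans AP.
  by rewrite prime_dvd_prodQ.
apply: (@le_trans _ _ (\sum_(A <- divisors P) FN R Y A / A%:R)).
  rewrite big_seq [leRHS]big_seq; apply: ler_sum => A; rewrite -dvdn_divisors // => AP.
  have A0 : (0 < A)%N by apply: dvdn_gt0 AP.
  rewrite /FN (@Nt_eq _ t Y) // => i p pr pA.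
  have /andP[_ /existsPn /(_ i)] := nE p A AP pr pA.
  by rewrite /t; clear; lia.
apply: sum_sub_le; first exact: divisors_uniq.
  move=> A; rewrite -!dvdn_divisors ?prodQ_gt0 // => AP.
  apply: dvdn_trans AP _; apply: prod_primes_dvd => p /andP[_ hp] /andP[pr /= nEp]; split => //.
  rewrite prime_dvd_prodQ //= andbT leqNgt; apply/negP => Yp.
  have pP : (p %| P)%N by rewrite prime_dvd_prodQ //= nEp andbT; move: hp; rewrite ltnS.
  have /andP[pt _] := nE p p pP pr (dvdnn p).
  by move/negP: nEp; apply; apply/existsP; exists ord_max; rewrite Yp.
by move=> A _; rewrite divr_ge0 // FN_ge0.
Qed.

End UpperClass.

(** * Sorting the largest prime factors *)

Section PrimeDecomposition.
Local Open Scope nat_scope.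

Lemma sorting_perm n (q : 'I_n -> nat) :
  exists s : {perm 'I_n}, forall i j : 'I_n, i <= j -> q (s i) <= q (s j).
Proof.
case: n q => [|n] q; first by exists 1%g => -[].
pose r := relpre q leq.
pose l := sort r (enum 'I_n.+1).
have lsz : size l = n.+1 by rewrite size_sort size_enum_ord.
have lu : uniq l by rewrite sort_uniq enum_uniq.
have inj : injective (fun i : 'I_n.+1 => nth ord0 l i).
  move=> i j /eqP; rewrite nth_uniq ?lsz //; by move=> /eqP h; apply: val_inj.
exists (perm inj) => i j ij; rewrite !permE.
have tr : transitive r by move=> a b c; apply: leq_trans.
have rr : reflexive r by move=> a; apply: leqnn.
have ls : sorted r l by apply: sort_sorted => a b; apply: leq_total.
by apply: (sorted_leq_nth tr rr ord0 ls); rewrite ?inE ?lsz.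
Qed.

(** Otherwise the inverse would map the [i + 1] indices up to [i] into the [i] indices below [i]. *)
Lemma perm_pigeonhole n (s : {perm 'I_n}) (i : 'I_n) : exists2 j : 'I_n, i <= j & s j <= i.
Proof.
apply/exists_inP; apply: contraT => /exists_inPn H.
have h (a : 'I_n) : a <= i -> (s^-1)%g a < i.
  move=> ai; rewrite ltnNge; apply/negP => hj.
  by have := H _ hj; rewrite permKV ai.
case: n s i H h => [|n] s i H h; first by case: (i).
pose l := [seq nat_of_ord ((s^-1)%g (inord a)) | a <- iota 0 i.+1].
have lu : uniq l.
  rewrite map_inj_in_uniq ?iota_uniq // => a b; rewrite !mem_iota !add0n => /andP[_ ha] /andP[_ hb].
  move=> /val_inj /perm_inj /(congr1 val) /=; have := ltn_ord i => li.
  by rewrite !inordK //; [apply: leq_trans hb li | apply: leq_trans ha li].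
have sub : {subset l <= iota 0 i}.
  move=> x /mapP[a]; rewrite mem_iota add0n => /andP[_ ha] ->.
  rewrite mem_iota /= add0n; apply: h; rewrite inordK //.
  by apply: leq_trans ha (ltn_ord i).
by have := uniq_leq_size lu sub; rewrite size_map !size_iota ltnn.
Qed.

Section Decomp.
Variable k : nat.

Definition wid (i : 'I_k.+1) : 'I_k.+2 := widen_ord (leqnSn k.+1) i.

Lemma max_pdiv_smooth d : 0 < d -> (below predT (max_pdiv d)).-nat d.
Proof.
move=> d0; apply/pnatP => // p pr pd; rewrite !inE andbT; apply: max_pdiv_max.
by rewrite mem_primes pr d0.
Qed.

Lemma pnat_le a b m : a <= b -> (below predT a).-nat m -> (below predT b).-nat m.
Proof.
by move=> ab; apply: sub_in_pnat => p _; rewrite !inE !andbT => h; apply: leq_trans ab.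
Qed.

(** The bound [p_i <= 4 Y_i] survives the sorting: some [j >= i] has [s j <= i], so [p_i] is at most
    the largest prime of [D (s j)], which is at most [4 Y_(s j) <= 4 Y_i]. *)
Lemma largest_prime_decomposition (Y : 'I_k.+1 -> nat) (D : 'I_k.+2 -> nat) :
  (forall i j : 'I_k.+1, i <= j -> Y i <= Y j) -> (forall j, 1 < D j) ->
  (forall i, D (wid i) <= 4 * Y i) ->
  exists (s : {perm 'I_k.+2}) (p e : {ffun 'I_k.+1 -> nat}) (A b : nat),
  [/\ forall i, prime (p i), \prod_j D j = A * \prod_i p i * b,
      1 < b /\ (rough (p ord_max)).-nat b,
      okd (fun i => 4 * Y i) A e /\ (below predT (4 * Y ord_max)).-nat A &
      forall i, [/\ D (s (wid i)) = p i * e i, (below predT (p i)).-nat (e i),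
        p i <= p ord_max & p i <= 4 * Y i]].
Proof.
move=> Ymono D1 DY.
have [s Hs] := sorting_perm (fun j => max_pdiv (D j)).
pose q j := max_pdiv (D (s j)).
have qpr j : prime (q j) by apply: max_pdiv_prime.
have qD j : q j %| D (s j) by apply: max_pdiv_dvd.
have q0 j : 0 < q j by apply: prime_gt0.
have D0 j : 0 < D j by apply: ltnW.
pose ee j := D (s j) %/ q j.
have De j : D (s j) = q j * ee j by rewrite mulnC divnK.
have ee0 j : 0 < ee j by have := D0 (s j); rewrite De muln_gt0 => /andP[].
have eD j : ee j %| D (s j) by rewrite De dvdn_mull.
have esm j : (below predT (q j)).-nat (ee j).
  by apply: pnat_dvd (eD j) _; apply: max_pdiv_smooth.
pose p : {ffun 'I_k.+1 -> nat} := [ffun i => q (wid i)].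
pose e : {ffun 'I_k.+1 -> nat} := [ffun i => ee (wid i)].
pose m := (\prod_i e i) * ee ord_max.
pose pi := below predT (p ord_max).
have pE : forall i, p i <= p ord_max.
  by move=> i; rewrite !ffunE; apply: Hs; rewrite /= -ltnS.
have pY i : p i <= 4 * Y i.
  rewrite ffunE; have [j ij sji] := perm_pigeonhole s (wid i).
  apply: leq_trans (Hs _ _ ij) _.
  apply: (@leq_trans (D (s j))); first by apply: dvdn_leq => //; apply: max_pdiv_dvd.
  have sj : s j < k.+1 by apply: leq_ltn_trans sji (ltn_ord i).
  have -> : s j = wid (Ordinal sj) by apply: val_inj.
  by apply: leq_trans (DY _) _; rewrite leq_mul2l Ymono.
have m0 : 0 < m.
  by rewrite /m muln_gt0 ee0 andbT; apply: prodn_gt0 => i; rewrite ffunE.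
(* [m] is what remains of the [D j] without their largest primes. Its part with primes above
   [p ord_max] joins the last prime in [b], which stays rough. *)
exists s, p, e, (m`_pi), (q ord_max * m`_pi^').
split.
- by move=> i; rewrite ffunE.
- rewrite (reindex_perm s) big_ord_recr /= De.
  under eq_bigr do rewrite De.
  rewrite big_split /=.
  have -> : \prod_(i < k.+1) q (widen_ord (leqnSn k.+1) i) = \prod_i p i.
    by apply: eq_bigr => i _; rewrite ffunE.
  have -> : \prod_(i < k.+1) ee (widen_ord (leqnSn k.+1) i) = \prod_i e i.
    by apply: eq_bigr => i _; rewrite ffunE.
  have mE : m = m`_pi * m`_pi^' by rewrite partnC.
  transitivity ((\prod_i p i) * q ord_max * m); first by rewrite /m; ring.
  by rewrite {1}mE; ring.
- split.
    by apply: (@leq_trans (q ord_max)); [apply: prime_gt1 | rewrite leq_pmulr ?part_gt0].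
  rewrite pnatM pnatE // !inE; apply/andP; split.
    by rewrite ffunE; apply: Hs; exact: leqnSn.
  apply: sub_in_pnat (part_pnat pi^' m) => r _; rewrite !inE andbT -ltnNge; exact: ltnW.
- split.
    apply/andP; split; last first.
      by apply/forallP => i; have := pY i; rewrite !ffunE => h; apply: pnat_le h (esm _).
    have en : pi.-nat (\prod_i e i).
      elim/big_ind: _ => // [x y hx hy|i _]; first by rewrite pnatM hx.
      by apply: pnat_le (pE i) _; rewrite !ffunE.
    by rewrite -(part_pnat_id en) partn_dvd // /m dvdn_mulr.
  by apply: pnat_le (pY ord_max) _; apply: part_pnat.
move=> i; split => //; first by rewrite !ffunE De.
by rewrite !ffunE.
Qed.

End Decomp.

End PrimeDecomposition.

Definition rootn h Y := (\max_(v < Y.+1 | (v ^ h <= Y)%N) v)%N.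

Lemma rootn_ge h Y v : (0 < h)%N -> (v ^ h <= Y)%N -> (v <= rootn h Y)%N.
Proof.
move=> h0 hv; have vY : (v < Y.+1)%N.
  rewrite ltnS; apply: leq_trans hv; case: v => // v.
  by rewrite -{1}[v.+1]expn1 leq_pexp2l.
exact: (@leq_bigmax_cond _ (fun v : 'I_Y.+1 => (v ^ h <= Y)%N) (fun v => v : nat) (Ordinal vY)).
Qed.

Lemma rootn_pow h Y : (0 < h)%N -> (rootn h Y ^ h <= Y)%N.
Proof.
move=> h0; rewrite /rootn; elim/big_ind: _ => //; first by rewrite exp0n.
by move=> a b ha hb; rewrite /maxn; case: ifP.
Qed.

Section Ext.
Variables (k : nat) (T : Type).
Definition ext (f : 'I_k.+1 -> T) (x : T) (j : 'I_k.+2) : T :=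
  if insub (val j) : option 'I_k.+1 is Some i then f i else x.

Lemma ext_wid f x i : ext f x (wid i) = f i.
Proof.
rewrite /ext; case: insubP => /= [i' _ e|]; last by rewrite ltn_ord.
by congr f; apply: val_inj.
Qed.

Lemma ext_max f x : ext f x ord_max = x.
Proof. by rewrite /ext insubF //= ltnn. Qed.
End Ext.

Lemma widP k (j : 'I_k.+2) : j = ord_max \/ exists i, j = wid i.
Proof.
have [h|h] := ltnP j k.+1; first by right; exists (Ordinal h); apply: val_inj.
by left; apply: val_inj; apply/eqP; rewrite eqn_leq h andbT /= -ltnS ltn_ord.
Qed.

(** * The upper bound for [n] in one dyadic block *)

Section UpperX.
Variables (R : realType) (k : nat).
Local Notation lnn n := (ln (n%:R : R)).

Lemma exp_pow_bound N (y : R) : 0 < y ->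
  expR (- (y / 8)) <= 8 ^+ N.+1 * (N.+1)`!%:R / y ^+ N.+1.
Proof.
move=> y0; have h := @expR_ge1Dxn R (y / 8) N ltac:(by rewrite divr_ge0 // ltW).
have yN : 0 < y ^+ N.+1 by apply: exprn_gt0.
have f0 : (0 : R) < (N.+1)`!%:R by rewrite ltr0n fact_gt0.
have e8 : (0 : R) < 8 ^+ N.+1 by apply: exprn_gt0.
rewrite expr_div_n in h.
rewrite expRN ler_pdivlMr // mulrC ler_pdivrMr ?expR_gt0 //.
move: h; move: (y ^+ N.+1) ((N.+1)`!%:R) (8 ^+ N.+1) (expR _) f0 e8 => a f e x f0 e0 h.
have {}h : a / e / f <= x by lra.
by move: h; rewrite ler_pdivrMr // ler_pdivrMr //; lra.
Qed.

(* The left side collects the loss [2^r] for each of the [k + 2] logarithms and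
   the gain from Rankin's trick. *)
Lemma class_factor_le r :
  2 ^+ (r.+1 * k.+2) * expR (1 - 2 ^+ r / 8) <=
  (2 ^+ k.+2 * expR 1 * (8 ^+ k.+3 * (k.+3)`!%:R)) * (1 / 2) ^+ r :> R.
Proof.
set y : R := 2 ^+ r.
have y0 : 0 < y by rewrite exprn_gt0.
have E1 : 2 ^+ (r.+1 * k.+2) = 2 ^+ k.+2 * y ^+ k.+2 :> R.
  by rewrite /y -!exprM -exprD; congr (_ ^+ _); lia.
have E2 := exp_pow_bound k.+2 y0.
rewrite expRD E1.
have E3 : (1 / 2) ^+ r = y^-1 :> R by rewrite /y mul1r exprVn.
rewrite E3.
have a0 : 0 <= 2 ^+ k.+2 * y ^+ k.+2 * expR 1.
  apply: mulr_ge0 (expR_ge0 _); apply: mulr_ge0; apply: exprn_ge0 => //; exact: ltW.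
rewrite mulrA; apply: le_trans (ler_wpM2l a0 E2) _.
apply: eq_lew; rewrite [y ^+ k.+3]exprS.
have yk : y ^+ k.+2 != 0 by rewrite gt_eqF ?exprn_gt0.
have yn : y != 0 by rewrite gt_eqF.
have key (a b c d e f : R) : a != 0 -> b != 0 ->
  c * a * f * (d * e / (b * a)) = c * f * (d * e) * b^-1.
  by move=> an bn; field; rewrite ?an ?bn.
exact: key.
Qed.

Lemma upper_dyadic_block : exists2 C : R, 0 < C & forall (Y : 'I_k.+1 -> nat) wl X (G : pred nat),
  (forall i, (2 < Y i)%N) -> (forall i j : 'I_k.+1, (i <= j)%N -> (Y i <= Y j)%N) ->
  (0 < wl)%N -> 1 / 8 * lnn (Y ord_max) <= lnn wl ->
  (forall n, G n -> exists D : 'I_k.+2 -> nat, [/\ (\prod_j D j)%N = n,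
     forall i, (Y i < D (wid i) <= 4 * Y i)%N &
     (wl < D ord_max <= 4 ^ k.+2 * wl)%N]) ->
  \sum_(0 <= n < X.+1 | G n) 1 <=
    C * X%:R * Ssum R Y / (\prod_i lnn (Y i) * lnn (Y ord_max)).
Proof.
have [C1 C10 HC1] := rankin_full R k.
have [C2 C20 HC2] := Ssum_4Y R k.
have [K HK] : exists K, K = (4 ^ k.+2)%N by exists (4 ^ k.+2)%N.
have K4 : (4 <= K)%N by rewrite HK -{1}[4%N]expn1 leq_pexp2l.
pose K1 : R := 2 ^+ k.+2 * expR 1 * (8 ^+ k.+3 * (k.+3)`!%:R).
have K10 : 0 < K1.
  apply: mulr_gt0.
    by apply: mulr_gt0 (expR_gt0 _); apply: exprn_gt0.
  by apply: mulr_gt0; [apply: exprn_gt0 | rewrite ltr0n fact_gt0].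
(* 34 is from the rough count, the first 8 from [Lam], the second from [prodlam], [(4K)^(k+1)] from
   [class_psum], and [C1 * C2] from Rankin and the passage from [4 Y] to [Y]. *)
pose K2 : R := 34 * 8 * ((4 * K)%:R ^+ k.+1 * 8) * (C1 * C2).
have K20 : 0 < K2.
  apply: mulr_gt0; last exact: mulr_gt0.
  apply: mulr_gt0 => //; apply: mulr_gt0 => //.
  by apply: exprn_gt0; rewrite ltr0n muln_gt0 (leq_trans _ K4).
exists (#|{perm 'I_k.+2}|%:R * (k.+1%:R * (K2 * K1 * 2))).
  apply: mulr_gt0; first by rewrite ltr0n; apply/card_gt0P; exists 1%g.
  by apply: mulr_gt0; [rewrite ltr0n | do 2 apply: mulr_gt0 => //].
move=> Y wl X G Y2 Ymono wl0 wlY; rewrite -HK => HG.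
set Z := Y ord_max in wlY *.
have Z1 : (1 < Z)%N by apply: ltnW; apply: Y2.
have lZ := lnn_gt0 R Z1.
have lY i : 0 < lnn (Y i) by apply: lnn_gt0; apply: ltnW; apply: Y2.
have lYZ i : lnn (Y i) <= lnn Z.
  by apply: lnn_le; [apply: leq_trans (Y2 i) | apply: Ymono; rewrite -ltnS].
have Pl0 : 0 < \prod_i lnn (Y i) by apply: prodr_gt0.
(* The cofactor enters [lam] with the guaranteed [1/8 log Z] instead of [log wl], so that every
   [lam j] is at most [log Z]. *)
pose W := ext Y wl; pose lam := ext (fun i => lnn (Y i)) (1 / 8 * lnn Z).
have W0 j : (0 < W j)%N.
  by case: (widP j) => [->|[i ->]]; rewrite /W ?ext_max ?ext_wid //; apply: leq_trans (Y2 i).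
have lam0 j : 0 < lam j.
  by case: (widP j) => [->|[i ->]]; rewrite /lam ?ext_max ?ext_wid //; lra.
have lamW j : lam j <= lnn (W j).
  by case: (widP j) => [->|[i ->]]; rewrite /lam /W ?ext_max ?ext_wid.
have lamZ j : lam j <= lnn Z.
  by case: (widP j) => [->|[i ->]]; rewrite /lam ?ext_max ?ext_wid //; lra.
pose Lam := 1 / 8 * lnn Z.
have Lam0 : 0 < Lam by rewrite /Lam; lra.
pose t (i : 'I_k.+1) := (4 * Y i)%N.
pose z (s : {perm 'I_k.+2}) r (i : 'I_k.+1) := rootn (2 ^ r) (W (s (wid i))).
pose cA (s : {perm 'I_k.+2}) (r : nat) (i : 'I_k.+1) A := (below predT (t ord_max)).-nat A &&
  ((r == 0%N) || (1 / 2 * lnn (W (s (wid i))) <= lnn (smooth_part (z s r i) A))).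
pose rho r : R := 2 ^+ r.+1.
pose B := (t ord_max).+1.
pose val_ (s : {perm 'I_k.+2}) r A (p : {ffun 'I_k.+1 -> 'I_B}) :=
  valid (fun i => W (s (wid i))) t (fun i => lam (s (wid i))) Lam (rho r) K A p.
pose cn n A (p : {ffun 'I_k.+1 -> 'I_B}) :=
  [&& (A * \prod_i p i %| n)%N, (1 < n %/ (A * \prod_i p i))%N &
        (rough (p ord_max)).-nat (n %/ (A * \prod_i p i))%N].
(* [log p_i >= 1/2] because [p_i >= 2], so the requirement is met at [r = rmax] and only finitely
   many classes occur. *)
have [rmax Hrmax] := nat_above (2 * lnn Z).
(* [r] is least such that every [log (p i)] is within a factor [2^(r+1)] of its
   expected size; for [r > 0] the index [i] witnesses its minimality. *)
have cover n : (n < X.+1)%N -> G n -> exists (s : {perm 'I_k.+2}) (r : 'I_rmax.+1) (i : 'I_k.+1)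
    (p : {ffun 'I_k.+1 -> 'I_B}) A,
    [/\ (A < X.+1)%N, cA s r i A, val_ s r A p & cn n A p].
  move=> nX Gn; have [D [Dn DY Dw]] := HG n Gn.
  have DW j : (W j < D j <= K * W j)%N.
    case: (widP j) => [->|[i ->]]; rewrite /W ?ext_max ?ext_wid //.
    have /andP[-> h] := DY i; apply: leq_trans h _; rewrite leq_mul2r K4 orbT //.
  have D1 j : (1 < D j)%N by have /andP[h _] := DW j; apply: leq_trans h; rewrite ltnS W0.
  have D4 i : (D (wid i) <= 4 * Y i)%N by case/andP: (DY i).
  have [s [p [e [A [b [ppr nE [b1 rb] [he Asm] Hi]]]]]] := largest_prime_decomposition Ymono D1 D4.
  rewrite Dn in nE.
  have n0 : (0 < n)%N by rewrite -Dn; apply: prodn_gt0 => j; apply: ltnW.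
  have A0 : (0 < A)%N by move: n0; rewrite nE !muln_gt0 => /andP[/andP[]].
  pose prd r := [forall i, lam (s (wid i)) <= rho r * lnn (p i)].
  have pex : prd rmax.
    apply/forallP => i; apply: le_trans (lamZ _) _.
    have h1 : (rmax%:R : R) <= rho rmax.
      by rewrite /rho -natrX ler_nat; apply/ltnW/(ltn_trans _ (ltn_expl _ _)).
    have h2 := lnn_ge_half R (prime_gt1 (ppr i)).
    apply: (@le_trans _ _ (rho rmax * (1 / 2))); first by move: (rho rmax) h1 => x; lra.
    by rewrite ler_wpM2l // exprn_ge0.
  have ex : exists r, prd r by exists rmax.
  case: (ex_minnP ex) => r pr_r rmin.
  have rm : (r < rmax.+1)%N by rewrite ltnS; apply: rmin.
  have pB i : (p i < B)%N.
    have [_ _ h1 _] := Hi i; have [_ _ _ h2] := Hi ord_max.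
    by rewrite ltnS; apply: leq_trans h1 h2.
  pose p' : {ffun 'I_k.+1 -> 'I_B} := [ffun i => inord (p i)].
  have p'E i : (p' i : nat) = p i by rewrite ffunE inordK.
  have pp : (\prod_i p' i = \prod_i p i)%N by apply: eq_bigr => i _; rewrite p'E.
  have w0 : (0 < A * \prod_i p i)%N by move: n0; rewrite {1}nE muln_gt0 => /andP[].
  have [i0 Hi0] : exists i : 'I_k.+1, (r == 0%N) || ~~ (lam (s (wid i)) <= 2 ^+ r * lnn (p i)).
    have [r0|r0] := eqVneq r 0%N; first by exists ord0.
    have : ~~ prd r.-1 by apply/negP => /rmin; rewrite leqNgt prednK ?lt0n // leqnn.
    by case/forallPn => i; rewrite /rho prednK ?lt0n //; exists i.
  exists s, (Ordinal rm), i0, p', A; split.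
  - by apply: leq_ltn_trans nX; rewrite dvdn_leq // nE -mulnA dvdn_mulr.
  - rewrite /cA Asm /=; case/orP: Hi0 => [->//|]; rewrite -ltNge => hlt.
    apply/orP; case: (posnP r) => [->|r0]; first by left.
    right; set w := W (s (wid i0)).
    have [De esm _ _] := Hi i0.
    have /andP[Dw1 _] := DW (s (wid i0)); rewrite De -/w in Dw1.
    have p0 := prime_gt0 (ppr i0).
    have pw : (p i0 ^ (2 ^ r) <= w)%N.
      rewrite -(ler_nat R) -ler_ln ?posrE ?ltr0n ?expn_gt0 ?p0 ?W0 //.
      rewrite lnnX // natrX; apply: le_trans (ltW hlt) (lamW _).
    (* [p e > w] while [p^2 <= w], which uses [r >= 1]. As [e] divides [A] and is [z]-smooth, the
       smooth part of [A] is at least [sqrt w]. *)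
    have e2 : (w <= e i0 ^ 2)%N.
      have p2 : (p i0 ^ 2 <= w)%N.
        apply: leq_trans pw; rewrite leq_pexp2l //.
        by rewrite -{1}[2%N]expn1 leq_pexp2l.
      move: Dw1 p2 p0; clear; rewrite !expnS !expn0; move: (p i0) (e i0) w => a b c; nia.
    have e0 : (0 < e i0)%N := okd_gt0 i0 he.
    have ez : (below predT (z s r i0)).-nat (e i0).
      apply: pnat_le esm; apply: rootn_ge => //; by rewrite expn_gt0.
    have esp : (e i0 <= smooth_part (z s r i0) A)%N.
      apply: dvdn_leq; first exact: part_gt0.
      by rewrite -(part_pnat_id ez) partn_dvd // (okd_dvd i0 he).
    apply: (@le_trans _ _ (lnn (e i0))); last exact: lnn_le.
    have := @lnn_le R w (e i0 ^ 2)%N (W0 _) e2; rewrite lnnX //.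
    by move: (ln _) (ln _) => a c; lra.
  - apply/and4P; split.
    + by apply/forallP => i; rewrite p'E.
    + by apply/forallP => i; rewrite p'E; apply: (forallP pr_r).
    (* Sorting leaves out one index only, so the last [Y] or the cofactor, both of expected size at
       least [Lam], is among the first [k+1] positions; [p ord_max] dominates its prime. *)
    + have [i hi] : exists i, Lam <= lam (s (wid i)).
        pose j0 := (s^-1)%g (wid (@ord_max k)); pose j1 := (s^-1)%g (@ord_max k.+1).
        have e0 : s j0 = wid ord_max by rewrite permKV.
        have e1 : s j1 = ord_max by rewrite permKV.
        case: (widP j0) => [h0|[i hi]]; last first.
          by exists i; rewrite -hi e0 /lam ext_wid /Lam -/Z; lra.
        case: (widP j1) => [h1|[i hi]]; last first.
          by exists i; rewrite -hi e1 /lam ext_max.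
        have : wid (@ord_max k) = @ord_max k.+1 by rewrite -e0 -e1 h0 h1.
        by move/(congr1 val) => /= /eqP; rewrite ltn_eqF.
      apply: le_trans hi _; apply: le_trans (forallP pr_r i) _; rewrite p'E.
      have [_ _ h1 _] := Hi i.
      by rewrite ler_wpM2l ?exprn_ge0 //; apply: lnn_le => //; apply: prime_gt0.
    + apply/hasP; exists e; first exact: okd_box he.
      apply/andP; split => //; apply/forallP => i; rewrite p'E.
      by have [<- _ _ _] := Hi i; apply: DW.
  - by rewrite /cn pp nE dvdn_mulr // mulKn // b1 p'E.
have bound (s : {perm 'I_k.+2}) (r : nat) (i : 'I_k.+1) :
  \sum_(p : {ffun 'I_k.+1 -> 'I_B}) \sum_(0 <= A < X.+1 | cA s r i A && val_ s r A p)
    \sum_(0 <= n < X.+1 | cn n A p) 1 <=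
  K2 * K1 * (1 / 2) ^+ r * (X%:R * Ssum R Y / (\prod_i lnn (Y i) * lnn Z)).
  have rho0 : 0 < rho r by apply: exprn_gt0.
  have cA0 A : cA s r i A -> (0 < A)%N by case/andP => /andP[].
  apply: le_trans (class_count t K B X (fun i => W0 (s (wid i))) (fun i => lam0 (s (wid i))) rho0 Lam0 cA0) _.
  (* The product over all [k+2] indices is known, and the omitted factor is at most [log Z]. *)
  have prodlam : 1 / 8 * \prod_i lnn (Y i) <= \prod_i lam (s (wid i)).
    have eP : (\prod_i lam (s (wid i))) * lam (s ord_max) = \prod_i lnn (Y i) * (1 / 8 * lnn Z).
      transitivity (\prod_j lam j).
        by rewrite [RHS](reindex_perm s) [RHS]big_ord_recr.
      rewrite big_ord_recr /= {2}/lam ext_max; congr (_ * _).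
      by apply: eq_bigr => j _; rewrite -/(wid j) /lam ext_wid.
    rewrite -(ler_pM2r lZ); apply: (@le_trans _ _ (\prod_i lam (s (wid i)) * lam (s ord_max))).
      by rewrite eP; apply: eq_lew; ring.
    by rewrite ler_wpM2l // prodr_ge0 // => j _; apply: ltW.
  have S0 : 0 <= Ssum R Y by apply: le_trans (Ssum_ge1 R Y).
  have sumA : \sum_(0 <= A < X.+1 | cA s r i A) FN R t A / A%:R <=
     C1 * C2 * expR (1 - 2 ^+ r / 8) * Ssum R Y.
    have St : Ssum R t <= C2 * Ssum R Y by apply: HC2 => j; apply: leq_trans (Y2 j).
    have E0 : 0 <= C1 * expR (1 - 2 ^+ r / 8) by rewrite mulr_ge0 ?expR_ge0 ?(ltW C10).
    apply: (@le_trans _ _ (C1 * expR (1 - 2 ^+ r / 8) * Ssum R t)); last first.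
      apply: le_trans (ler_wpM2l E0 St) _.
      by apply: eq_lew; ring.
    have St0 : 0 <= Ssum R t by apply: le_trans (Ssum_ge1 R t).
    have [r0|r0] := posnP r.
      have := HC1 t (t ord_max) X 0%N 0 0 (lexx _).
      rewrite !mul0r => /(_ ltac:(lra)); rewrite oppr0 expR0 mulr1 => h.
      apply: (@le_trans _ _ (C1 * Ssum R t)).
        apply: le_trans h; apply: eq_lew.
        by apply: eq_bigl => A; rewrite /cA r0 /= lnn_ge0.
      rewrite ler_wpM2r // -{1}[C1]mulr1 ler_wpM2l ?(ltW C10) //.
      by apply: le_trans (expR_ge1Dx _); rewrite r0 expr0; lra.
    set w := W (s (wid i)).
    have lw : 0 < lnn w by apply: lt_le_trans (lam0 _) (lamW _).
    (* [z] is at most the [2^r]-th root of [w], so this [eta] meets [eta log z <= 1/4], and the gain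
       at [beta = (log w)/2] is [exp (-2^r/8)]. The extra [exp 1] in [sumA] covers [r = 0], where
       nothing is gained. *)
    pose eta : R := 2 ^+ r / (4 * lnn w).
    have eta0 : 0 <= eta by rewrite divr_ge0 ?exprn_ge0 // mulr_ge0 // ltW.
    have etaz : eta * lnn (z s r i) <= 1 / 4.
      rewrite /eta mulrAC ler_pdivrMr ?mulr_gt0 //.
      have -> : 1 / 4 * (4 * lnn w) = lnn w by field.
      case: (posnP (z s r i)) => [->|z0]; first by rewrite ln0 // mulr0 ltW.
      have zp : (z s r i ^ (2 ^ r) <= w)%N by apply: rootn_pow; rewrite expn_gt0.
      by rewrite -natrX -lnnX //; apply: lnn_le => //; rewrite expn_gt0 z0.
    have := HC1 t (t ord_max) X (z s r i) eta (1 / 2 * lnn w) eta0 etaz => h.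
    apply: (@le_trans _ _ (C1 * expR (- (eta * (1 / 2 * lnn w))) * Ssum R t)).
      apply: le_trans h; apply: eq_lew.
      by apply: eq_bigl => A; rewrite /cA -/w; case: (r) r0.
    rewrite ler_wpM2r // ler_wpM2l ?(ltW C10) // ler_expR.
    have -> : eta * (1 / 2 * lnn w) = 2 ^+ r / 8 by rewrite /eta; field; rewrite gt_eqF.
    by rewrite lerDr.
  have cf := class_factor_le r; rewrite -/K1 in cf.
  have fK : 0 <= ((4 * K)%:R : R) ^+ k.+1 by apply: exprn_ge0.
  have rk : rho r * (rho r) ^+ k.+1 = 2 ^+ (r.+1 * k.+2) by rewrite -exprS /rho -exprM.
  have s1 : (((4 * K)%:R * rho r) ^+ k.+1 / \prod_i lam (s (wid i))) <=
     (4 * K)%:R ^+ k.+1 * 8 * (rho r) ^+ k.+1 / \prod_i lnn (Y i).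
    have P8 : 0 < 1 / 8 * \prod_i lnn (Y i) by rewrite mulr_gt0.
    rewrite exprMn.
    apply: (@le_trans _ _ ((4 * K)%:R ^+ k.+1 * (rho r) ^+ k.+1 / (1 / 8 * \prod_i lnn (Y i)))).
      rewrite ler_wpM2l ?mulr_ge0 ?exprn_ge0 ?(ltW rho0) //.
      by rewrite lef_pV2 ?posrE // (lt_le_trans P8).
    apply: eq_lew.
    move: ((4 * K)%:R ^+ k.+1) (rho r ^+ k.+1) (\prod_i lnn (Y i)) Pl0 => a b c c0.
    by field; rewrite gt_eqF.
  have pl0 : 0 <= 34 * X%:R * rho r / Lam.
    by apply: divr_ge0 (ltW Lam0); apply: mulr_ge0 (ltW rho0); apply: mulr_ge0.
  have q0 : 0 <= ((4 * K)%:R * rho r) ^+ k.+1 / \prod_i lam (s (wid i)).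
    apply: divr_ge0; last by apply: prodr_ge0 => j _; apply: ltW.
    by apply: exprn_ge0; apply: mulr_ge0 (ltW rho0).
  have sA0 : 0 <= \sum_(0 <= A < X.+1 | cA s r i A) FN R t A / A%:R.
    by apply: sumr_ge0 => A _; rewrite divr_ge0 // FN_ge0.
  apply: (@le_trans _ _ (34 * X%:R * rho r / Lam *
     ((4 * K)%:R ^+ k.+1 * 8 * (rho r) ^+ k.+1 / \prod_i lnn (Y i)) *
     (C1 * C2 * expR (1 - 2 ^+ r / 8) * Ssum R Y))).
    apply: ler_pM => //; first exact: mulr_ge0.
    by rewrite ler_wpM2l.
  have T0 : 0 <= K2 * (X%:R * Ssum R Y / (\prod_i lnn (Y i) * lnn Z)).
    by rewrite mulr_ge0 ?(ltW K20) // divr_ge0 ?mulr_ge0 // ltW.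
  apply: (@le_trans _ _ (K2 * (X%:R * Ssum R Y / (\prod_i lnn (Y i) * lnn Z)) *
      (2 ^+ (r.+1 * k.+2) * expR (1 - 2 ^+ r / 8)))).
    rewrite -rk /K2 /Lam; apply: eq_lew.
    move: ((4 * K)%:R ^+ k.+1) (rho r ^+ k.+1) (\prod_i lnn (Y i)) Pl0 (lnn Z) lZ (rho r) (expR _).
    by move=> a b c c0 d d0 e f; field; rewrite !gt_eqF.
  apply: le_trans (ler_wpM2l T0 cf) _.
  by apply: eq_lew; ring.
set M := X%:R * Ssum R Y / (\prod_i lnn (Y i) * lnn Z) in bound.
have M0 : 0 <= M.
  by rewrite divr_ge0 ?mulr_ge0 ?(ltW Pl0) ?(ltW lZ) // (le_trans _ (Ssum_ge1 R Y)).
apply: (@le_trans _ _ (\sum_(s : {perm 'I_k.+2}) \sum_(r < rmax.+1) \sum_(i < k.+1)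
   K2 * K1 * (1 / 2) ^+ r * M)).
  apply: (@le_trans _ _ (\sum_(s : {perm 'I_k.+2}) \sum_(r < rmax.+1) \sum_(i < k.+1)
    \sum_(p : {ffun 'I_k.+1 -> 'I_B}) \sum_(0 <= A < X.+1 | cA s r i A && val_ s r A p)
    \sum_(0 <= n < X.+1 | cn n A p) 1)); last first.
    by apply: ler_sum => s _; apply: ler_sum => r _; apply: ler_sum => i _; apply: bound.
  rewrite (_ : \sum_(s : {perm 'I_k.+2}) _ = \sum_(0 <= n < X.+1)
    \sum_(s : {perm 'I_k.+2}) \sum_(r < rmax.+1) \sum_(i < k.+1)
    \sum_(p : {ffun 'I_k.+1 -> 'I_B}) \sum_(0 <= A < X.+1 | cA s r i A && val_ s r A p)
    (if cn n A p then 1 else 0)); last first.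
    rewrite [RHS]exchange_big; apply: eq_bigr => s _.
    rewrite [RHS]exchange_big; apply: eq_bigr => r _.
    rewrite [RHS]exchange_big; apply: eq_bigr => i _.
    rewrite [RHS]exchange_big; apply: eq_bigr => p _.
    rewrite [RHS]exchange_big; apply: eq_bigr => A _.
    by rewrite big_mkcond.
  rewrite big_mkcond big_nat_cond [leRHS]big_nat_cond; apply: ler_sum => n /andP[/andP[_ nX] _].
  have ge A p : 0 <= (if cn n A p then 1 else 0 : R) by case: ifP.
  case: ifP => Gn; last first.
    by do 4 (apply: sumr_ge0 => ? _); apply: sumr_ge0 => ? _.
  have [s [r [i [p [A [AX hc hv hn]]]]]] := cover n nX Gn.
  rewrite (bigD1 s) //= (bigD1 r) //= (bigD1 i) //= (bigD1 p) //=.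
  rewrite -!addrA; apply: ler_wpDr.
    by rewrite !addr_ge0 //; do ?(apply: sumr_ge0 => ? _).
  have Ain : A \in index_iota 0 X.+1 by rewrite mem_index_iota.
  rewrite big_mkcond (bigD1_seq A) ?iota_uniq //= hc hv hn lerDl.
  by apply: sumr_ge0 => a _; case: ifP.
have -> : \sum_(s : {perm 'I_k.+2}) \sum_(r < rmax.+1) \sum_(i < k.+1) K2 * K1 * (1 / 2) ^+ r * M
  = #|{perm 'I_k.+2}|%:R * (k.+1%:R * (K2 * K1 * M * \sum_(0 <= r < rmax.+1) (1 / 2) ^+ r)).
  rewrite sumr_const -[_ *+ #|_|]mulr_natl; congr (_ * _).
  rewrite big_mkord !mulr_sumr; apply: eq_bigr => r _.
  by rewrite sumr_const card_ord -[_ *+ _]mulr_natl; congr (_ * _); ring.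
have gs := @geom_sum_le R (1 / 2) rmax.+1 ltac:(lra) ltac:(lra).
have gs2 : (1 - 1 / 2)^-1 = 2 :> R by field.
rewrite gs2 in gs.
apply: (@le_trans _ _ (#|{perm 'I_k.+2}|%:R * (k.+1%:R * (K2 * K1 * M * 2)))).
  rewrite ler_wpM2l // ler_wpM2l // ler_wpM2l // mulr_ge0 // mulr_ge0 // ltW //.
by rewrite /M; apply: eq_lew; ring.
Qed.

End UpperX.

(** [n] is known up to a factor 2 and [Pd] up to [c], so [q] is known up to [2c]; the second 2 pays
    for rounding [w]. *)
Lemma cofactor_window c PY Pd q n X w : (0 < PY)%N -> (PY <= Pd)%N -> (Pd <= c * PY)%N ->
  (Pd * q = n)%N -> (X < 2 * n)%N -> (n <= X)%N -> (0 < w)%N ->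
  (w = X %/ (2 * c * PY))%N -> (w < q <= 4 * c * w)%N.
Proof.
move=> PY0 h1 h2 h3 h4 h5 w0 wE.
have c0 : (0 < c)%N by move: h1 h2 PY0; case: c {wE}; lia.
have m0 : (0 < 2 * c * PY)%N by rewrite !muln_gt0 c0.
have u1 : (w * (2 * c * PY) <= X)%N by rewrite wE leq_trunc_div.
have u2 : (X < w.+1 * (2 * c * PY))%N by rewrite wE ltn_ceil.
apply/andP; split.
  rewrite -(ltn_pmul2r m0); apply: leq_ltn_trans u1 _; apply: leq_trans h4 _.
  rewrite -h3 mulnA [leqRHS]mulnC; apply: leq_mul => //.
  by rewrite -mulnA leq_mul2l h2 orbT.
rewrite -(leq_pmul2r PY0); apply: (@leq_trans X).
  by apply: leq_trans h5; rewrite -h3 mulnC leq_mul2r h1 orbT.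
apply: leq_trans (ltnW u2) _.
rewrite mulnA leq_mul2r; apply/orP; right.
have : (w.+1 <= 2 * w)%N by lia.
by rewrite -(leq_pmul2r (_ : (0 < 2 * c)%N)) ?muln_gt0 ?c0 // => h; apply: leq_trans h _; lia.
Qed.

(** The exponent is that of a power of 2 below [wl]; restricting to [s < a/2] keeps it above [a/8],
    the origin of the [1/8] in [upper_dyadic_block]. *)
Lemma dyadic_exponent a s k : (s < a./2)%N -> (4 * k.+3 <= a)%N ->
  (a.+1 <= 8 * (a - s - k - 2))%N /\ (a - s - k - 2 + s + k + 2 = a)%N.
Proof. by lia. Qed.

(** * Summation over dyadic blocks *)

Section Upper.
Variables (R : realType) (k : nat).
Local Notation lnn n := (ln (n%:R : R)).

Lemma gpow_le_exp j : exists2 K : R, 0 < K & forall v, gpow R j v <= K * 2 ^+ v.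
Proof.
have [K K0 HK] := gpow_series R j; exists K => // v.
have h : gpow R j v.+2 * (3 / 4) ^+ v <= K.
  apply: le_trans (HK v.+1); rewrite big_nat_recr //= lerDr.
  by apply: sumr_ge0 => i _; rewrite mulr_ge0 ?gpow_ge0 // exprn_ge0 //; lra.
have g2 : gpow R j v <= gpow R j v.+2.
  by apply: lerXn2r; rewrite ?nnegrE // ler_nat; lia.
have p0 : (0 : R) < (3 / 4) ^+ v by apply: exprn_gt0; lra.
apply: le_trans g2 _; rewrite -(ler_pM2r p0); apply: le_trans h _.
rewrite -mulrA -exprMn -[leLHS]mulr1 ler_wpM2l ?(ltW K0) //.
by apply: exprn_ege1; lra.
Qed.

Lemma count_le_nat m (Q : pred nat) :
  \sum_(0 <= n < m.+1 | (0 < n)%N && Q n) 1 <= m%:R :> R.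
Proof.
apply: (@le_trans _ _ (\sum_(n <- iota 1 m) (1 : R))).
  rewrite -[leLHS]big_filter; apply: sum_sub_le => //; first by rewrite filter_uniq // iota_uniq.
  move=> n; rewrite mem_filter mem_index_iota mem_iota add1n => /andP[/andP[-> _] h].
  by case/andP: h.
by rewrite big_const_seq count_predT size_iota iter_addr_0.
Qed.

Lemma dyadic_le (Q : pred nat) x S :
  \sum_(0 <= n < x.+1 | Q n) 1 <=
  \sum_(0 <= n < (x %/ 2 ^ S).+1 | Q n) 1 +
  \sum_(s < S) \sum_(0 <= n < (x %/ 2 ^ s).+1 |
      Q n && ((x %/ 2 ^ s) %/ 2 < n <= x %/ 2 ^ s)%N) 1 :> R.
Proof.
elim: S => [|S IH]; first by rewrite big_ord0 expn0 divn1 addr0.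
apply: le_trans IH _; rewrite big_ord_recr /= [X in _ <= _ + X]addrC addrA lerD2r.
have -> : (x %/ 2 ^ S.+1 = (x %/ 2 ^ S) %/ 2)%N by rewrite expnSr divnMA.
set X := (x %/ 2 ^ S)%N.
rewrite (bigID (fun n => (n <= X %/ 2)%N)) /=; apply: lerD.
  rewrite -[leLHS]big_filter -[leRHS]big_filter; apply: sum_sub_le => //.
    by rewrite filter_uniq // iota_uniq.
  by move=> n; rewrite !mem_filter !mem_index_iota => /andP[/andP[-> h] _]; rewrite ltnS.
rewrite -[leLHS]big_filter -[leRHS]big_filter; apply: sum_sub_le => //.
  by rewrite filter_uniq // iota_uniq.
move=> n; rewrite !mem_filter !mem_index_iota => /andP[/andP[-> h] h2].
by move: h h2; rewrite -ltnNge ltnS => -> ->.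
Qed.

Lemma upper_bound : exists2 C : R, 0 < C & forall (Y : 'I_k.+1 -> nat) x (P : pred nat),
  (forall i, (2 < Y i)%N) -> (forall i j : 'I_k.+1, (i <= j)%N -> (Y i <= Y j)%N) ->
  (2 ^ k.+1 * \prod_i Y i * Y ord_max <= x)%N ->
  (forall n, (0 < n)%N -> P n -> exists d : 'I_k.+1 -> nat,
     (\prod_i d i %| n)%N /\ forall i, (Y i < d i <= 4 * Y i)%N) ->
  \sum_(0 <= n < x.+1 | (0 < n)%N && P n) 1 <=
    C * x%:R * Ssum R Y / (\prod_i lnn (Y i) * lnn (Y ord_max)).
Proof.
have [C C0 HC] := upper_dyadic_block R k.
have [K K0 HK] := gpow_le_exp k.+2.
(* For bounded [Z]: all logarithms are bounded, and counting every [n <= x] suffices since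
   [Ssum >= 1]. *)
pose Ca : R := gpow R k.+2 (4 * k.+3).
have Ca0 : 0 < Ca by apply: lt_le_trans (gpow_ge1 _ _ _).
exists (Ca + (K + C * 2)).
  by rewrite !addr_gt0 // mulr_gt0.
move=> Y x P Y2 Ymono Hx HP.
set Z := Y ord_max in Hx *.
have Z0 : (0 < Z)%N by apply: leq_trans (Y2 _).
have Z1 : (1 < Z)%N by apply: ltnW; apply: Y2.
have lZ := lnn_gt0 R Z1.
have lY i : 0 < lnn (Y i) by apply: lnn_gt0; apply: ltnW; apply: Y2.
have lYZ i : lnn (Y i) <= lnn Z.
  by apply: lnn_le; [apply: leq_trans (Y2 i) | apply: Ymono; rewrite -ltnS].
have Pl0 : 0 < \prod_i lnn (Y i) by apply: prodr_gt0.
have PP0 : 0 < \prod_i lnn (Y i) * lnn Z by apply: mulr_gt0.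
have S1 := Ssum_ge1 R Y.
have S0 : 0 <= Ssum R Y by apply: le_trans S1.
pose M := x%:R * Ssum R Y / (\prod_i lnn (Y i) * lnn Z).
have M0 : 0 <= M by rewrite divr_ge0 ?mulr_ge0 // ltW.
have -> c : c * x%:R * Ssum R Y / (\prod_i lnn (Y i) * lnn Z) = c * M.
  by rewrite /M !mulrA.
pose a := trunc_log 2 Z.
have /andP[a1 a2] := trunc_log_bounds (isT : (1 < 2)%N) Z0.
rewrite -/a in a1 a2.
have lZa : lnn Z <= a.+1%:R * lnn 2.
  by rewrite -lnnX //; apply: lnn_le => //; apply: ltnW.
have lZa' : lnn Z <= a.+1%:R.
  by apply: le_trans lZa _; rewrite -[leRHS]mulr1 ler_wpM2l // ln2_le1.
have prodle (v : nat) : (a < 2 * v.+1)%N -> \prod_i lnn (Y i) * lnn Z <= gpow R k.+2 v.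
  move=> av; have lv : lnn Z <= (2 * v.+1)%:R by apply: le_trans lZa' _; rewrite ler_nat.
  rewrite /gpow exprSr; apply: ler_pM => //; rewrite ?(ltW Pl0) ?(ltW lZ) //.
  have -> : (2 * v.+1)%:R ^+ k.+1 = \prod_(i < k.+1) (2 * v.+1)%:R :> R.
    by rewrite prodr_const card_ord.
  apply: ler_prod => i _; rewrite (ltW (lY i)) /=; apply: le_trans (lYZ i) lv.
have [asmall|abig] := ltnP a (4 * k.+3).
  apply: le_trans (count_le_nat _ _) _.
  apply: (@le_trans _ _ (Ca * M)); last first.
    by rewrite ler_wpM2r // lerDl addr_ge0 ?mulr_ge0 // ltW.
  have av : (a < 2 * (4 * k.+3).+1)%N by move: asmall; clear; move: a => a'; lia.
  have h := prodle _ av.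
  rewrite /M mulrA ler_pdivlMr // [Ca * _]mulrC -mulrA ler_wpM2l //.
  by apply: le_trans h _; rewrite -/Ca; clear -S1 Ca0; nra.
(* The [n <= x / 2^(a/2)], about [x / sqrt Z], are estimated trivially. *)
pose S0' := a./2.
apply: le_trans (dyadic_le (fun n => (0 < n)%N && P n) x S0') _.
apply: (@le_trans _ _ (K * M + C * 2 * M)); last first.
  by rewrite -mulrDl ler_wpM2r // lerDr ltW.
apply: lerD.
  apply: le_trans (count_le_nat _ _) _.
  have av : (a < 2 * S0'.+1)%N by rewrite /S0'; clear; move: a => a'; lia.
  have h := prodle _ av.
  have h2 := le_trans h (HK S0').
  rewrite /M mulrA ler_pdivlMr //.
  apply: (@le_trans _ _ ((x %/ 2 ^ S0')%:R * (K * 2 ^+ S0'))); first by rewrite ler_wpM2l.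
  rewrite mulrCA [K * _ in leRHS]mulrA -mulrA ler_wpM2l ?(ltW K0) //.
  rewrite -natrX -natrM; apply: (@le_trans _ _ (x%:R * 1)).
    by rewrite mulr1 ler_nat leq_trunc_div.
  by rewrite ler_wpM2l.
have PY0 : (0 < \prod_i Y i)%N by apply: prodn_gt0 => i; apply: leq_trans (Y2 i).
apply: (@le_trans _ _ (\sum_(s < S0') C * M * (1 / 2) ^+ s)); last first.
  rewrite -mulr_sumr -(big_mkord xpredT (fun s => (1 / 2 : R) ^+ s)).
  have gs := @geom_sum_le R (1 / 2) S0' ltac:(lra) ltac:(lra).
  have gs2 : (1 - 1 / 2)^-1 = 2 :> R by field.
  rewrite gs2 in gs; rewrite [leRHS]mulrAC ler_wpM2l // mulr_ge0 // ltW //.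
apply: ler_sum => s _; set X := (x %/ 2 ^ s)%N.
pose c := (4 ^ k.+1)%N.
pose wl := (X %/ (2 * c * \prod_i Y i))%N.
pose e := (a - s - k - 2)%N.
have sS := ltn_ord s; rewrite /S0' in sS.
have [ea esk] := dyadic_exponent sS abig; rewrite -/e in ea esk.
(* Besides the product of the [Y_i], the hypothesis on [x] supplies [2^(k+1) * 2^a]; the block takes
   [2^s] and [2 c = 2^(2k+3)], which leaves [2^e]. *)
have we : (2 ^ e <= wl)%N.
  rewrite /wl /X -divnMA leq_divRL ?muln_gt0 ?expn_gt0 ?PY0 //.
  apply: leq_trans Hx.
  apply: (@leq_trans (2 ^ k.+1 * \prod_i Y i * 2 ^ a)); last by rewrite leq_mul2l a1 orbT.
  have cE : c = (2 ^ (2 * k.+1))%N by rewrite /c expnM.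
  have -> : (2 ^ e * (2 ^ s * (2 * c * \prod_i Y i)) =
     2 ^ (e + (s + (1 + 2 * k.+1))) * \prod_i Y i)%N by rewrite cE !expnD expn1; ring.
  have -> : (2 ^ k.+1 * \prod_i Y i * 2 ^ a = 2 ^ (k.+1 + a) * \prod_i Y i)%N.
    by rewrite expnD; ring.
  rewrite leq_mul2r; apply/orP; right; rewrite leq_exp2l // -esk.
  by clear; move: (nat_of_ord s) e => s' e'; lia.
have wl0 : (0 < wl)%N by apply: leq_trans we; rewrite expn_gt0.
have wlZ : 1 / 8 * lnn Z <= lnn wl.
  apply: (@le_trans _ _ (lnn (2 ^ e)%N)); last by apply: lnn_le => //; rewrite expn_gt0.
  rewrite lnnX //.
  have ea' : a.+1%:R <= 8 * e%:R :> R by rewrite -natrM ler_nat.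
  have l2 := ln_ge_half R.
  have : a.+1%:R * lnn 2 <= 8 * e%:R * lnn 2 by rewrite ler_wpM2r // lnn_ge0.
  by move: lZa; move: (lnn Z) (a.+1%:R) (e%:R) (lnn 2) => u v w t; lra.
have up := HC Y wl X (fun n => [&& (0 < n)%N && P n & (X %/ 2 < n <= X)%N]) Y2 Ymono wl0 wlZ _.
apply: le_trans (up _) _; last first.
  have -> : C * X%:R * Ssum R Y / (\prod_i lnn (Y i) * lnn Z) =
     C * (Ssum R Y / (\prod_i lnn (Y i) * lnn Z)) * X%:R by ring.
  have -> : C * M * (1 / 2) ^+ s = C * (Ssum R Y / (\prod_i lnn (Y i) * lnn Z)) * (x%:R * (1 / 2) ^+ s).
    by rewrite /M; ring.
  rewrite ler_wpM2l //.
    by rewrite mulr_ge0 ?(ltW C0) // divr_ge0 // ltW.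
  rewrite mul1r exprVn ler_pdivlMr ?exprn_gt0 // -natrX -natrM ler_nat.
  exact: leq_trunc_div.
move=> n /andP[/andP[n0 Pn] /andP[nX1 nX2]].
have [d [dn dY]] := HP n n0 Pn.
exists (ext d (n %/ \prod_i d i)%N); split.
- rewrite big_ord_recr /= ext_max.
  under eq_bigr => i _ do rewrite -/(wid i) ext_wid.
  by rewrite mulnC divnK.
- by move=> i; rewrite ext_wid; apply: dY.
rewrite ext_max (_ : 4 ^ k.+2 = 4 * c)%N; last by rewrite /c expnS.
apply: (@cofactor_window c (\prod_i Y i) (\prod_i d i) _ n X) => //.
- by apply: leq_prod => i _; case/andP: (dY i) => /ltnW.
- rewrite /c -[X in (4 ^ X)%N]card_ord -prod_nat_const -big_split /=.
  by apply: leq_prod => i _; case/andP: (dY i).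
- by rewrite mulnC divnK.
by move: nX1; clear; lia.
Qed.

End Upper.

(** * Comparison of the measures L with the cell counts *)

Section MeasureSum.
Local Open Scope classical_set_scope.
Local Open Scope ring_scope.

Section IterInt.
Variable R : realType.
Notation mu := (@lebesgue_measure R).

(** For nonnegative integrands the integral is a supremum over simple functions below, so
    monotonicity needs no measurability. The inner integrals of the indicator of [Lset] are thus
    never shown measurable. *)
Lemma ge0_le_integral_nonmeasurable (f g : R -> \bar R) : (forall x, (0 <= f x)%E) ->
  (forall x, (f x <= g x)%E) -> (\int[mu]_(x in setT) f x <= \int[mu]_(x in setT) g x)%E.
Proof.
move=> f0 fg; have g0 x : (0 <= g x)%E by apply: le_trans (fg x).
rewrite !ge0_integralTE //.
apply: ge_ereal_sup => _ /= [h hf <-]; apply: ereal_sup_ubound; exists h => // x.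
by apply: le_trans (hf x) (fg x).
Qed.

Lemma iter_leb_int_ge0 n (f : (nat -> R) -> \bar R) : (forall t, (0 <= f t)%E) ->
  (0 <= iter_leb_int n f)%E.
Proof.
elim: n f => [|n IH] f f0 //=.
by apply: integral_ge0 => s _; apply: IH.
Qed.

Lemma iter_leb_int_mono n (f g : (nat -> R) -> \bar R) : (forall t, (0 <= f t)%E) ->
  (forall t, (f t <= g t)%E) -> (iter_leb_int n f <= iter_leb_int n g)%E.
Proof.
elim: n f g => [|n IH] f g f0 fg //=.
apply: ge0_le_integral_nonmeasurable => s; first by apply: iter_leb_int_ge0.
exact: IH.
Qed.

Definition itvind (a b : R) (x : R) : R := \1_([set` `[a, b[] : set R) x.

Lemma itvindE a b x : itvind a b x = (((a <= x < b)%R : bool) : nat)%:R.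
Proof. by rewrite /itvind indicE mem_setE in_itv. Qed.

Lemma itvind_ge0 a b x : 0 <= itvind a b x.
Proof. by rewrite itvindE. Qed.

Lemma integral_itvind (T : Type) (s : seq T) (c : T -> R) (a b : T -> R) :
  (forall m, 0 <= c m) -> (forall m, a m <= b m) ->
  (\int[mu]_(x in setT) (\sum_(m <- s) c m * itvind (a m) (b m) x)%:E =
   (\sum_(m <- s) c m * (b m - a m))%:E)%E.
Proof.
move=> c0 ab.
under eq_integral do rewrite -sumEFin.
rewrite ge0_integral_sum //; last 2 first.
- move=> m; apply/measurable_EFinP; apply: measurable_funM; first exact: measurable_cst.
  by apply: measurable_indic; apply: measurable_itv.
- by move=> m x _; rewrite lee_fin mulr_ge0 // itvind_ge0.
rewrite -sumEFin; apply: eq_bigr => m _.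
under eq_integral do rewrite EFinM.
rewrite ge0_integralZl //; last 3 first.
- by apply/measurable_EFinP; apply: measurable_indic; apply: measurable_itv.
- by move=> x _; rewrite lee_fin itvind_ge0.
- by rewrite lee_fin.
  rewrite integral_indic //.
  rewrite setIT EFinM; congr (_ * _)%E; rewrite [LHS]lebesgue_measure_itv /= lte_fin.
  have := ab m; rewrite le_eqVlt => /orP[/eqP ->|->]; last by rewrite EFinB.
  by rewrite ltxx subrr.
Qed.

(** These are the functions between which the indicator of [Lset] is squeezed. Fixing one coordinate
    gives the same shape with new coefficients, hence the general [c]. *)
Lemma iter_leb_int_boxes n (T : Type) (s : seq T) (c : T -> R) (a b : T -> nat -> R) :
  (forall m, 0 <= c m) -> (forall m i, a m i <= b m i) ->
  iter_leb_int n (fun t =>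
    (\sum_(m <- s) c m * \prod_(1 <= i < n.+1) itvind (a m i) (b m i) (t i))%:E) =
  (\sum_(m <- s) c m * \prod_(1 <= i < n.+1) (b m i - a m i))%:E.
Proof.
elim: n c => [|n IH] c c0 ab.
  by rewrite /=; congr (_%:E); apply: eq_bigr => m _; rewrite !big_geq.
rewrite /=.
transitivity (\int[mu]_(u in setT)
   (\sum_(m <- s) (c m * \prod_(1 <= i < n.+1) (b m i - a m i))
       * itvind (a m n.+1) (b m n.+1) u)%:E)%E.
  apply: eq_integral => u _.
  rewrite -[RHS](_ : (\sum_(m <- s) (c m * itvind (a m n.+1) (b m n.+1) u) *
     \prod_(1 <= i < n.+1) (b m i - a m i))%:E = _); last first.
    by congr (_%:E); apply: eq_bigr => m _; rewrite mulrAC.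
  rewrite -IH => [|m|//]; last by rewrite mulr_ge0 // itvind_ge0.
  congr (iter_leb_int n _); apply: funext => t; congr (_%:E); apply: eq_bigr => m _.
  rewrite big_nat_recr //= eqxx -mulrA [X in _ = _ * X]mulrC; congr (_ * (_ * _)).
  rewrite big_nat_cond [RHS]big_nat_cond; apply: eq_bigr => i /andP[/andP[_ hi] _].
  by rewrite ltn_eqF.
rewrite integral_itvind //.
  congr (_%:E); apply: eq_bigr => m _.
  by rewrite [X in _ = _ * X]big_nat_recr //= mulrA.
move=> m; rewrite mulr_ge0 //; apply: prodr_ge0 => i _; by rewrite subr_ge0.
Qed.

End IterInt.

Section LkBounds.
Variables (R : realType) (k : nat).
Local Notation lnn n := (ln (n%:R : R)).

Definition nvec (d : nat -> nat) : {ffun 'I_k.+1 -> nat} := [ffun i : 'I_k.+1 => d i.+1].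
Definition vnat (T : Type) (d : {ffun 'I_k.+1 -> T}) (i : nat) : T := d (inord i.-1).

Lemma nvecK (d : {ffun 'I_k.+1 -> nat}) : nvec (vnat d) = d.
Proof. by apply/ffunP => i; rewrite ffunE /vnat /= inord_val. Qed.

(** From below, take one cube per cell: a point lies in at most [2^(k+1)] of them, so with weight
    [2^-(k+1)] their indicators stay under that of [Lset]. From above, every cube of the union lies
    in the box of side [2 log 2] attached to the cell of its [d]. *)
Lemma Lk_bounds (Y : 'I_k.+1 -> nat) A (a : nat -> nat) : (0 < A)%N ->
  (forall d : nat -> nat,
     ((forall i, (1 <= i <= k.+1)%N -> (0 < d i)%N) /\
      (forall i, (1 <= i <= k.+1)%N ->
         ((\prod_(1 <= j < i.+1) d j) %| (\prod_(1 <= j < i.+1) a j))%N))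
     <-> okd Y A (nvec d)) ->
  (((ln 2 / 2) ^+ k.+1 * FN R Y A)%:E <= Lk R k.+1 a <= ((2 * ln 2) ^+ k.+1 * FN R Y A)%:E)%E.
Proof.
move=> A0 Hd; rewrite /Lk /lebesgue_k.
have l2 := ln_ge_half R.
have SP t : Lset k.+1 a t <-> exists2 d : nat -> nat, okd Y A (nvec d) &
    forall i, (1 <= i <= k.+1)%N -> ln ((d i)%:R / 2) <= t i < ln ((d i)%:R : R).
  split=> [[d [d1 [d2 d3]]]|[d /Hd[d1 d2] d3]]; exists d => //.
  by apply/Hd.
have ind0 (t : nat -> R) : 0 <= \1_(Lset k.+1 a) t :> R by rewrite indicE.
have prod01 (al be : nat -> R) (t : nat -> R) :
  \prod_(1 <= i < k.+2) itvind (al i) (be i) (t i) =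
   ((all (fun i => (al i <= t i < be i)%R) (index_iota 1 k.+2) : bool) : nat)%:R.
  elim: (index_iota 1 k.+2) => [|i s IH]; first by rewrite big_nil.
  by rewrite big_cons IH itvindE -natrM mulnb.
apply/andP; split.
- have [dsel Hsel] : exists dsel : {ffun 'I_k.+1 -> nat} -> {ffun 'I_k.+1 -> nat},
      forall m, m \in Mlist Y A -> okd Y A (dsel m) /\ lgv (dsel m) = m.
    have H m : exists d, m \in Mlist Y A -> okd Y A d /\ lgv d = m.
      have [mM|_] := boolP (m \in Mlist Y A); last by exists m.
      by have /(MlistP _ _ A0)[d hd ->] := mM; exists d.
    by have [f Hf] := choice H; exists f.
  pose al m i : R := ln ((vnat (dsel m) i)%:R / 2).
  pose be m i : R := ln ((vnat (dsel m) i)%:R).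
  have albe m i : al m i <= be m i.
    rewrite /al /be; case: (vnat (dsel m) i) => [|d]; first by rewrite mul0r.
    have d0 : (0 : R) < d.+1%:R by rewrite ltr0n.
    rewrite ler_ln ?posrE ?divr_gt0 //; lra.
  pose c : R := (1 / 2) ^+ k.+1.
  have c0 : 0 <= c by apply: exprn_ge0; lra.
  have st := @iter_leb_int_boxes R k.+1 _ (Mlist Y A) (fun=> c) al be (fun=> c0) albe.
  have -> : ((ln 2 / 2) ^+ k.+1 * FN R Y A)%:E =
     (\sum_(m <- Mlist Y A) c * \prod_(1 <= i < k.+2) (be m i - al m i))%:E.
    congr (_%:E); rewrite /FN /Nt -sum1_size natr_sum mulr_sumr big_seq [RHS]big_seq.
    apply: eq_bigr => m mM; have [hd _] := Hsel m mM.
    rewrite mulr1 (eq_bigr (fun=> ln 2)).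
      by rewrite prodr_const_nat subSS subn0 -exprMn; congr (_ ^+ _); field.
    move=> i _; have d0 : (0 : R) < (vnat (dsel m) i)%:R by rewrite ltr0n (okd_gt0 _ hd).
    by rewrite /be /al ln_div ?posrE //; ring.
  rewrite -st; apply: iter_leb_int_mono => t; rewrite lee_fin.
    apply: sumr_ge0 => m _; rewrite mulr_ge0 //.
    by apply: prodr_ge0 => i _; apply: itvind_ge0.
  pose V := [seq m <- Mlist Y A | all (fun i => (al m i <= t i < be m i)%R) (index_iota 1 k.+2)].
  have -> : \sum_(m <- Mlist Y A) c * \prod_(1 <= i < k.+2) itvind (al m i) (be m i) (t i) =
     c * (size V)%:R.
    rewrite -mulr_sumr; congr (_ * _); rewrite -sum1_size natr_sum /V big_filter [RHS]big_mkcond.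
    by apply: eq_bigr => m _; rewrite prod01; case: all.
  have VP m : m \in V -> m \in Mlist Y A /\ forall i, (1 <= i <= k.+1)%N -> al m i <= t i < be m i.
    rewrite mem_filter => /andP[/allP h mM]; split => // j hj; apply: h.
    by rewrite mem_index_iota ltnS.
  have V2 : (size V <= 2 ^ k.+1)%N.
    (* [t] in the cube of [d] means [e^t < d <= 2 e^t] coordinatewise, so the integer [d] lies
       between [truncn (e^t) + 1] and its double. *)
    apply: (@size_two_values k.+1 _ (fun i => trunc_log 2 (Num.truncn (expR (t i.+1))).+1)).
      by rewrite filter_uniq // Mlist_uniq.
    move=> m i mV; have [mM /(_ i.+1)] := VP m mV.
    rewrite ltn_ord => /(_ isT); rewrite /al /be /vnat /= inord_val.
    have [hd mE] := Hsel m mM.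
    have -> : m i = trunc_log 2 (dsel m i) by rewrite -[in LHS]mE ffunE.
    have d0 : (0 < dsel m i)%N := okd_gt0 i hd.
    have d0' : (0 : R) < (dsel m i)%:R by rewrite ltr0n.
    move=> /andP[h1 h2].
    have e1 : (dsel m i)%:R / 2 <= expR (t i.+1).
      by rewrite -[leLHS]lnK ?posrE ?divr_gt0 // ler_expR.
    have e2 : expR (t i.+1) < (dsel m i)%:R by rewrite -[ltRHS]lnK ?posrE // ltr_expR.
    have e3 := truncnS_gt (expR (t i.+1)).
    have q1 : ((Num.truncn (expR (t i.+1))).+1 <= dsel m i)%N.
      by rewrite truncn_lt_nat ?expR_ge0.
    have q2 : (dsel m i <= (Num.truncn (expR (t i.+1))).+1.*2)%N.
      rewrite -(ler_nat R) -muln2 natrM; move: e1 e3.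
      by move: (expR _) ((dsel m i)%:R) ((Num.truncn _).+1%:R) => u v w; lra.
    by rewrite leq_trunc_log //= -trunc_log2_double //; apply: leq_trunc_log.
  rewrite indicE; case: (boolP (t \in Lset k.+1 a)) => [_|/negP tS].
    rewrite /c mul1r exprVn mulrC ler_pdivrMr ?exprn_gt0 // mul1r -natrX ler_nat //.
  have -> : V = [::].
    apply/eqP; rewrite -size_eq0 -leqn0 leqNgt -has_predT; apply/hasP => -[m mV _].
    have [mM h] := VP m mV; have [hd _] := Hsel m mM.
    apply: tS; rewrite in_setE; apply/SP; exists (vnat (dsel m)); first by rewrite nvecK.
    exact: h.
  by rewrite mulr0.
- pose al (m : {ffun 'I_k.+1 -> nat}) i : R := ((vnat m i)%:R - 1) * ln 2.
  pose be (m : {ffun 'I_k.+1 -> nat}) i : R := ((vnat m i)%:R + 1) * ln 2.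
  have albe m i : al m i <= be m i.
    by rewrite /al /be ler_wpM2r //; [apply: le_trans l2; lra | lra].
  have st := @iter_leb_int_boxes R k.+1 _ (Mlist Y A) (fun=> 1) al be (fun=> ler01) albe.
  have -> : ((2 * ln 2) ^+ k.+1 * FN R Y A)%:E =
     (\sum_(m <- Mlist Y A) 1 * \prod_(1 <= i < k.+2) (be m i - al m i))%:E.
    congr (_%:E); rewrite /FN /Nt -sum1_size natr_sum mulr_sumr.
    apply: eq_bigr => m _; rewrite mulr1 mul1r (eq_bigr (fun=> 2 * ln 2)).
      by rewrite prodr_const_nat subSS subn0.
    by move=> i _; rewrite /be /al; ring.
  rewrite -st; apply: iter_leb_int_mono => t; rewrite lee_fin //.
  have tm0 m : 0 <= 1 * \prod_(1 <= i < k.+2) itvind (al m i) (be m i) (t i).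
    by rewrite mul1r; apply: prodr_ge0 => i _; apply: itvind_ge0.
  rewrite indicE; case: (boolP (t \in Lset k.+1 a)) => [|_]; last by apply: sumr_ge0.
  rewrite in_setE => /SP[d hd ht].
  have mM : lgv (nvec d) \in Mlist Y A by apply/MlistP => //; exists (nvec d).
  rewrite (bigD1_seq _ mM (Mlist_uniq _ _)) /=.
  rewrite -[leLHS]addr0; apply: lerD; last by apply: sumr_ge0.
  rewrite mul1r prod01 ler1n lt0b; apply/allP => i; rewrite mem_index_iota => hi.
  have hi' : (1 <= i <= k.+1)%N by move: hi; rewrite ltnS.
  have iE : vnat (lgv (nvec d)) i = trunc_log 2 (d i).
    rewrite /vnat !ffunE inordK; last by lia.
    by rewrite prednK //; lia.
  have d0 : (0 < d i)%N.
    have := okd_gt0 (inord i.-1) hd; rewrite ffunE inordK; last by lia.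
    by rewrite prednK //; lia.
  have /andP[e1 e2] := trunc_log_bounds (isT : (1 < 2)%N) d0.
  have /andP[t1 t2] := ht i hi'.
  rewrite /al /be iE; apply/andP; split.
    apply: le_trans t1; rewrite ln_div ?posrE ?ltr0n // mulrBl mul1r lerD2r.
    by rewrite -lnnX //; apply: lnn_le => //; rewrite expn_gt0.
  apply: lt_le_trans t2 _; rewrite natr1 -lnnX //; apply: lnn_le => //.
  exact: ltnW.
Qed.

End LkBounds.

Lemma prodQ_sqfree Q n p : prime p -> ~~ (p ^ 2 %| prodQ Q n)%N.
Proof.
move=> pr; elim: n => [|n IH].
  have -> : prodQ Q 0 = 1%N by rewrite /prodQ big_mkcond big_nat1.
  rewrite dvdn1 expnS expn1; have := prime_gt1 pr; lia.
rewrite prodQS; case: ifP => [/andP[prn _]|_]; last by rewrite muln1.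
have [e|ne] := eqVneq p n.+1.
  rewrite -e expnS expn1 dvdn_pmul2r ?prime_gt0 // prime_dvd_prodQ //.
  by rewrite e ltnn.
rewrite Gauss_dvdl // coprimeXl // prime_coprime // dvdn_prime2 //.
Qed.

Lemma sqfree_dvd_prodQ m N : (0 < m)%N ->
  (forall p, prime p -> (p %| m)%N -> (p <= N)%N /\ ~~ (p ^ 2 %| m)%N) ->
  (m %| prodQ predT N)%N.
Proof.
move=> m0 H; apply/dvdn_partP => // p; rewrite mem_primes => /and3P[pr _ pm].
have [pN p2] := H p pr pm; rewrite p_part.
have -> : logn p m = 1%N.
  apply/eqP; rewrite eqn_leq; apply/andP; split.
    by rewrite leqNgt -pfactor_dvdn.
  by rewrite logn_gt0 mem_primes pr m0.
by rewrite expn1 prime_dvd_prodQ // pN.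
Qed.

(** * Encoding the vector [a] by the product [A] *)

Section Parts.
Variables (K : nat) (T : nat -> nat).
Hypothesis T0 : T 0%N = 1%N.
Hypothesis Tmono : forall i, (i < K)%N -> (T i <= T i.+1)%N.

Lemma Tmono_le i j : (i <= j)%N -> (j <= K)%N -> (T i <= T j)%N.
Proof.
elim: j => [|j IH]; first by rewrite leqn0 => /eqP ->.
rewrite leq_eqVlt ltnS => /orP[/eqP ->//|ij] jK.
by apply: leq_trans (IH ij (ltnW jK)) (Tmono jK).
Qed.

Definition prime_range i : nat_pred := [pred p | (T i.-1 < p <= T i)%N].
(** The coordinate [a_i] of [A], normalised to 1 outside [1..K] as in [Pstar_k], so that reindexing
    is an equality of functions. *)
Definition range_part (A i : nat) : nat := if (1 <= i <= K)%N then (A`_(prime_range i))%N else 1%N.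

Lemma eA_gt0 A i : (0 < range_part A i)%N.
Proof. by rewrite /range_part; case: ifP => // _; apply: part_gt0. Qed.

(** The ranges [(T_(i-1), T_i]] tile [(1, T_j]], and [T 0 = 1] loses no prime. *)
Lemma parts_prod A j : (0 < A)%N -> (j <= K)%N ->
  (\prod_(1 <= i < j.+1) range_part A i)%N = (A`_(below predT (T j)))%N.
Proof.
move=> A0; elim: j => [|j IH] jK.
  rewrite big_geq // T0 part_p'nat //; apply/pnatP => // p /prime_gt1 p1 _.
  by rewrite !inE andbT -ltnNge.
rewrite big_nat_recr //= IH ?(ltnW jK) // /range_part jK /=.
rewrite -[RHS](@partnC (below predT (T j))) ?part_gt0 // -!partnI; congr (_ * _)%N.
  apply: eq_partn => p; rewrite !inE !andbT; have := Tmono jK; lia.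
by apply: eq_partn => p; rewrite !inE /= !andbT -ltnNge andbC.
Qed.

Lemma parts_prod_full A : (A %| prodQ predT (T K))%N -> (\prod_(1 <= i < K.+1) range_part A i)%N = A.
Proof.
move=> AP; have A0 : (0 < A)%N by apply: dvdn_gt0 AP; apply: prodQ_gt0.
rewrite parts_prod // part_pnat_id //; apply/pnatP => // p pr pA.
have : (p %| prodQ predT (T K))%N by apply: dvdn_trans AP.
by rewrite prime_dvd_prodQ // !inE.
Qed.

Lemma partn_prod (s : seq nat) (a : nat -> nat) (pi : nat_pred) :
  (forall i, i \in s -> (0 < a i)%N) ->
  ((\prod_(i <- s) a i)`_pi = \prod_(i <- s) (a i)`_pi)%N.
Proof.
elim: s => [|i s IH] h; first by rewrite !big_nil partn1.
have hs j : j \in s -> (0 < a j)%N by move=> js; apply: h; rewrite inE js orbT.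
rewrite !big_cons partnM ?IH //; first by apply: h; rewrite mem_head.
by rewrite big_seq_cond; apply: prodn_cond_gt0 => j /andP[/hs].
Qed.

Lemma partn_rng_prod (a : nat -> nat) i : (1 <= i <= K)%N ->
  (forall j, (1 <= j <= K)%N -> (prime_range j).-nat (a j)) ->
  ((\prod_(1 <= j < K.+1) a j)`_(prime_range i))%N = a i.
Proof.
move=> hi ha; rewrite partn_prod; last first.
  by move=> j; rewrite mem_index_iota ltnS => /ha /andP[].
have iin : i \in index_iota 1 K.+1 by rewrite mem_index_iota ltnS.
rewrite (bigD1_seq i) ?iota_uniq //= part_pnat_id ?ha //.
rewrite big_seq_cond big1 ?muln1 // => j /andP[]; rewrite mem_index_iota ltnS => hj ne.
have aj := ha j hj; apply: part_p'nat; apply: sub_in_pnat aj => p _.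
rewrite !inE => hp; apply/negP => hp2; move: ne; rewrite neq_ltn => /orP[ji|ij].
  have : (T j <= T i.-1)%N by apply: Tmono_le; lia.
  by lia.
have : (T i <= T j.-1)%N by apply: Tmono_le; lia.
by lia.
Qed.

(** Since [a_1...a_i] is the [T_i]-smooth part of [A], the chain of divisibilities makes each [d_i]
    smooth. Conversely [d_1...d_i] is [T_i]-smooth and divides [A], so it divides that part. *)
Lemma lset_cond k (Y : 'I_k.+1 -> nat) A (d : nat -> nat) : K = k.+1 ->
  (forall i : 'I_k.+1, Y i = T i.+1) -> (A %| prodQ predT (T K))%N ->
  ((forall i, (1 <= i <= k.+1)%N -> (0 < d i)%N) /\
   (forall i, (1 <= i <= k.+1)%N ->
      ((\prod_(1 <= j < i.+1) d j) %| (\prod_(1 <= j < i.+1) range_part A j))%N))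
  <-> okd Y A (nvec k d).
Proof.
move=> KE YT AP; have A0 : (0 < A)%N by apply: dvdn_gt0 AP; apply: prodQ_gt0.
have prE : (\prod_(i < k.+1) nvec k d i = \prod_(1 <= j < k.+2) d j)%N.
  by rewrite big_add1 /= big_mkord; apply: eq_bigr => i _; rewrite ffunE.
split=> [[d0 dd]|/andP[dv /forallP sm]].
  apply/andP; split.
    by rewrite prE; have := dd k.+1; rewrite leqnn => /(_ isT); rewrite -KE parts_prod_full.
  apply/forallP => i; rewrite ffunE YT.
  have hi : (1 <= i.+1 <= k.+1)%N by rewrite ltn_ord.
  have := dd i.+1 hi; rewrite parts_prod ?KE // big_nat_recr //= => h.
  apply: pnat_dvd (dvdn_trans (dvdn_mull _ (dvdnn _)) h) _; exact: part_pnat.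
have smT j : (1 <= j <= k.+1)%N -> (below predT (T j)).-nat (d j).
  case: j => // j hj; have := sm (Ordinal hj); rewrite ffunE YT //.
split=> [j /smT /andP[]//|i /andP[i1 ik]].
rewrite parts_prod ?KE //.
have pn : (below predT (T i)).-nat (\prod_(1 <= j < i.+1) d j)%N.
  rewrite big_seq; elim/big_ind: _ => // [x y hx hy|j].
    by rewrite pnatM hx.
  rewrite mem_index_iota ltnS => hj.
  apply: sub_in_pnat (smT j _); last by lia.
  move=> p _; rewrite !inE !andbT => h; apply: leq_trans h _.
  by apply: Tmono_le; rewrite ?KE; lia.
rewrite -(part_pnat_id pn) partn_dvd //; apply: dvdn_trans dv.
rewrite prE [X in (_ %| X)%N](@big_cat_nat _ _ _ i.+1) //; exact: dvdn_mulr.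
Qed.

End Parts.

Section LsumFinite.
Variables (R : realType) (k : nat) (y : nat -> R).
Hypothesis y3 : 3 <= y 1%N.
Hypothesis ymono : forall i, (1 <= i < k.+1)%N -> y i <= y i.+1.

(** The value 1 at 0 matches [t_0 = 1]; elsewhere integer parts separate primes exactly as the [y_i]
    do. *)
Definition Ty i := if i == 0%N then 1%N else Num.truncn (y i).

Lemma y_ge3 i : (1 <= i <= k.+1)%N -> 3 <= y i.
Proof.
elim: i => // i IH hi; case: i IH hi => [|i] IH hi //.
by apply: le_trans (IH _) (ymono _); lia.
Qed.

Lemma Ty_mono i : (i < k.+1)%N -> (Ty i <= Ty i.+1)%N.
Proof.
case: i => [|i] hi; rewrite /Ty /=.
  by rewrite truncn_ge_nat; [apply: le_trans (y_ge3 _); rewrite ?ler1n | apply: le_trans (y_ge3 _)].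
by apply: le_truncn; apply: ymono.
Qed.

Lemma Pstar_bij :
  set_bij [set` divisors (prodQ predT (Ty k.+1))] (Pstar_k k.+1 y) (range_part k.+1 Ty).
Proof.
have PA A : [set` divisors (prodQ predT (Ty k.+1))] A -> (A %| prodQ predT (Ty k.+1))%N.
  by rewrite /= -dvdn_divisors ?prodQ_gt0.
have tl i p : (1 <= i <= k.+1)%N -> (p <= Ty i)%N = (p%:R <= y i).
  move=> hi; rewrite /Ty; case: i hi => // i hi /=.
  by rewrite truncn_ge_nat //; apply: le_trans (y_ge3 hi).
have tg i p : (1 <= i <= k.+1)%N -> prime p ->
   (Ty i.-1 < p)%N = ((if i == 1%N then 1 else y i.-1) < p%:R).
  move=> hi pr; case: i hi => // -[|i] hi /=; first by rewrite /Ty /= ltr1n.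
  by rewrite ltnNge tl ?ltNge //; lia.
split.
- move=> A /PA AP; have A0 : (0 < A)%N by apply: dvdn_gt0 AP; apply: prodQ_gt0.
  split=> [i hi|i hi]; last by rewrite /range_part (negbTE hi).
  split; first exact: eA_gt0.
  move=> p pr; rewrite /range_part hi => pA; split.
    apply/negP => h; have := @prodQ_sqfree predT (Ty k.+1) p pr; move/negP; apply.
    by apply: dvdn_trans AP; apply: dvdn_trans h (dvdn_part _ _).
  have := pnatPpi (part_pnat (prime_range Ty i) A); move=> /(_ p).
  rewrite mem_primes pr part_gt0 pA => /(_ isT); rewrite !inE => /andP[h1 h2].
  by rewrite -tg // h1 -tl // h2.
- move=> A B; rewrite !in_setE => /PA AP /PA BP e.
  by rewrite -(parts_prod_full (erefl _) Ty_mono AP) e parts_prod_full //; apply: Ty_mono.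
move=> a [a1 a2].
have arng j : (1 <= j <= k.+1)%N -> (prime_range Ty j).-nat (a j).
  move=> hj; have [aj0 H] := a1 j hj; apply/pnatP => // p pr pa.
  by have [_ /andP[h1 h2]] := H p pr pa; rewrite !inE tg // h1 tl.
have aE i : (1 <= i <= k.+1)%N -> ((\prod_(1 <= j < k.+2) a j)`_(prime_range Ty i))%N = a i.
  by move=> hi; apply: partn_rng_prod => //; apply: Ty_mono.
have a0 : (0 < \prod_(1 <= j < k.+2) a j)%N.
  rewrite big_seq; apply: prodn_cond_gt0 => j; rewrite mem_index_iota ltnS => /a1[].
  done.
exists (\prod_(1 <= j < k.+2) a j)%N; last first.
  apply: funext => i; rewrite /range_part; case: ifP => hi; first exact: aE.
  by rewrite a2 // hi.
rewrite /= -dvdn_divisors ?prodQ_gt0 //; apply: sqfree_dvd_prodQ => // p pr pA.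
have [i hi pai] : exists2 i, (1 <= i <= k.+1)%N & (p %| a i)%N.
  move: pA; rewrite Euclid_dvd_prod // big_has => /hasP[i].
  by rewrite mem_index_iota ltnS => hi pi; exists i.
have [aj0 H] := a1 i hi; have [h1 /andP[h2 h3]] := H p pr pai.
split.
  apply: (@leq_trans (Ty i)); first by rewrite tl.
  by apply: (Tmono_le (K := k.+1)) => //; [apply: Ty_mono | case/andP: hi].
apply: contra h1 => h; rewrite -(aE i hi).
have pn : (prime_range Ty i).-nat (p ^ 2)%N.
  by rewrite pnatX pnatE // !inE tg // h2 tl // h3.
by rewrite -(part_pnat_id pn) partn_dvd.
Qed.

Definition Yv (i : 'I_k.+1) : nat := Num.truncn (y i.+1).

(** Reindexed by [Pstar_bij] the sum is finite, so [Lsum] is a real number and [Lk_bounds] applies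
    term by term. *)
Lemma Lsum_bounds : exists2 l : R, Lsum k.+1 y = l%:E &
  (ln 2 / 2) ^+ k.+1 * Ssum R Yv <= l <= (2 * ln 2) ^+ k.+1 * Ssum R Yv.
Proof.
pose P := prodQ predT (Ty k.+1).
have P0 : (0 < P)%N by apply: prodQ_gt0.
have SE : Ssum R Yv = \sum_(A <- divisors P) FN R Yv A / A%:R by [].
have LkB A : A \in divisors P -> (((ln 2 / 2) ^+ k.+1 * FN R Yv A)%:E <=
    Lk R k.+1 (range_part k.+1 Ty A) <= ((2 * ln 2) ^+ k.+1 * FN R Yv A)%:E)%E.
  rewrite -dvdn_divisors // => AP.
  have A0 : (0 < A)%N by apply: dvdn_gt0 AP.
  by apply: Lk_bounds => // d; apply: (lset_cond _ Ty_mono).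
have LE : Lsum k.+1 y = (\sum_(A <- divisors P) Lk R k.+1 (range_part k.+1 Ty A) * (A%:R^-1)%:E)%E.
  rewrite /Lsum (@reindex_esum R _ _ _ _ _ _ Pstar_bij) esum_fset //; last 2 first.
  - exact: finite_seq.
  - move=> A _; rewrite mule_ge0 //; last by rewrite lee_fin invr_ge0; apply: prodr_ge0.
    by apply: iter_leb_int_ge0 => t; rewrite lee_fin indicE.
  rewrite -fsbig_seq ?divisors_uniq //= big_seq [RHS]big_seq; apply: eq_bigr => A.
  rewrite -dvdn_divisors // => AP.
  by rewrite -natr_prod parts_prod_full //; apply: Ty_mono.
pose lA A : R := fine (Lk R k.+1 (range_part k.+1 Ty A)).
have lAE A : A \in divisors P -> Lk R k.+1 (range_part k.+1 Ty A) = (lA A)%:E.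
  move=> AP; have /andP[h1 h2] := LkB A AP; rewrite fineK // fin_numE.
  apply/andP; split; first by rewrite gt_eqF // (lt_le_trans _ h1) // ltNyr.
  by rewrite lt_eqF // (le_lt_trans h2) // ltry.
exists (\sum_(A <- divisors P) lA A / A%:R).
  rewrite LE -sumEFin big_seq [RHS]big_seq; apply: eq_bigr => A AP.
  by rewrite lAE // EFinM.
rewrite SE !mulr_sumr; apply/andP; split; rewrite big_seq [leRHS]big_seq; apply: ler_sum => A AP;
  have := LkB A AP; rewrite lAE // !lee_fin => /andP[h1 h2];
  by rewrite mulrA ler_wpM2r ?invr_ge0.
Qed.

End LsumFinite.

End MeasureSum.

(** * The logarithmic factor and the counting function *)

Lemma succ_le_sqr m : (1 < m)%N -> (m.+1 <= m ^ 2)%N.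
Proof. by move=> m1; rewrite expnS expn1; nia. Qed.

Lemma lt_double_succ m d : (1 < m)%N -> (d < 2 * m.+1)%N -> (d <= 4 * m)%N.
Proof. by lia. Qed.

Section Final.
Variable R : realType.

Lemma ratio_prod_telescope (l : nat -> R) k : (forall i, (i <= k)%N -> l i != 0) ->
  \prod_(1 <= i < k.+1) (l i / l i.-1) = l k / l 0%N.
Proof.
elim: k => [|k IH] h; first by rewrite big_geq // divff ?h.
rewrite big_nat_recr //= IH => [|i ik]; last by apply: h; apply: leqW.
by field; rewrite !h.
Qed.

(** Passing from [k] to [k+1] raises every old exponent by 1, which multiplies by the inverse of a
    telescoping product. *)
Lemma ratio_prod_pow (l : nat -> R) k : (forall i, (i <= k)%N -> l i != 0) ->
  \prod_(1 <= i < k.+1) (l i / l i.-1) ^- (k - i + 2) * (\prod_(1 <= i < k.+1) l i * l k)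
  = l 0%N ^+ k.+1.
Proof.
elim: k => [|k IH] h; first by rewrite !big_geq // !mul1r expr1.
have h' i : (i <= k)%N -> l i != 0 by move=> ik; apply: h; apply: leqW.
have {}IH := IH h'.
rewrite big_nat_recr //= [\prod_(1 <= i < k.+2) l i]big_nat_recr //= subnn add0n.
have -> : \prod_(1 <= i < k.+1) (l i / l i.-1) ^- (k.+1 - i + 2) =
   \prod_(1 <= i < k.+1) (l i / l i.-1) ^- (k - i + 2) * (l k / l 0%N)^-1.
  rewrite -(ratio_prod_telescope h') -prodfV -big_split /= big_nat_cond [RHS]big_nat_cond.
  apply: eq_bigr => i /andP[hi _].
  by rewrite -invfM -exprSr; congr (_ ^-  _); lia.
rewrite [RHS]exprS -IH.
have n0 : l 0%N != 0 by apply: h.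
have nk : l k != 0 by apply: h.
have nk1 : l k.+1 != 0 by apply: h.
move: (\prod_(1 <= i < k.+1) (l i / l i.-1) ^- (k - i + 2)) (\prod_(1 <= i < k.+1) l i) => a b.
by rewrite expr2; field; rewrite ?n0 ?nk ?nk1.
Qed.

Lemma logprodE k (y : nat -> R) : (forall i, (1 <= i <= k.+1)%N -> 0 < ln (y i)) ->
  logprod k.+1 y = ln 3 ^+ k.+2 / (\prod_(i < k.+1) ln (y i.+1) * ln (y k.+1)).
Proof.
move=> ly; pose l i : R := if i == 0%N then ln 3 else ln (y i).
have l0 i : (i <= k.+1)%N -> l i != 0.
  by case: i => [|i] hi; rewrite /l /= gt_eqF // ?ly // ln_gt0 // ltr1n.
have n0 : \prod_(1 <= i < k.+2) l i * l k.+1 != 0.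
  rewrite mulf_neq0 ?l0 // big_add1 /= big_mkord.
  by apply/prodf_neq0 => i _; apply: l0.
have -> : \prod_(i < k.+1) ln (y i.+1) * ln (y k.+1) = \prod_(1 <= i < k.+2) l i * l k.+1.
  by rewrite big_add1 /= big_mkord.
apply: (canRL (mulfK n0)); rewrite -[ln 3]/(l 0%N) -(ratio_prod_pow l0); congr (_ * _).
rewrite /logprod big_nat_cond [RHS]big_nat_cond; apply: eq_bigr => i /andP[hi _].
have -> : l i = ln (y i) by rewrite /l; case: (i) hi.
congr ((_ / _) ^- _); rewrite /l; case: i hi => // -[|i] _ //=.
Qed.

Lemma HcountE k (x : R) (y : nat -> R) : 1 <= x ->
  exists2 P : pred nat,
   (forall n, P n <-> exists d : nat -> nat,
              (forall i, (1 <= i <= k)%N -> (0 < d i)%N) /\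
              ((\prod_(1 <= i < k.+1) d i) %| n)%N /\
              (forall i, (1 <= i <= k)%N -> y i < (d i)%:R <= 2 * y i)) &
   (Hcount k x y (fun i => 2 * y i))%:R =
   \sum_(0 <= n < (Num.truncn x).+1 | (0 < n)%N && P n) 1 :> R.
Proof.
move=> x1; pose P n := `[< exists d : nat -> nat,
              (forall i, (1 <= i <= k)%N -> (0 < d i)%N) /\
              ((\prod_(1 <= i < k.+1) d i) %| n)%N /\
              (forall i, (1 <= i <= k)%N -> y i < (d i)%:R <= 2 * y i) >].
exists P; first by move=> n; split=> [/asboolP|?] //; apply/asboolP.
rewrite /Hcount natr_sum big_mkord; apply: eq_bigl => n.
suff -> : (n%:R <= x) by rewrite andbT.
by rewrite -truncn_ge_nat ?(le_trans _ x1) // -ltnS.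
Qed.

End Final.

Theorem theorem1p7 (R : realType) (k : nat) (hk : (1 <= k)%N) :
  exists c1 c2 : R, 0 < c1 /\ 0 < c2 /\
  forall (x : R) (y : nat -> R),
    1 <= x ->
    3 <= y 1%N ->
    (forall i, (1 <= i < k)%N -> y i <= y i.+1) ->
    2 ^+ k * \prod_(1 <= i < k.+1) y i <= x / y k ->
    (c1%:E * ((logprod k y)%:E * Lsum k y)
       <= ((Hcount k x y (fun i => 2 * y i))%:R / x)%:E
     <= c2%:E * ((logprod k y)%:E * Lsum k y))%E.
Proof.
case: k hk => // k _.
have [cl cl0 Hl] := lower_bound R k; have [cu cu0 Hu] := upper_bound R k.
pose e3 : R := ln 3 ^+ k.+2.
have e30 : 0 < e3 by apply: exprn_gt0; apply: ln_gt0; rewrite ltr1n.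
have l2 : 0 < ln 2 :> R by apply: ln_gt0; rewrite ltr1n.
pose a1 : R := (ln 2 / 2) ^+ k.+1; pose a2 : R := (2 * ln 2) ^+ k.+1.
have a10 : 0 < a1 by apply: exprn_gt0; apply: divr_gt0.
have a20 : 0 < a2 by apply: exprn_gt0; apply: mulr_gt0.
pose t : R := 2 ^+ k.+2.
have t0 : 0 < t by apply: exprn_gt0.
(* [e3] comes from [logprod], [a1] and [a2] from [Lsum_bounds], the 2 from [x <= 2 truncn x], and
   [t = 2^(k+2)] from comparing the [k+2] logarithms of the [y_i] with those of their integer
   parts. *)
exists (cl / (2 * (e3 * a2))), (cu * t / (a1 * e3)).
split; first by rewrite divr_gt0 // mulr_gt0 // mulr_gt0.
split; first by apply: divr_gt0; apply: mulr_gt0.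
move=> x y x1 y3 ymono hxy.
have Y3 i : (1 <= i <= k.+1)%N -> 3 <= y i by apply: y_ge3.
have [l LE /andP[l1 l2']] := Lsum_bounds y3 ymono.
pose Y : 'I_k.+1 -> nat := @Yv R k y; rewrite -/Y -/a1 -/a2 in l1 l2'.
have i1 (i : 'I_k.+1) : (1 <= i.+1 <= k.+1)%N by rewrite ltn_ord.
have Yle (i : 'I_k.+1) : (Y i)%:R <= y i.+1 by rewrite truncn_le; apply: le_trans (Y3 _ (i1 i)).
have Ygt (i : 'I_k.+1) : y i.+1 < (Y i).+1%:R by apply: truncnS_gt.
have Y2 i : (2 < Y i)%N by rewrite truncn_ge_nat ?Y3 //; apply: le_trans (Y3 _ (i1 i)).
have Tm i : (i < k.+1)%N -> (Ty y i <= Ty y i.+1)%N by apply: Ty_mono.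
have Ym (i j : 'I_k.+1) : (i <= j)%N -> (Y i <= Y j)%N.
  by move=> ij; apply: (Tmono_le (K := k.+1) (T := Ty y) Tm (i := i.+1) (j := j.+1)).
have YZ i : (Y i <= Y ord_max)%N by apply: Ym; rewrite -ltnS.
set S := Ssum R Y in l1 l2'.
have S0 : 0 < S by apply: lt_le_trans (Ssum_ge1 R Y).
have lY i : 0 < ln ((Y i)%:R : R) by apply: lnn_gt0; apply: ltnW.
have ln_le (i : 'I_k.+1) : ln ((Y i)%:R : R) <= ln (y i.+1).
  rewrite ler_ln ?posrE // ?(lt_le_trans _ (Y3 _ (i1 i))) // ltr0n.
  exact: leq_trans (Y2 i).
have ln_ge (i : 'I_k.+1) : ln (y i.+1) <= 2 * ln ((Y i)%:R : R).
  have Y0 : (0 < Y i)%N by apply: leq_trans (Y2 i).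
  rewrite mulr_natl -lnXn ?ltr0n // ler_ln ?posrE ?exprn_gt0 ?ltr0n //.
    apply: (le_trans (ltW (Ygt i))); rewrite -natrX ler_nat.
    exact: succ_le_sqr (ltnW (Y2 i)).
  exact: lt_le_trans (Y3 _ (i1 i)).
pose PA : R := \prod_i ln ((Y i)%:R : R) * ln ((Y ord_max)%:R : R).
pose PL : R := \prod_(i < k.+1) ln (y i.+1) * ln (y k.+1).
have PA0 : 0 < PA by apply: mulr_gt0 => //; apply: prodr_gt0.
have ly0 i : 0 < ln (y (nat_of_ord (n := k.+1) i).+1) by apply: lt_le_trans (ln_le i).
have PAL : PA <= PL.
  apply: ler_pM; last exact: (ln_le ord_max).
  - by apply: prodr_ge0 => i _; apply: ltW.
  - exact: ltW.
  - by apply: ler_prod => i _; rewrite ltW //=.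
have PLA : PL <= t * PA.
  have -> : t * PA = \prod_i (2 * ln ((Y i)%:R : R)) * (2 * ln ((Y ord_max)%:R : R)).
    by rewrite big_split /= prodr_const card_ord /t /PA exprSr; ring.
  apply: ler_pM; last exact: (ln_ge ord_max).
  - by apply: prodr_ge0 => i _; apply: ltW.
  - exact: ltW (ly0 ord_max).
  - by apply: ler_prod => i _; rewrite ltW //=.
have PL0 : 0 < PL by apply: lt_le_trans PAL.
have LP : logprod k.+1 y = e3 / PL.
  apply: logprodE => i /andP[]; case: i => // i _ hi.
  exact: (ly0 (Ordinal hi)).
have l0 : 0 <= l by apply: le_trans l1; apply: mulr_ge0; apply: ltW.
have [P HP ->] := HcountE k.+1 y x1.
rewrite LE LP -!EFinM !lee_fin.
set x' := Num.truncn x.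
have x'1 : (0 < x')%N by rewrite truncn_gt0.
have x'le : x'%:R <= x by rewrite truncn_le (le_trans _ x1).
have x'ge : x <= 2 * x'%:R.
  by apply: (le_trans (ltW (truncnS_gt x))); rewrite -natrM ler_nat -/x' mul2n -addnn -addn1 leq_add2l.
have x0 : 0 < x by apply: lt_le_trans x1.
have yk0 : 0 < y k.+1 by apply: lt_le_trans (Y3 k.+1 _); rewrite ?leqnn.
have Hx : (2 ^ k.+1 * \prod_i Y i * Y ord_max <= x')%N.
  rewrite truncn_ge_nat ?(ltW x0) //; apply: le_trans (_ : _ <= 2 ^+ k.+1 * \prod_(1 <= i < k.+2) y i * y k.+1) _; last by rewrite -ler_pdivlMr.
  rewrite natrM natrM natrX natr_prod; apply: ler_pM => //.
    by apply: mulr_ge0; [apply: exprn_ge0|apply: prodr_ge0].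
  apply: ler_wpM2l; first exact: exprn_ge0.
  by rewrite big_add1 /= big_mkord; apply: ler_prod => i _; rewrite ler0n Yle.
set h := \sum_(_ <= _ < _ | _) _.
have HL : cl * x'%:R * S / PA <= h.
  apply: Hl => // n d n0 dn hd; apply/HP; exists (fun i => d (inord i.-1)).
  have dE (i : 'I_k.+1) : inord i = i :> 'I_k.+1 by apply: inord_val.
  split; [|split].
  - by move=> i _; have /andP[+ _] := hd (inord i.-1); apply: leq_trans.
  - by rewrite big_add1 /= big_mkord; under eq_bigr => i _ do rewrite dE.
  - case=> // i /andP[_ hi] /=; have /andP[d1 d2] := hd (inord i).
    have yi : y i.+1 = y (inord i : 'I_k.+1).+1 by rewrite inordK.
    have y0 : 0 <= y i.+1 by apply: le_trans (Y3 i.+1 hi).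
    rewrite yi; apply/andP; split; first by rewrite -truncn_lt_nat // -yi.
    apply: le_trans (_ : _ <= (2 * Y (inord i))%:R) _; first by rewrite ler_nat.
    by rewrite natrM ler_pM2l.
have HU : h <= cu * x'%:R * S / PA.
  apply: Hu => // n n0 /HP [d [_ [dn hd]]]; exists (fun i => d i.+1); split.
    by move: dn; rewrite big_add1 /= big_mkord.
  move=> i; have /andP[d1 d2] := hd i.+1 (i1 i).
  have y0 : 0 <= y i.+1 by apply: le_trans (Y3 i.+1 (i1 i)).
  apply/andP; split; first by rewrite truncn_lt_nat.
  (* [d <= 2 y < 2 (Y + 1)] may exceed [2 Y], which is why the upper bound allows [4 Y]. *)
  have : (d i.+1 < 2 * (Y i).+1)%N.
    by rewrite -(ltr_nat R); apply: (le_lt_trans d2); rewrite natrM ltr_pM2l.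
  by move=> lt; apply: lt_double_succ lt; apply: ltnW.
apply/andP; split.
- rewrite ler_pdivlMr //; apply: le_trans HL.
  have -> : cl / (2 * (e3 * a2)) * (e3 / PL * l) * x = (cl * l * x) / (2 * a2 * PL).
    by field; rewrite !gt_eqF.
  have -> : cl * x'%:R * S / PA = (cl * (a2 * S) * (2 * x'%:R)) / (2 * a2 * PA).
    by field; rewrite !gt_eqF.
  apply: ler_pM; first by do 2 (apply: mulr_ge0; last by rewrite ?l0 ?ltW); apply: ltW.
  - by rewrite invr_ge0 ltW // mulr_gt0 // mulr_gt0.
  - apply: ler_pM => //; [by apply: mulr_ge0 => //; apply: ltW|exact: ltW|].
    by rewrite ler_pM2l.
  - by rewrite lef_pV2 ?posrE ?ler_pM2l // mulr_gt0 // mulr_gt0.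
- rewrite ler_pdivrMr //; apply: (le_trans HU).
  have -> : cu * t / (a1 * e3) * (e3 / PL * l) * x = (cu * l * x * t) / (a1 * PL).
    by field; rewrite !gt_eqF.
  have -> : cu * x'%:R * S / PA = (cu * (a1 * S) * x'%:R * t) / (a1 * (t * PA)).
    by field; rewrite !gt_eqF.
  have tPA : 0 < t * PA by apply: mulr_gt0.
  have a1S : 0 < a1 * S by apply: mulr_gt0.
  apply: ler_pM.
  - by do 3 (apply: mulr_ge0; last by rewrite ?ler0n ?ltW); apply: ltW.
  - by rewrite invr_ge0 ltW // mulr_gt0.
  - rewrite ler_pM2r //; apply: ler_pM => //; first by apply: mulr_ge0; apply: ltW.
    by rewrite ler_pM2l.
  - by rewrite lef_pV2 ?posrE ?ler_pM2l // mulr_gt0.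
Qed.
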